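(* Let $P,Q\in\mathbb C(z)$ be non-constant rational functions and let $\gamma\subset\mathbb C$ be a curve containing no poles of $P$ or $Q$. Let $i_0\ge0$, $j_0\ge0$. Then the equalities $$\int_\gamma P^i(z)Q^j(z)Q'(z)\,dz=0$$ hold for all $i\ge i_0$, $j\ge j_0$ if and only if there exist rational functions $\tilde P,\tilde Q,W$ such that $$P(z)=\tilde P(W(z)),\qquad Q(z)=\tilde Q(W(z)),$$ the curve $W(\gamma)$ is closed, and the poles of $\tilde P$ and $\tilde Q$ lie on one side of the curve $W(\gamma)$. In particular, if these equalities hold for all $i\ge i_0$, $j\ge j_0$, then they hold for all $i\ge0$, $j\ge0$.
   Context: A curve is an oriented piecewise-smooth curve in $\mathbb C$ (closed or not) having only transversal self-intersections. $W(\gamma)$ is the image curve in $\mathbb{CP}^1$; it is closed if its starting and ending points coincide. Points $x_1,\dots,x_k\in\mathbb{CP}^1$ lie on one side of a curve if the curve is closed and homologous to zero in $\mathbb{CP}^1\setminus\{x_1,\dots,x_k\}$; here the set of points is the union of the sets of poles (in $\mathbb{CP}^1$) of $\tilde P$ and $\tilde Q$. *)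

(* Defs.v *)
From HB Require Import structures.
From mathcomp Require Import all_boot all_order all_algebra.
From mathcomp Require Import generic_quotient fraction complex.
From mathcomp Require Import all_classical all_reals all_analysis.

Set Implicit Arguments.
Unset Strict Implicit.
Unset Printing Implicit Defensive.

Import Order.TTheory GRing.Theory Num.Theory.
Import numFieldNormedType.Exports.

Local Open Scope classical_set_scope.
Local Open Scope ring_scope.
Local Open Scope quotient_scope.

(** ** Rational functions *)

Notation ratfun K := {fraction {poly K}}.

(* Numerator and denominator in lowest terms: [repr] need not be reduced. *)
Definition ratnum (K : fieldType) (f : ratfun K) : {poly K} :=
  (repr f).1 %/ gcdp (repr f).1 (repr f).2.

Definition ratden (K : fieldType) (f : ratfun K) : {poly K} :=
  (repr f).2 %/ gcdp (repr f).1 (repr f).2.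

Definition rat_nonconstant (K : fieldType) (f : ratfun K) : Prop :=
  forall c : K, f <> tofrac c%:P.

(* The value at a point which is not a pole; at a pole this is the junk
   value 0. *)
Definition rateval (K : fieldType) (f : ratfun K) (z : K) : K :=
  (ratnum f).[z] / (ratden f).[z].

Definition ratderiv (K : fieldType) (f : ratfun K) : ratfun K :=
  tofrac ((ratnum f)^`() * ratden f - ratnum f * (ratden f)^`())
    / tofrac (ratden f ^+ 2).

(** ** The Riemann sphere *)

(* [R[i]^o] is [R[i]] with the topology of its norm. [Some z] is the finite
   point z, and [None] is the point at infinity. *)
Notation CP1 R := (one_point_compactification R[i]^o).

(* At infinity, f = p / q has a pole if deg p > deg q, and otherwise the value
   p_d / q_d where d = deg q. *)
Definition ratmap (R : realType) (f : ratfun R[i]) (x : CP1 R) : CP1 R :=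
  match x with
  | Some z => if (ratden f).[z] == 0 then None else Some (rateval f z)
  | None =>
      if (size (ratnum f) <= size (ratden f))%N
      then Some ((ratnum f)`_(size (ratden f)).-1 / lead_coef (ratden f))
      else None
  end.

Definition poles (R : realType) (f : ratfun R[i]) : set (CP1 R) :=
  [set x | ratmap f x = None].

(** ** Curves in the complex plane *)

(* A curve is parametrized by [0, 1]; the values of the function outside of
   this interval are irrelevant. *)

Definition cderive (R : realType) (gamma : R -> R[i]) (t : R) : R[i] :=
  Complex (derive1 (fun s => complex.Re (gamma s)) t)
          (derive1 (fun s => complex.Im (gamma s)) t).

(* Regular C^1 arc on the closed interval [a, b]: the derivative on the open
   interval has a continuous nowhere vanishing extension to [a, b]. *)
Definition smooth_arc (R : realType) (gamma : R -> R[i]) (a b : R) : Prop :=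
  {within `[a, b], continuous (gamma : R -> R[i]^o)} /\
  exists g : R -> R[i],
    [/\ {within `[a, b], continuous (g : R -> R[i]^o)},
        forall t, t \in `[a, b] -> g t != 0 &
        forall t, t \in `]a, b[ ->
          [/\ derivable (fun s => complex.Re (gamma s)) t 1,
              derivable (fun s => complex.Im (gamma s)) t 1 &
              cderive gamma t = g t]].

Definition piecewise_smooth (R : realType) (gamma : R -> R[i]) : Prop :=
  exists s : seq R, itv_partition 0 1 s /\
    forall k : nat, (k < size s)%N ->
      smooth_arc gamma (nth 0 (0 :: s) k) (nth 0 s k).

(* u points along one of the (at most two) half-branches of the curve issued
   from the parameter t. *)
Definition half_tangent (R : realType) (gamma : R -> R[i]) (t : R)
    (u : R[i]) : Prop :=
  (t < 1 /\ (((h^-1)%:C%C * (gamma (t + h) - gamma t) : R[i]^o)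
               @[h --> (0 : R)^'+] --> (u : R[i]^o))) \/
  (0 < t /\ (((h^-1)%:C%C * (gamma (t - h) - gamma t) : R[i]^o)
               @[h --> (0 : R)^'+] --> (u : R[i]^o))).

(* The branches at two parameters of a multiple point have no half-tangent ray
   in common. Where gamma is differentiable the half-tangents are the two
   opposites +v and -v, so that this is the linear independence over the reals
   of the two tangent vectors. The pair (0, 1) is exempted: for a closed curve
   it is the base point and not a self-intersection. *)
Definition transversal_self_intersections (R : realType)
    (gamma : R -> R[i]) : Prop :=
  forall s t : R, 0 <= s -> s < t -> t <= 1 -> (s, t) <> (0, 1) ->
    gamma s = gamma t ->
    forall u v : R[i], half_tangent gamma s u -> half_tangent gamma t v ->
    forall k : R, 0 < k -> u <> k%:C%C * v.

Definition curve (R : realType) (gamma : R -> R[i]) : Prop :=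
  piecewise_smooth gamma /\ transversal_self_intersections gamma.

Definition contour_integral (R : realType) (gamma : R -> R[i])
    (f : R[i] -> R[i]) : R[i] :=
  Complex
    (Rintegral (@lebesgue_measure R) `[0, 1]
       (fun t => complex.Re (f (gamma t) * cderive gamma t)))
    (Rintegral (@lebesgue_measure R) `[0, 1]
       (fun t => complex.Im (f (gamma t) * cderive gamma t))).

(* The image W(gamma) in the sphere. *)
Definition image_curve (R : realType) (W : ratfun R[i])
    (gamma : R -> R[i]) : R -> CP1 R :=
  fun t => ratmap W (Some (gamma t)).

Definition closed_curve (R : realType) (X : Type) (c : R -> X) : Prop :=
  c 0 = c 1.

(** ** Singular homology in degree one *)

(* The standard 2-simplex, in the affine coordinates for which its vertices
   are v0 = (0, 0), v1 = (1, 0) and v2 = (0, 1). *)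
Definition simplex2 (R : realType) : set (R * R) :=
  [set x | [/\ 0 <= x.1, 0 <= x.2 & x.1 + x.2 <= 1]].

Definition singular1 (R : realType) (X : topologicalType) (A : set X)
    (c : R -> X) : Prop :=
  {within `[0, 1], continuous c} /\ c @` `[0, 1] `<=` A.

Definition singular2 (R : realType) (X : topologicalType) (A : set X)
    (sigma : R * R -> X) : Prop :=
  {within @simplex2 R, continuous sigma} /\ sigma @` @simplex2 R `<=` A.

Definition face0 (R : realType) (X : Type) (sigma : R * R -> X) : R -> X :=
  fun t => sigma (1 - t, t).
Definition face1 (R : realType) (X : Type) (sigma : R * R -> X) : R -> X :=
  fun t => sigma (0, t).
Definition face2 (R : realType) (X : Type) (sigma : R * R -> X) : R -> X :=
  fun t => sigma (t, 0).

(* The coefficient of the singular 1-simplex p in the chain 1 * c; as singular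
   simplices, c and p are functions on [0, 1] only. *)
Definition coef1 (R : realType) (X : Type) (c p : R -> X) : int :=
  (`[< forall t, t \in `[0, 1] -> c t = p t >] : nat)%:Z.

(* A singular 2-chain is given by the list of its terms (n, sigma), and the
   equality of its boundary with c in the free abelian group on the singular
   1-simplices is tested coefficient by coefficient. *)
Definition homologous_to_zero (R : realType) (X : topologicalType)
    (A : set X) (c : R -> X) : Prop :=
  singular1 A c /\
  exists B : seq (int * (R * R -> X)),
    (forall k : nat, (k < size B)%N ->
       singular2 A (nth (0, fun=> c 0) B k).2) /\
    forall p : R -> X,
      \sum_(b <- B)
        b.1 * (coef1 (face0 b.2) p - coef1 (face1 b.2) p + coef1 (face2 b.2) p)
      = coef1 c p.

Definition on_one_side (R : realType) (S : set (CP1 R))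
    (c : R -> CP1 R) : Prop :=
  closed_curve c /\ homologous_to_zero (~` S) c.

(* Main.v *)
Require Import Defs.
From HB Require Import structures.
From mathcomp Require Import all_boot all_order all_algebra.
From mathcomp Require Import generic_quotient fraction complex.
From mathcomp Require Import all_classical all_reals all_analysis.
From mathcomp Require Import ring lra zify.

Set Implicit Arguments.
Unset Strict Implicit.
Unset Printing Implicit Defensive.

Import Order.TTheory GRing.Theory Num.Theory.
Import numFieldNormedType.Exports.

Local Open Scope classical_set_scope.
Local Open Scope ring_scope.

(* Let W generate the field C(P, Q) (Lueroth), normalized so that Q = Qt(W) with a pole of
   Qt at infinity, and P = Pt(W). Then W, as well as 1 / (W - a) for a finite pole a of Pt or
   Qt, is integral over C[P, Q] and lies in its fraction field, so that C[P, Q] contains a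
   nonzero multiple of every polynomial in them. Hence the vanishing of the moments from
   (i0, j0) on gives a polynomial N <> 0 such that N(W) p(W) (W - a)^-j W' has integral 0 for
   all p and j. For a suitable p this integral is a nonzero multiple of W(gamma 1) - W(gamma 0)
   (Chinese remainders), so W(gamma) is closed; for another one it is the integral of
   W' / (W - a) up to a constant factor, so the winding number of W(gamma) around a is 0. A
   plane loop with winding number 0 around each of finitely many points is a boundary in their
   complement.
   Conversely, let Y = W or Y = 1 / (W - b) be a coordinate that is finite outside the poles
   of Pt and Qt. Then P^i Q^j Q' = g(Y) Y' where g has its poles among those of Pt and Qt. In
   the partial fractions of g all terms have a rational primitive except 1 / (Y - a), whose
   integral is the variation of the argument of Y - a; it vanishes because W(gamma) is
   homologous to zero off the poles. *)

(** Generating the whole field C(P, Q) is what puts W, and not merely some power of it, into the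
    fraction field of C[P, Q]. Clearing the denominators of finitely many powers of W and 1 / (W -
    a) then multiplies all their powers into C[P, Q], because integrality rewrites high powers by
    low ones. The bounds [i0] and [j0] cost only one more factor P^i0 Q^j0, which is absorbed into
    N. The zeros of N do no harm: a polynomial whose derivative is a multiple of N can still take
    different values at two given points, and a zero of N at a is offset by a higher power of 1 / (W
    - a). The pole of Qt at infinity keeps W finite on the curve, since Q would be infinite wherever
    W is. In the converse W(gamma) may run through infinity when infinity is not a pole; this is why
    a second coordinate 1 / (W - b) is required, with b a pole of Qt and hence off the curve.
    Homology is given by the equality of coefficients of formal sums of paths. Geometry enters
    through functions of paths, such as the variation of the argument, which extend additively to
    chains. *)

Section BivariateGauss.
Variable K : closedFieldType.
Implicit Types (M N G : {poly {poly K}}) (e : {poly K}).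

(** For [M] read as a polynomial in T over K[z] this is primitivity: since [K] is algebraically
    closed, a nonconstant common divisor of the coefficients would have a root. *)
Definition zprimitive_poly M := forall a : K, exists i, (M`_i).[a] != 0.

Lemma poly2_factor_XsubC M (a : K) : (forall i, (M`_i).[a] = 0) ->
  exists M', M = ('X - a%:P) *: M'.
Proof.
move=> h; exists (\poly_(i < size M) (M`_i %/ ('X - a%:P))).
apply/polyP => i; rewrite coefZ coef_poly; case: ltnP => [_|lei].
  by rewrite mulrC divpK // dvdp_XsubCl; apply/rootP.
by rewrite mulr0 nth_default.
Qed.

(** Extracting a common root of the coefficients lowers the degree of the leading one, so the
    extraction stops. *)
Lemma primitive_part M : M != 0 ->
  exists e M', [/\ e != 0, M = e *: M' & zprimitive_poly M'].
Proof.
have [n] := ubnP (size (lead_coef M)); elim: n M => // n IH M ltn M0.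
have [h|] := pselect (zprimitive_poly M).
  by exists 1, M; rewrite oner_eq0 scale1r.
move=> /existsNP[a /forallNP h].
have [|M1 E] := @poly2_factor_XsubC M a.
  by move=> i; have /negP := h i; rewrite negbK => /eqP.
have M10 : M1 != 0 by apply: contraNneq M0 => M10; rewrite E M10 scaler0.
have [|e [M' [e0 E' pM']]] := IH M1 _ M10.
  move: ltn; rewrite E lead_coefZ mulrC size_Mmonic ?monicXsubC ?lead_coef_eq0 //.
  by rewrite size_XsubC addn2.
by exists (('X - a%:P) * e), M'; rewrite mulf_neq0 ?polyXsubC_eq0 // -scalerA -E'.
Qed.

(** Gauss's lemma. For a root a of [e], the product [M * N] vanishes modulo z - a while [M] does
    not; hence z - a divides [N] and cancels from [e]. *)
Lemma primitive_cancel M N G e : e != 0 -> zprimitive_poly M ->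
  e *: G = M * N -> exists H, G = M * H.
Proof.
have [n] := ubnP (size e); elim: n e N => // n IH e N lte e0 pM E.
have [/eqP/size_poly1P[c c0 ec]|se] := eqVneq (size e) 1%N.
  exists ((c^-1)%:P *: N); rewrite -scalerAr -E ec scalerA -polyCM mulVf //.
  by rewrite scale1r.
have [a /factor_theorem[e' Ee]] := closed_rootP _ se.
have [|N' EN] := @poly2_factor_XsubC N a.
  have EVC : map_poly (horner_eval a) M * map_poly (horner_eval a) N = 0.
    rewrite -rmorphM -E Ee; apply/polyP => i.
    by rewrite coef0 coef_map coefZ /= /horner_eval !hornerE subrr !(mulr0,mul0r).
  move: EVC => /eqP; rewrite mulf_eq0 => /orP[] /eqP /polyP h.
    by have [j] := pM a; move: (h j); rewrite coef0 coef_map /= /horner_eval => ->; rewrite eqxx.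
  by move=> i; move: (h i); rewrite coef0 coef_map.
have e'0 : e' != 0 by apply: contraNneq e0; rewrite Ee => ->; rewrite mul0r.
apply: (IH e' N') => //.
  by move: lte; rewrite Ee size_Mmonic ?monicXsubC // size_XsubC addn2.
have X0 : ('X - a%:P) != 0 :> {poly K} by rewrite polyXsubC_eq0.
have : ('X - a%:P) *: (e' *: G - M * N') = 0.
  by rewrite scalerBr scalerA mulrC -Ee E EN scalerAr subrr.
by move/eqP; rewrite -mul_polyC mulf_eq0 polyC_eq0 (negPf X0) subr_eq0 => /eqP.
Qed.

End BivariateGauss.

(** * Lueroth's theorem *)

Section Luroth.
Variables (K : closedFieldType) (F L : fieldType).
Variables (phi : {rmorphism {poly K} -> F}) (iota : {rmorphism L -> F}).
Variable c : {rmorphism K -> L}.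
Hypothesis phi_inj : injective phi.
Hypothesis phi_frac : forall f, exists p q, q != 0 /\ f = phi p / phi q.
Hypothesis iota_c : forall x, iota (c x) = phi x%:P.
Hypothesis L_nonconstant : exists l : L, forall x, l != c x.

Local Notation z := (phi 'X).

Lemma phi_eq0 p : (phi p == 0) = (p == 0).
Proof. by rewrite -(inj_eq phi_inj) rmorph0. Qed.

Lemma horner_generic u : (map_poly iota (map_poly c u)).[z] = phi u.
Proof.
elim/poly_ind: u => [|u x IH]; first by rewrite !rmorph0 horner0.
by rewrite !rmorphD !rmorphM /= !map_polyX !map_polyC /= !hornerE IH iota_c.
Qed.

Lemma poly_common_denominator (N : {poly F}) :
  exists e M, e != 0 /\ phi e *: N = map_poly phi M.
Proof.
elim/poly_ind: N => [|N x [e [M [e0 E]]]].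
  by exists 1, 0; rewrite oner_eq0 scaler0 rmorph0.
have [p [q [q0 ->]]] := phi_frac x.
exists (q * e), ((q *: M) * 'X + (e * p)%:P); rewrite mulf_neq0 //; split => //.
rewrite [map_poly _ _]rmorphD /= [map_poly phi (_ * _)]rmorphM /= map_polyX map_polyC.
have -> : map_poly phi (q *: M) = phi q *: map_poly phi M.
  by apply/polyP => i; rewrite !(coefZ, coef_map) /= rmorphM.
have qF : phi q != 0 by rewrite phi_eq0.
rewrite /= -E !rmorphM -!mul_polyC mulrDr mulrA -!polyCM mulrA; congr (_ + _%:P); last by field.
by ring.
Qed.

(** A nonconstant l = p / q in [L] makes [z] algebraic over [L], as a root of p(T) - l q(T). *)
Lemma generic_minpoly : exists m : {poly L},
  [/\ m \is monic, (map_poly iota m).[z] = 0 &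
     forall p, (map_poly iota p).[z] = 0 -> m %| p].
Proof.
pose P n := `[< exists p : {poly L},
   [/\ p != 0, (map_poly iota p).[z] = 0 & size p = n] >].
have exP : exists n, P n.
  have [l nl] := L_nonconstant; have [p [q [q0 E]]] := phi_frac (iota l).
  exists (size (map_poly c p - l *: map_poly c q)); apply/asboolP.
  exists (map_poly c p - l *: map_poly c q); split => //.
    (* Were this polynomial zero, [l] would be the constant p_j / q_j at an index where [q] has a
       nonzero coefficient. *)
    apply/eqP => /polyP H; have [j qj] : exists j, q`_j != 0.
      by exists (size q).-1; rewrite -lead_coefE lead_coef_eq0.
    have /negP := nl (p`_j / q`_j); apply.
    move: (H j); rewrite coefB coefZ !coef_map coef0 => /eqP.
    rewrite subr_eq0 => /eqP E1; rewrite fmorph_div E1 mulfK //.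
    by rewrite fmorph_eq0.
  rewrite rmorphB /= map_polyZ !hornerE !horner_generic E mulfVK ?subrr //.
  by rewrite phi_eq0.
case: (ex_minnP exP) => n /asboolP[m [m0 mz sm]] minn.
exists ((lead_coef m)^-1 *: m); split.
- by rewrite monicE lead_coefZ mulVf ?lead_coef_eq0.
- by rewrite map_polyZ hornerZ mz mulr0.
move=> p pz; rewrite dvdpZl ?invr_eq0 ?lead_coef_eq0 //.
apply/negPn/negP => ndv; have := ltn_modp p m; rewrite m0 ltnNge => /negP; apply.
rewrite sm; apply: minn; apply/asboolP; exists (p %% m); split => //.
move: pz; rewrite {1}(divp_eq p m) rmorphD rmorphM /= hornerD hornerM mz mulr0 add0r.
by [].
Qed.

Lemma generic_minpoly_primitive (m : {poly L}) : m \is monic ->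
  exists M d, [/\ d != 0, zprimitive_poly M, d = lead_coef M &
    map_poly phi M = phi d *: map_poly iota m].
Proof.
move=> mm; have [e [M0 [e0 E0]]] := poly_common_denominator (map_poly iota m).
have m0 : map_poly iota m != 0 by rewrite map_poly_eq0 monic_neq0.
have M00 : M0 != 0.
  apply: contraNneq m0 => M00; move/eqP: E0; rewrite M00 rmorph0 -mul_polyC mulf_eq0.
  by rewrite polyC_eq0 phi_eq0 (negPf e0).
have [e' [M [e'0 EM pM]]] := primitive_part M00.
have E : map_poly phi M = (phi e / phi e') *: map_poly iota m.
  have e'F : phi e' != 0 by rewrite phi_eq0.
  by rewrite mulrC -scalerA E0 EM map_polyZ scalerA mulVf // scale1r.
have M0' : M != 0 by apply: contraNneq M00; rewrite EM => ->; rewrite scaler0.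
have sphi : phi (lead_coef M) = phi e / phi e'.
  rewrite -(lead_coef_map_inj phi_inj (rmorph0 _)) E lead_coefZ lead_coef_map.
  by rewrite (monicP mm) rmorph1 mulr1.
by exists M, (lead_coef M); rewrite lead_coef_eq0 M0' sphi.
Qed.

(** Otherwise [z] would be algebraic over [K], against the injectivity of [phi]. Such a coefficient
    will generate [L]. *)
Lemma minpoly_nonconstant_coef (m : {poly L}) : m \is monic ->
  (map_poly iota m).[z] = 0 -> exists k, forall x, m`_k != c x.
Proof.
move=> mm mz; apply: contrapT => /forallNP h.
have [x hx] : {x : nat -> K & forall k, m`_k = c (x k)}.
  apply: (@choice _ _ (fun k y => m`_k = c y)) => k.
  by have /existsNP[y /negP] := h k; rewrite negbK => /eqP; exists y.
have Em : m = map_poly c (\poly_(i < size m) x i).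
  apply/polyP => i; rewrite coef_map coef_poly; case: ltnP => // lei.
  by rewrite raddf0 nth_default.
move: mz; rewrite Em horner_generic => /eqP; rewrite phi_eq0 => /eqP E0.
by move: (monic_neq0 mm); rewrite Em E0 rmorph0 eqxx.
Qed.

Lemma coef_bilinear_antisym (f g : {poly K}) :
  let G := map_poly polyC f * g%:P - map_poly polyC g * f%:P in
  forall i j, G`_i`_j = f`_i * g`_j - g`_i * f`_j.
Proof.
by move=> G i j; rewrite coefB !coefMC !coef_map coefB !coefCM.
Qed.

(* Comparing degrees in the inner variable shows that the primitive minimal
   polynomial is the antisymmetric form [f(T) g(z) - f(z) g(T)]. *)
Lemma minpoly_antisym (m : {poly L}) : m \is monic ->
    (map_poly iota m).[z] = 0 ->
    (forall p, (map_poly iota p).[z] = 0 -> m %| p) ->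
  exists (w : L) (f g : {poly K}), [/\ forall x, w != c x, g != 0,
    phi f = iota w * phi g &
    size m = size (map_poly polyC f * g%:P - map_poly polyC g * f%:P)].
Proof.
move=> mm mz mdiv.
have [M [d [d0 pM dM EM]]] := generic_minpoly_primitive mm.
have [k hk] := minpoly_nonconstant_coef mm mz; set w := m`_k in hk.
(* [w] is the quotient of a coefficient of [M] by its leading coefficient [d]; f / g is this
   quotient in lowest terms. *)
pose h := gcdp M`_k d; pose f := M`_k %/ h; pose g := d %/ h.
have h0 : h != 0 by rewrite gcdp_eq0 negb_and d0 orbT.
have Ef : M`_k = f * h by rewrite divpK // dvdp_gcdl.
have Eg : d = g * h by rewrite divpK // dvdp_gcdr.
have g0 : g != 0 by apply: contraNneq d0 => g0; rewrite Eg g0 mul0r.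
have cfg : coprimep f g by rewrite coprimep_div_gcd // d0 orbT.
have fw : phi f = iota w * phi g.
  have hF : phi h != 0 by rewrite phi_eq0.
  have := congr1 (fun p : {poly F} => p`_k) EM; rewrite coefZ !coef_map /= -/w Ef Eg !rmorphM.
  by move=> E; apply: (mulIf hF); rewrite E; ring.
exists w, f, g; split => //.
pose G := map_poly polyC f * g%:P - map_poly polyC g * f%:P; rewrite -/G.
have GE i j : G`_i`_j = f`_i * g`_j - g`_i * f`_j by exact: coef_bilinear_antisym.
have G0 : G != 0.
  apply: contraTneq (g0) => GE0; rewrite negbK; apply/eqP.
  pose j := (size g).-1.
  have gj : g`_j != 0 by rewrite -lead_coefE lead_coef_eq0.
  have /negP := hk (f`_j / g`_j); case.
  have E : f * (g`_j)%:P = g * (f`_j)%:P.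
    apply/polyP => i; rewrite !coefMC; apply/eqP; rewrite -subr_eq0 -GE GE0.
    by rewrite !coef0.
  have pg : phi g != 0 by rewrite phi_eq0.
  have pj : iota (c g`_j) != 0 by rewrite !fmorph_eq0.
  apply/eqP/(fmorph_inj iota); rewrite !fmorph_div -/w.
  apply: (mulIf pg); rewrite -fw; apply: (mulIf pj).
  by rewrite iota_c -rmorphM E rmorphM -!iota_c; field.
have mG : m %| map_poly c f - w *: map_poly c g.
  apply: mdiv; rewrite rmorphB /= map_polyZ !hornerE !horner_generic fw subrr //.
have [q Eq] := dvdpP _ _ mG.
have PG : map_poly phi G = phi g *: map_poly iota (map_poly c f - w *: map_poly c g).
  apply/polyP => i; rewrite coefZ !coef_map /= !(coefB, coefMC, coefZ, coef_map).
  by rewrite /= !(rmorphB, rmorphM) /= !iota_c fw; ring.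
have [e [N [e0 EN]]] := poly_common_denominator (map_poly iota q).
(* Over [L] the minimal polynomial divides f(T) - w g(T); the primitivity of [M] turns this into
   divisibility in K[z][T]. *)
have [H EH] : exists H, G = M * H.
  apply: (@primitive_cancel _ M (g *: N) G (e * d)) => //; first exact: mulf_neq0.
  apply: (map_inj_poly phi_inj (rmorph0 _)).
  have mZ a (A : {poly {poly K}}) : map_poly phi (a *: A) = phi a *: map_poly phi A.
    by apply/polyP => i; rewrite !(coefZ, coef_map) /= rmorphM.
  rewrite mZ PG Eq [in RHS]rmorphM /= mZ EM -EN rmorphM [map_poly _ (_ * _)]rmorphM /=.
  by rewrite -!mul_polyC rmorphM; ring.
have M0 : M != 0 by apply: contraNneq G0 => M0; rewrite EH M0 mul0r.
have H0 : H != 0 by apply: contraNneq G0 => H0; rewrite EH H0 mulr0.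
(* [swapXY] exchanges T and z, so that its size measures the degree in z. This degree is bounded
   below through coefficients of [M] that are multiples of [f] and [g]. *)
have szM : (maxn (size f) (size g) <= size (swapXY M))%N.
  have step (p : {poly K}) j : (forall i, p`_i != 0 -> M`_j`_i != 0) -> (size p <= size (swapXY M))%N.
    move=> hp; have [->|p0] := eqVneq p 0; first by rewrite size_poly0.
    have := hp (size p).-1; rewrite -lead_coefE lead_coef_eq0 => /(_ p0) E.
    rewrite -(prednK (_ : 0 < size p)%N) ?size_poly_gt0 // ltnNge; apply/negP => le.
    by move: E; rewrite -coef_swapXY (nth_default _ le) coef0 eqxx.
  have szd (p q' : {poly K}) : q' != 0 -> (size p <= size (p * q')%R)%N.
    move=> q0; have [->|p0] := eqVneq p 0; first by rewrite size_poly0.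
    by apply: dvdp_leq; rewrite ?mulf_neq0 // dvdp_mulr.
  rewrite geq_max; apply/andP; split.
    apply: leq_trans (step M`_k k _) => //.
    by rewrite Ef; apply: szd.
  apply: leq_trans (step d (size M).-1 _) => //; first by rewrite Eg; apply: szd.
  by rewrite dM /lead_coef.
have szG : (size (swapXY G) <= maxn (size f) (size g))%N.
  apply/leq_sizeP => j; rewrite geq_max => /andP[lef leg].
  apply/polyP => i; rewrite coef0 coef_swapXY GE.
  by rewrite (nth_default _ lef) (nth_default _ leg) !mulr0 subrr.
(* In z, the degree of [G] does not exceed that of its factor [M], so the cofactor [H] is free of
   z. *)
have [hh EHH] : exists hh, swapXY H = hh%:P.
  exists (swapXY H)`_0; apply: size1_polyC.
  have := leq_trans szG szM; rewrite EH rmorphM /= size_mul ?swapXY_eq0 //.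
  rewrite -ltnS prednK ?addn_gt0 ?size_poly_gt0 ?swapXY_eq0 ?M0 //.
  by rewrite -[X in (_ <= X)%N]addn1 leq_add2l.
have EHm : H = map_poly polyC hh by rewrite -[H]swapXYK EHH swapXY_polyC.
(* At a root a of [hh] one has f(a) g = g(a) f, where f(a) and g(a) are not both 0 by coprimality;
   then g = 0 or w = f / g is constant. *)
have hh1 : size hh = 1%N.
  apply/eqP/negPn/negP => /closed_rootP[a /rootP ha].
  have prop j : f.[a] * g`_j = g.[a] * f`_j.
    have : swapXY G = swapXY M * hh%:P by rewrite EH rmorphM /= EHH.
    move=> /(congr1 (fun p : {poly {poly K}} => (p`_j).[a])).
    rewrite coefMC hornerM ha mulr0.
    suff -> : (swapXY G)`_j = g`_j *: f - f`_j *: g.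
      by rewrite !hornerE => /eqP; rewrite subr_eq0 => /eqP E; rewrite mulrC E mulrC.
    by apply/polyP => i; rewrite coef_swapXY GE coefB !coefZ; ring.
  have [ga|ga] := eqVneq g.[a] 0.
    have fa : f.[a] != 0.
      by apply: contraTneq cfg => fa; apply/negP => /coprimep_root /(_ (introT rootP fa)); rewrite ga eqxx.
    move: g0; rewrite -lead_coef_eq0; apply/negP; rewrite negbK.
    by have /eqP := prop (size g).-1; rewrite ga mul0r mulf_eq0 (negPf fa).
  have Efg : f = (f.[a] / g.[a]) *: g.
    by apply/polyP => j; rewrite coefZ mulrAC prop mulrAC mulfV // mul1r.
  have /negP := hk (f.[a] / g.[a]); apply; apply/eqP/(fmorph_inj iota).
  have pg : phi g != 0 by rewrite phi_eq0.
  apply: (mulIf pg); rewrite -fw {1}Efg -mul_polyC rmorphM /=.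
  by rewrite iota_c.
have szH : size H = 1%N by rewrite EHm size_map_polyC.
have -> : size G = size M.
  by rewrite EH size_mul // szH addn1.
rewrite -(size_map_inj_poly phi_inj (rmorph0 _)) EM size_scale ?phi_eq0 //.
by rewrite size_map_poly.
Qed.

(* L is embedded by [iota] between K and the rational function field F = K(z). *)
Lemma luroth : exists w : L, forall l : L, exists a b : {poly K},
  (map_poly c b).[w] != 0 /\ l = (map_poly c a).[w] / (map_poly c b).[w].
Proof.
have [m [mm mz mdiv]] := generic_minpoly.
have [w [f [g [nw g0 fw sm]]]] := minpoly_antisym mm mz mdiv.
pose ev : {rmorphism {poly K} -> L} := horner_eval w \o map_poly c.
have evE a : ev a = (map_poly c a).[w] by [].
(* The variable of the coefficients stands for [w]: [ev] maps [G] to f(T) - w g(T), which vanishes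
   at [z] and has at most the degree of the minimal polynomial. *)
pose G : {poly {poly K}} := map_poly polyC f - 'X *: map_poly polyC g.
have GE i : G`_i = (f`_i)%:P - (g`_i) *: 'X.
  by rewrite coefB coefZ !coef_map /= mulrC mul_polyC.
have evG i : ev G`_i = c f`_i - w * c g`_i.
  rewrite GE evE [map_poly _ _]rmorphB /= map_polyC map_polyZ map_polyX !hornerE /=.
  by rewrite mulrC.
have nwP x y : c x = w * c y -> x = 0 /\ y = 0.
  move=> E; have y0 : y = 0.
    apply/eqP/negPn/negP => y0; have /negP := nw (x / y); apply.
    by rewrite fmorph_div E mulfK // fmorph_eq0.
  by split=> //; apply/eqP; rewrite -(fmorph_eq0 c) E y0 rmorph0 mulr0.
have evG0 i : ev G`_i = 0 -> G`_i = 0.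
  by rewrite evG => /eqP; rewrite subr_eq0 => /eqP /nwP[E1 E2]; rewrite GE E1 E2 scale0r subr0.
have szG : (size G <= size m)%N.
  rewrite sm; apply/leq_sizeP => i lei; apply: evG0; rewrite evG.
  apply/eqP; rewrite subr_eq0; apply/eqP/(fmorph_inj iota).
  have pg : phi g != 0 by rewrite phi_eq0.
  apply: (mulIf pg).
  have /(congr1 phi) : f`_i *: g = g`_i *: f.
    apply/polyP => j; rewrite !coefZ; apply/eqP; rewrite -subr_eq0.
    by rewrite -(coef_bilinear_antisym f g) (nth_default _ lei) coef0.
  rewrite -!mul_polyC !rmorphM /= !iota_c fw => ->; ring.
have G0 : G != 0.
  apply: contraNneq g0 => G0; rewrite -lead_coef_eq0 /lead_coef.
  have /eqP := evG (size g).-1; rewrite G0 coef0 rmorph0 eq_sym subr_eq0 => /eqP.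
  by case/nwP => _ ->.
have Gz : (map_poly iota (map_poly ev G)).[z] = 0.
  have -> : map_poly ev G = map_poly c f - w *: map_poly c g.
    apply/polyP => i; transitivity (ev G`_i); first exact: coef_map.
    by rewrite evG coefB coefZ !coef_map.
  by rewrite rmorphB /= map_polyZ !hornerE !horner_generic fw subrr.
pose a := ev (lead_coef G).
have a0 : a != 0.
  by apply: contraNneq G0 => /evG0; rewrite -/(lead_coef G) => /eqP; rewrite lead_coef_eq0.
(* Pseudo-division by [G]: up to a power of [a], u(z) is the value at [z] of a polynomial over K[w]
   of degree below that of [m]. *)
have pdiv u : exists k (r : {poly {poly K}}), (size r < size m)%N /\
    (map_poly iota (map_poly ev r)).[z] = iota a ^+ k * phi u.
  exists (scalp (map_poly polyC u) G), (Pdiv.Idomain.modp (map_poly polyC u) G).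
  split; first by apply: leq_trans szG; rewrite Pdiv.Idomain.ltn_modp.
  have /(congr1 (map_poly ev)) := Pdiv.Idomain.divp_eq (map_poly polyC u) G.
  rewrite rmorphD rmorphM /= => /(congr1 (fun p => (map_poly iota p).[z])).
  rewrite rmorphD rmorphM /= hornerD hornerM Gz mulr0 add0r => <-.
  have -> : map_poly ev (lead_coef G ^+ scalp (map_poly polyC u) G *: map_poly polyC u) =
      a ^+ scalp (map_poly polyC u) G *: map_poly c u.
    apply/polyP => i; rewrite [in RHS]coefZ.
    transitivity (ev (lead_coef G ^+ scalp (map_poly polyC u) G * (map_poly polyC u)`_i)).
      by rewrite -coefZ; exact: coef_map.
    rewrite (rmorphM ev) (rmorphXn ev) !coef_map; congr (_ * _).
    by rewrite evE map_polyC hornerC.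
  by rewrite map_polyZ hornerZ horner_generic rmorphXn.
exists w => l; have [u [v [v0 El]]] := phi_frac (iota l).
have pv0 : phi v != 0 by rewrite phi_eq0.
have [k [r [szr rz]]] := pdiv u; have [k' [r' [szr' rz']]] := pdiv v.
(* The two sides agree at [z] and have smaller degree than the minimal polynomial, so they are
   equal; comparing one coefficient expresses [l] through [w]. *)
have D0 : a ^+ k' *: map_poly ev r = (l * a ^+ k) *: map_poly ev r'.
  have szev (q : {poly {poly K}}) : (size q < size m)%N -> (size (map_poly ev q) < size m)%N.
    by apply: leq_ltn_trans; exact: size_poly.
  set D1 := LHS; set D2 := RHS; apply/eqP; rewrite -subr_eq0; apply/negPn/negP => D0.
  have /dvdp_leq : m %| D1 - D2.
    apply: mdiv; rewrite rmorphB /= !map_polyZ !hornerE rz rz' !rmorphM !rmorphXn El.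
    by field.
  move=> /(_ D0); apply/negP; rewrite -ltnNge.
  apply: leq_ltn_trans (size_polyD _ _) _; rewrite size_polyN gtn_max.
  by rewrite !(leq_ltn_trans (size_scale_leq _ _)) // szev.
have [j r'j] : exists j, ev r'`_j != 0.
  apply: contrapT => /forallNP h.
  have E : map_poly ev r' = 0.
    by apply/polyP => j; rewrite coef_map coef0; apply/eqP/negPn/negP/h.
  move/eqP: rz'; rewrite E rmorph0 horner0 eq_sym mulf_eq0 (negPf pv0) orbF.
  by rewrite expf_eq0 fmorph_eq0 (negPf a0) andbF.
exists (lead_coef G ^+ k' * r`_j), (lead_coef G ^+ k * r'`_j).
rewrite -!evE !rmorphM !rmorphXn /= -/a; split.
  by rewrite mulf_neq0 // expf_neq0.
have ak : a ^+ k != 0 by rewrite expf_neq0.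
have /(congr1 (fun p : {poly L} => p`_j)) := D0; rewrite !coefZ !coef_map => ->.
by field; rewrite r'j.
Qed.

End Luroth.

(** * The field and the algebra generated by two elements *)

Section GeneratedField.
Variables (K F : fieldType) (cst : {rmorphism K -> F}) (P Q : F).

Inductive genfield : F -> Prop :=
| genfield_cst c : genfield (cst c)
| genfield_l : genfield P
| genfield_r : genfield Q
| genfield_add x y of genfield x & genfield y : genfield (x + y)
| genfield_mul x y of genfield x & genfield y : genfield (x * y)
| genfield_inv x of genfield x : genfield x^-1.

(** The algebra K[P, Q], closed under multiplication by one generator at a time: an induction over
    it raises one exponent of P^i Q^j per step. *)
Inductive genalg : F -> Prop :=
| genalg_cst c : genalg (cst c)
| genalg_add x y of genalg x & genalg y : genalg (x + y)
| genalg_mull x of genalg x : genalg (P * x)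
| genalg_mulr x of genalg x : genalg (Q * x).

Lemma genalg_mul x y : genalg x -> genalg y -> genalg (x * y).
Proof.
elim=> {x} [c Ay|x x' _ IH _ IH' Ay|x _ IH Ay|x _ IH Ay].
- elim: Ay => {y} [d|y y' _ IH _ IH'|y _ IH|y _ IH]; first by rewrite -rmorphM; constructor.
  + by rewrite mulrDr; constructor.
  + by rewrite mulrCA; constructor.
  + by rewrite mulrCA; constructor.
- by rewrite mulrDl; constructor; [exact: IH|exact: IH'].
- by rewrite -mulrA; constructor; exact: IH.
- by rewrite -mulrA; constructor; exact: IH.
Qed.

Lemma genalg_opp x : genalg x -> genalg (- x).
Proof.
move=> Ax; rewrite -mulN1r -(rmorph1 cst) -rmorphN; apply: genalg_mul => //.
exact: genalg_cst.
Qed.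

Lemma genalg_P : genalg P.
Proof. by rewrite -[P]mulr1 -(rmorph1 cst); do 2!constructor. Qed.

Lemma genalg_Q : genalg Q.
Proof. by rewrite -[Q]mulr1 -(rmorph1 cst); apply/genalg_mulr/genalg_cst. Qed.

Lemma genalg_0 : genalg 0.
Proof. by rewrite -(rmorph0 cst); constructor. Qed.

Lemma genalg_1 : genalg 1.
Proof. by rewrite -(rmorph1 cst); constructor. Qed.

Lemma genalg_exp x n : genalg x -> genalg (x ^+ n).
Proof.
move=> Ax; elim: n => [|n IH]; first exact: genalg_1.
by rewrite exprS; apply: genalg_mul.
Qed.

Lemma genalg_sum n (f : nat -> F) : (forall i, (i < n)%N -> genalg (f i)) ->
  genalg (\sum_(i < n) f i).
Proof.
elim: n => [_|n IH h]; first by rewrite big_ord0; exact: genalg_0.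
rewrite big_ord_recr; apply: genalg_add; last exact: h.
by apply: IH => i lti; apply: h; rewrite ltnW.
Qed.

Lemma genfield_frac x : genfield x ->
  exists s t, [/\ genalg s, genalg t, t != 0 & x * t = s].
Proof.
elim=> {x} [c|||x y _ [s [t [As At t0 E]]] _ [s' [t' [As' At' t'0 E']]]
    |x y _ [s [t [As At t0 E]]] _ [s' [t' [As' At' t'0 E']]]
    |x _ [s [t [As At t0 E]]]].
- by exists (cst c), 1; rewrite oner_eq0 mulr1; split => //; [exact: genalg_cst|exact: genalg_1].
- by exists P, 1; rewrite oner_eq0 mulr1; split => //; [exact: genalg_P|exact: genalg_1].
- by exists Q, 1; rewrite oner_eq0 mulr1; split => //; [exact: genalg_Q|exact: genalg_1].
- exists (s * t' + s' * t), (t * t'); rewrite mulf_neq0 //; split => //.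
  + by apply: genalg_add; apply: genalg_mul.
  + exact: genalg_mul.
  + by rewrite -E -E'; ring.
- exists (s * s'), (t * t'); rewrite mulf_neq0 //; split => //; try exact: genalg_mul.
  by rewrite -E -E'; ring.
- have [x0|x0] := eqVneq x 0.
    by exists 0, 1; rewrite x0 invr0 oner_eq0 mulr1; split => //; [exact: genalg_0|exact: genalg_1].
  by exists t, s; rewrite -E mulf_neq0 // mulKf //; split => //; rewrite E.
Qed.

(** The boolean form makes the generated field a field type of its own, to which Lueroth's theorem
    applies as the abstract [L]. *)
Definition genfield_pred : {pred F} := fun x => `[< genfield x >].

Fact genfield_divring : divring_closed genfield_pred.
Proof.
split.
- by apply/asboolP; rewrite -(rmorph1 cst); constructor.
- move=> x y /asboolP gx /asboolP gy; apply/asboolP; apply: genfield_add => //.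
  by rewrite -mulN1r -(rmorph1 cst) -rmorphN; apply: genfield_mul => //; constructor.
- move=> x y /asboolP gx /asboolP gy; apply/asboolP; apply: genfield_mul => //.
  exact: genfield_inv.
Qed.

HB.instance Definition _ :=
  GRing.isDivringClosed.Build F genfield_pred genfield_divring.

Record genfield_type := Genfield { genfield_val : F; _ : genfield_val \in genfield_pred }.

HB.instance Definition _ := [isSub for genfield_val].
HB.instance Definition _ := [Choice of genfield_type by <:].
HB.instance Definition _ := [SubChoice_isSubIntegralDomain of genfield_type by <:].
HB.instance Definition _ := [SubIntegralDomain_isSubField of genfield_type by <:].

Fact genfield_const_proof c : cst c \in genfield_pred.
Proof. by apply/asboolP; constructor. Qed.

Definition genfield_const c : genfield_type := Genfield (genfield_const_proof c).

Fact genfield_const_zmod : zmod_morphism genfield_const.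
Proof. by move=> x y; apply: val_inj; rewrite /= rmorphB. Qed.
Fact genfield_const_monoid : monoid_morphism genfield_const.
Proof. by split=> [|x y]; apply: val_inj; rewrite /= (rmorph1, rmorphM). Qed.
HB.instance Definition _ := GRing.isZmodMorphism.Build K genfield_type genfield_const genfield_const_zmod.
HB.instance Definition _ := GRing.isMonoidMorphism.Build K genfield_type genfield_const genfield_const_monoid.

End GeneratedField.

(** Lueroth's theorem for the field generated by [P] and [Q], read back in [F]; this field is larger
    than the constants because it contains [Q]. *)
Lemma luroth_generator (K : closedFieldType) (F : fieldType)
    (phi : {rmorphism {poly K} -> F}) (P Q : F) :
    let cst : {rmorphism K -> F} := phi \o polyC in
    injective phi -> (forall f, exists p q, q != 0 /\ f = phi p / phi q) ->
    (forall x, Q != cst x) ->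
  exists W : F, genfield cst P Q W /\ forall f, f = P \/ f = Q -> exists a b : {poly K},
    (map_poly cst b).[W] != 0 /\ f = (map_poly cst a).[W] / (map_poly cst b).[W].
Proof.
move=> cst phi_inj phi_frac nQ; pose L : fieldType := genfield_type cst P Q.
pose io : {rmorphism L -> F} := (\val : genfield_type cst P Q -> F).
pose c : {rmorphism K -> L} := (genfield_const cst P Q : K -> genfield_type cst P Q).
have gP : P \in genfield_pred cst P Q by apply/asboolP; constructor.
have gQ : Q \in genfield_pred cst P Q by apply/asboolP; constructor.
have [//||w hw] := @luroth K F L phi io c phi_inj phi_frac.
  exists (Genfield gQ) => x; apply: contra (nQ x) => /eqP /(congr1 io) /= EQ.
  by apply/eqP.
exists (io w); split; first by apply/asboolP; case: (w).
have ioE a : io (map_poly c a).[w] = (map_poly cst a).[io w].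
  by rewrite -horner_map -map_poly_comp; congr (_.[_]); apply: eq_map_poly.
have main l : exists a b : {poly K}, (map_poly cst b).[io w] != 0 /\
    io l = (map_poly cst a).[io w] / (map_poly cst b).[io w].
  have [a [b [b0 ->]]] := hw l; exists a, b.
  by rewrite -!ioE fmorph_eq0 fmorph_div.
by move=> f [] ->; [exact: (main (Genfield gP))|exact: (main (Genfield gQ))].
Qed.

(** * Polynomials evaluated in an extension field *)

Section PolyValue.
Variables (K F : fieldType) (cst : {rmorphism K -> F}).
Implicit Types (p q : {poly K}) (W : F).

Definition pev W : {rmorphism {poly K} -> F} := horner_eval W \o map_poly cst.

Lemma pevE W p : pev W p = (map_poly cst p).[W].
Proof. by []. Qed.

Lemma pevC W c : pev W c%:P = cst c.
Proof. by rewrite pevE map_polyC hornerC. Qed.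

Lemma pevX W : pev W 'X = W.
Proof. by rewrite pevE map_polyX hornerX. Qed.

Lemma pevXsubC W c : pev W ('X - c%:P) = W - cst c.
Proof. by rewrite (rmorphB (pev W)) pevX pevC. Qed.

Lemma pev_cst c p : pev (cst c) p = cst p.[c].
Proof. by rewrite pevE horner_map. Qed.

Lemma pev_sum W p n : (size p <= n)%N -> pev W p = \sum_(i < n) cst p`_i * W ^+ i.
Proof.
move=> sp; rewrite pevE (@horner_coef_wide _ n) ?size_map_poly //.
by apply: eq_bigr => i _; rewrite coef_map.
Qed.

Lemma pev_shift W c p : pev W (p \Po ('X + c%:P)) = pev (W + cst c) p.
Proof.
by rewrite !pevE map_comp_poly rmorphD /= map_polyX map_polyC horner_comp !hornerE.
Qed.

(** The polynomial X^n p(1/X), for p of degree at most n. *)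
Definition revpoly n p := \poly_(i < n.+1) p`_(n - i).

Lemma pev_rev W n p : (size p <= n.+1)%N -> W != 0 ->
  pev W^-1 p * W ^+ n = pev W (revpoly n p).
Proof.
move=> sp W0; rewrite (pev_sum _ sp) (@pev_sum _ (revpoly n p) n.+1) ?size_poly //.
rewrite [RHS](reindex_inj rev_ord_inj) /= mulr_suml; apply: eq_bigr => i _.
rewrite coef_poly ltnS subSS leq_subr subKn; last by rewrite -ltnS.
rewrite -mulrA exprVn; congr (_ * _).
have lein : (i <= n)%N by rewrite -ltnS.
move: (nat_of_ord i) lein => k lekn.
by rewrite -{1}(subnKC lekn) exprD mulKf ?expf_neq0.
Qed.

(** Division by the gcd lowers both degrees equally; the last clause keeps track of a pole at
    infinity. *)
Lemma pev_reduce W a b : pev W b != 0 ->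
  exists a1 b1, [/\ coprimep a1 b1, pev W b1 != 0, pev W a / pev W b = pev W a1 / pev W b1 &
    (size b < size a)%N -> (size b1 < size a1)%N].
Proof.
move=> b0; have bn0 : b != 0 by apply: contraNneq b0 => ->; rewrite rmorph0.
pose g := gcdp a b; have g0 : g != 0 by rewrite gcdp_eq0 negb_and bn0 orbT.
have Ea : a = (a %/ g) * g by rewrite divpK // dvdp_gcdl.
have Eb : b = (b %/ g) * g by rewrite divpK // dvdp_gcdr.
move: (b0); rewrite Eb rmorphM mulf_eq0 negb_or => /andP[b10 gW0].
exists (a %/ g), (b %/ g); split => //; first by rewrite coprimep_div_gcd // bn0 orbT.
  by rewrite {1}Ea rmorphM -mulf_div divff ?mulr1.
have b1n0 : b %/ g != 0 by apply: contraNneq b10 => ->; rewrite rmorph0.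
have key (u v : {poly K}) : u != 0 -> (size (u * g)%R < size (v * g)%R)%N ->
    (size u < size v)%N.
  move=> u0; have [->|v0] := eqVneq v 0; first by rewrite mul0r size_poly0 ltn0.
  rewrite !size_mul //; move: g0; rewrite -size_poly_gt0.
  by move: (size u) (size v) (size g) => x y t; lia.
by move=> lt; apply: (key _ _ b1n0); rewrite -Ea.
Qed.

Lemma derivation_pev (D : F -> F) W p : (forall x y, D (x + y) = D x + D y) ->
    (forall x y, D (x * y) = D x * y + x * D y) -> (forall c, D (cst c) = 0) ->
  D (pev W p) = pev W p^`() * D W.
Proof.
move=> DD DM DC; elim/poly_ind: p => [|p c IH].
  by rewrite deriv0 !(rmorph0 (pev W)) mul0r -(rmorph0 cst) DC rmorph0.
rewrite derivMXaddC !(rmorphD (pev W)) !(rmorphM (pev W)) pevX pevC DD DM DC IH addr0.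
by ring.
Qed.

Lemma derivation_pev_frac (D : F -> F) W a b : (forall x y, D (x + y) = D x + D y) ->
    (forall x y, D (x * y) = D x * y + x * D y) -> (forall c, D (cst c) = 0) ->
    pev W b != 0 ->
  D (pev W a / pev W b) * pev W b ^+ 2 = pev W (a^`() * b - a * b^`()) * D W.
Proof.
move=> DD DM DC b0; have key (q u : F) : pev W a = q -> pev W b = u -> D (q / u) * u ^+ 2 = D q * u - q * D u.
  move=> _ Eu; rewrite Eu in b0; have := DM (q / u) u; rewrite divfK // => ->.
  by field.
rewrite (key _ _ erefl erefl) (derivation_pev W a DD DM DC) (derivation_pev W b DD DM DC).
by rewrite rmorphB !rmorphM; ring.
Qed.

End PolyValue.

Lemma deriv_eq0_size (K : numDomainType) (p : {poly K}) : p^`() = 0 -> (size p <= 1)%N.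
Proof.
move=> dp; apply/leq_sizeP => -[//|i] _; apply/eqP.
by have := coef_deriv p i; rewrite dp coef0 => /esym/eqP; rewrite mulrn_eq0.
Qed.

(** If a' b = a b', then a divides a' by coprimality; but in characteristic 0 the derivative of a
    nonconstant a is nonzero and of smaller degree. *)
Lemma wronskian_neq0 (K : numFieldType) (a b : {poly K}) : coprimep a b ->
  (1 < size a)%N -> b != 0 -> a^`() * b - a * b^`() != 0.
Proof.
move=> cab sa b0; rewrite subr_eq0; apply/eqP => E.
have a0 : a != 0 by rewrite -size_poly_gt0 ltnW.
have /gtNdvdp : a^`() != 0.
  by apply: contraTneq sa => /deriv_eq0_size; rewrite -leqNgt.
move=> /(_ a); rewrite lt_size_deriv // => /(_ isT) /negP; apply.
by rewrite -(Gauss_dvdpl _ cab) E dvdp_mulr.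
Qed.

(** * Moebius normalization of the generator *)

Section PoleAtInfinity.
Variables (K : closedFieldType) (F : fieldType) (cst : {rmorphism K -> F}).
Local Notation pev := (pev cst).

(* After a Moebius change of the generator, [Q] takes the value infinity at infinity. *)
Lemma generator_with_pole (P Q W : F) : genfield cst P Q W -> (forall c, Q != cst c) ->
    (forall f, f = P \/ f = Q -> exists a b, pev W b != 0 /\ f = pev W a / pev W b) ->
  exists (V : F) (p1 p2 q1 q2 : {poly K}), genfield cst P Q V /\
    [/\ coprimep p1 p2, coprimep q1 q2, pev V p2 != 0 & pev V q2 != 0] /\
    [/\ P = pev V p1 / pev V p2, Q = pev V q1 / pev V q2 & (size q2 < size q1)%N].
Proof.
move=> gW nQ frac.
have [a' [b' [b'0 EQ']]] := frac Q (or_intror erefl).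
have [a [b [cab b0 EQ _]]] := pev_reduce a' b'0; rewrite {a' b' b'0}EQ in EQ'.
have [p1 [p2 [p20 EP]]] := frac P (or_introl erefl).
suff [V [u1 [u2 [q1 [q2 [gV [u20 EPV] [q20 EQV] sq]]]]]] : exists (V : F) (u1 u2 q1 q2 : {poly K}),
   [/\ genfield cst P Q V, pev V u2 != 0 /\ P = pev V u1 / pev V u2,
   pev V q2 != 0 /\ Q = pev V q1 / pev V q2 & (size q2 < size q1)%N].
  have [w1 [w2 [cw w20 EPw _]]] := pev_reduce u1 u20.
  have [r1 [r2 [cr r20 EQr sr]]] := pev_reduce q1 q20.
  by exists V, w1, w2, r1, r2; rewrite -EPw -EQr; do !split => //; exact: sr.
have [sba|sab] := ltnP (size b) (size a); first by exists W, p1, p2, a, b.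
have bn0 : b != 0 by apply: contraNneq b0 => ->; rewrite rmorph0.
have [sb1|sb1] := eqVneq (size b) 1%N.
  have [c c0 Eb] : exists2 c, c != 0 & b = c%:P by apply/size_poly1P/eqP.
  have := nQ (a`_0 / c); rewrite EQ' Eb pevC.
  by rewrite (size1_polyC (leq_trans sab _)) ?sb1 // pevC coefC fmorph_div eqxx.
have [beta /rootP rb] := closed_rootP _ sb1.
have ab0 : a.[beta] != 0.
  by apply: contraTneq cab => ab; apply/negP => /coprimep_root /(_ (introT rootP ab)); rewrite rb eqxx.
have Wb : W - cst beta != 0.
  apply: contraNneq b0 => /eqP; rewrite subr_eq0 => /eqP ->.
  by rewrite pev_cst rb rmorph0.
pose V := (W - cst beta)^-1.
have V0 : V != 0 by rewrite invr_neq0.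
(* Since W = 1 / V + beta, a shift by [beta] followed by reversal writes p(W) V^n as a polynomial in
   V. *)
have tr (p : {poly K}) n : (size p <= n.+1)%N ->
    pev W p * V ^+ n = pev V (revpoly n (p \Po ('X + beta%:P))).
  move=> sp; have sz : (size (p \Po ('X + beta%:P)) <= n.+1)%N.
    by apply: leq_trans (size_comp_poly_leq _ _) _; rewrite size_XaddC muln1; case: (size p) sp.
  rewrite -pev_rev ?V0 // pev_shift; congr (pev _ _ * _).
  by rewrite /V invrK subrK.
have trf (u v : {poly K}) n : (size u <= n.+1)%N -> (size v <= n.+1)%N -> pev W v != 0 ->
    pev V (revpoly n (v \Po ('X + beta%:P))) != 0 /\
    pev W u / pev W v = pev V (revpoly n (u \Po ('X + beta%:P))) /
      pev V (revpoly n (v \Po ('X + beta%:P))).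
  move=> su sv v0; rewrite -!tr // mulf_neq0 ?expf_neq0 //; split => //.
  by rewrite -mulf_div divff ?mulr1 ?expf_neq0.
set n := (size b).-1; have sbn : size b = n.+1 by rewrite prednK ?size_poly_gt0.
exists V, (revpoly (maxn (size p1) (size p2)) (p1 \Po ('X + beta%:P))),
  (revpoly (maxn (size p1) (size p2)) (p2 \Po ('X + beta%:P))),
  (revpoly n (a \Po ('X + beta%:P))), (revpoly n (b \Po ('X + beta%:P))).
split.
- apply: genfield_inv; apply: genfield_add => //; rewrite -rmorphN; exact: genfield_cst.
- by rewrite EP; apply: trf; rewrite // leqW // ?leq_maxl ?leq_maxr.
- by rewrite EQ'; apply: trf; rewrite -?sbn.
have c0 (p : {poly K}) : (p \Po ('X + beta%:P))`_0 = p.[beta].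
  by rewrite -horner_coef0 horner_comp !hornerE.
(* After reversal the coefficient of degree n is the value at [beta], which is zero for [b] and
   nonzero for [a]. *)
apply: (@leq_ltn_trans n).
  apply/leq_sizeP => j lej; rewrite coef_poly; case: ltnP => // ltj.
  by move: lej; rewrite -subn_eq0 => /eqP ->; rewrite c0 rb.
rewrite ltnNge; apply/negP => /leq_sizeP /(_ n (leqnn _)).
by rewrite coef_poly ltnSn subnn c0 => /eqP; rewrite (negPf ab0).
Qed.

End PoleAtInfinity.

(** * Integrality over K[P, Q] and conductors *)

Section Conductor.
Variables (K F : fieldType) (cst : {rmorphism K -> F}) (P Q : F).
Local Notation A := (genalg cst P Q).
Local Notation pev := (pev cst).

Definition integral_over_genalg x := exists n (alpha : nat -> F),
  (forall i, A (alpha i)) /\ x ^+ n = \sum_(i < n) alpha i * x ^+ i.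

Lemma integral_of_relation n (beta : nat -> F) c x : (forall i, A (beta i)) ->
    beta n = cst c -> c != 0 -> \sum_(i < n.+1) beta i * x ^+ i = 0 ->
  integral_over_genalg x.
Proof.
move=> Ab bn c0 E; exists n, (fun i => cst (- c^-1) * beta i); split.
  by move=> i; apply: genalg_mul => //; constructor.
under eq_bigr do rewrite -mulrA.
rewrite -mulr_sumr; move/eqP: E; rewrite big_ord_recr /= bn addr_eq0 => /eqP ->.
by rewrite rmorphN fmorphV mulrNN mulKf ?fmorph_eq0.
Qed.

(** With x = s / t satisfying an integral equation of degree n, the factor t^n clears x^i for i < n,
    and the equation reduces higher powers to these. The set [B] allows iteration: two integral
    elements get one multiplier for all products of their powers. *)
Lemma integral_conductor (B : F -> Prop) h x : A h -> (forall b, B b -> A (h * b)) ->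
    genfield cst P Q x -> integral_over_genalg x -> h != 0 ->
  exists h', [/\ h' != 0, A h' & forall b i, B b -> A (h' * (b * x ^+ i))].
Proof.
move=> Ah hB /genfield_frac[s [t [As At t0 E]]] [n [al [Aal En]]] h0.
exists (h * t ^+ n); rewrite mulf_neq0 ?expf_neq0 //; split => //.
  by apply: genalg_mul => //; apply: genalg_exp.
move=> b i Bb; have [m] := ubnP i; elim: m i => // m IH i ltim.
have [lin|lni] := ltnP i n.
  have -> : h * t ^+ n * (b * x ^+ i) = (h * b) * (s ^+ i * t ^+ (n - i)).
    by rewrite -{1}(subnKC (ltnW lin)) exprD -E exprMn; ring.
  by apply: genalg_mul; [exact: hB|apply: genalg_mul; apply: genalg_exp].
have -> : h * t ^+ n * (b * x ^+ i) =
    \sum_(j < n) al j * (h * t ^+ n * (b * x ^+ (i - n + j))).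
  rewrite -{1}(subnK lni) exprD En !mulr_sumr; apply: eq_bigr => j _.
  by rewrite exprD; ring.
apply: (@genalg_sum _ _ _ _ _ n (fun j => al j * (h * t ^+ n * (b * x ^+ (i - n + j))))).
move=> j ltj; apply: genalg_mul => //; apply: IH; lia.
Qed.

(** [W] is a root of u(T) - f v(T), whose leading coefficient is that of [u], a constant, because
    [v] has smaller degree. *)
Lemma integral_generator f W u v : A f -> f = pev W u / pev W v -> pev W v != 0 ->
  (size v < size u)%N -> integral_over_genalg W.
Proof.
move=> Af Ef v0 suv; pose n := (size u).-1.
have sun : size u = n.+1 by rewrite prednK // (leq_ltn_trans _ suv).
apply: (@integral_of_relation n (fun i => cst u`_i - f * cst v`_i) (lead_coef u)).
- move=> i; apply: genalg_add; first by constructor.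
  by apply: genalg_opp; apply: genalg_mul => //; constructor.
- by rewrite -/(lead_coef u) [v`_n]nth_default ?rmorph0 ?mulr0 ?subr0 // -ltnS -sun.
- by rewrite lead_coef_eq0 -size_poly_gt0 sun.
under eq_bigr do rewrite mulrBl -mulrA.
rewrite sumrB -mulr_sumr -!pev_sum -?sun ?leqnn // 1?ltnW //.
by rewrite Ef divfK // subrr.
Qed.

(** The relation u(W) - f v(W) = 0, expanded at [a] and reversed, is an equation for 1 / (W - a)
    with leading coefficient u(a) - f v(a) = u(a), a nonzero constant. *)
Lemma integral_pole f W u v a : A f -> f = pev W u / pev W v -> pev W v != 0 ->
    v.[a] = 0 -> u.[a] != 0 ->
  integral_over_genalg (W - cst a)^-1.
Proof.
move=> Af Ef v0 va ua; pose n := maxn (size u) (size v).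
pose tr (p : {poly K}) := p \Po ('X + a%:P).
have szt (p : {poly K}) : (size (tr p) <= size p)%N.
  by rewrite size_comp_poly2 ?size_XaddC.
have t0 (p : {poly K}) : (tr p)`_0 = p.[a].
  by rewrite -horner_coef0 horner_comp !hornerE.
have Wa : W - cst a != 0.
  apply: contraNneq v0 => /eqP; rewrite subr_eq0 => /eqP ->.
  by rewrite pev_cst va rmorph0.
pose ru := revpoly n (tr u); pose rv := revpoly n (tr v).
have pr (p : {poly K}) : (size p <= n)%N ->
    pev (W - cst a)^-1 (revpoly n (tr p)) = pev W p * (W - cst a)^-1 ^+ n.
  move=> sp; rewrite -pev_rev ?invr_neq0 // ?leqW ?(leq_trans (szt p)) //.
  by rewrite invrK pev_shift subrK.
apply: (@integral_of_relation n (fun i => cst ru`_i - f * cst rv`_i) u.[a]) => //.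
- move=> i; apply: genalg_add; first by constructor.
  by apply: genalg_opp; apply: genalg_mul => //; constructor.
- by rewrite !coef_poly ltnSn subnn !t0 va rmorph0 mulr0 subr0.
under eq_bigr do rewrite mulrBl -mulrA.
rewrite sumrB -mulr_sumr -!pev_sum ?size_poly // !pr ?leq_maxl ?leq_maxr //.
by rewrite Ef mulrA divfK // subrr.
Qed.

End Conductor.

(** * From moments of P and Q to integrals against dV *)

Section MomentCore.
Variables (K : numClosedFieldType) (F : fieldType) (phi : {rmorphism {poly K} -> F}).
Hypothesis phi_inj : injective phi.
Hypothesis phi_frac : forall f, exists p q, q != 0 /\ f = phi p / phi q.
Local Notation cst := (phi \o polyC).
Local Notation pev := (pev (phi \o polyC)).
Variable D : F -> F.
Hypothesis D_add : forall x y, D (x + y) = D x + D y.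
Hypothesis D_mul : forall x y, D (x * y) = D x * y + x * D y.
Hypothesis D_cst : forall c, D (cst c) = 0.
Variable vint : F -> Prop.
Hypothesis vint_add : forall x y, vint x -> vint y -> vint (x + y).
Hypothesis vint_scale : forall c x, vint x -> vint (cst c * x).

Lemma vint_sum n (f : nat -> F) : vint 0 -> (forall i, vint (f i)) ->
  vint (\sum_(i < n) f i).
Proof.
move=> v0 vf; elim: n => [|n IH]; first by rewrite big_ord0.
by rewrite big_ord_recr; apply: vint_add.
Qed.

Lemma genalg_value (P Q V : F) (p1 p2 q1 q2 : {poly K}) x :
    pev V p2 != 0 -> pev V q2 != 0 ->
    P = pev V p1 / pev V p2 -> Q = pev V q1 / pev V q2 -> genalg cst P Q x ->
  exists a b, pev V b != 0 /\ x = pev V a / pev V b.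
Proof.
move=> p20 q20 -> ->; elim=> {x} [c|x y _ [a [b [b0 ->]]] _ [a' [b' [b'0 ->]]]
  |x _ [a [b [b0 ->]]]|x _ [a [b [b0 ->]]]].
- by exists c%:P, 1; rewrite pevC !rmorph1 divr1 oner_eq0.
- exists (a * b' + a' * b), (b * b'); rewrite rmorphM mulf_neq0 //; split => //.
  by rewrite addf_div // rmorphD !rmorphM.
- by exists (p1 * a), (p2 * b); rewrite !rmorphM mulf_neq0 // mulf_div.
- by exists (q1 * a), (q2 * b); rewrite !rmorphM mulf_neq0 // mulf_div.
Qed.

(** Here [vint] stands for the functions with integral 0 along the curve. A conductor h of the
    powers of V and y puts every h V^k y^j into the algebra, where the moments vanish against P^i0
    Q^j0 dQ; writing P^i0 Q^j0 h and dQ in terms of V leaves the polynomial N. *)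
Lemma moment_core (P Q : F) i0 j0 : P != 0 -> (forall c, Q != cst c) ->
    (forall i j, (i0 <= i)%N -> (j0 <= j)%N -> vint (P ^+ i * Q ^+ j * D Q)) ->
  exists (V : F) (p1 p2 q1 q2 : {poly K}),
   [/\ coprimep p1 p2, coprimep q1 q2, pev V p2 != 0 & pev V q2 != 0] /\
   [/\ P = pev V p1 / pev V p2, Q = pev V q1 / pev V q2 & (size q2 < size q1)%N] /\
   (exists2 N, N != 0 & forall p, vint (pev V (N * p) * D V)) /\
   forall a, p2.[a] = 0 \/ q2.[a] = 0 -> exists2 N, N != 0 &
     forall p j, vint (pev V (N * p) * (V - cst a)^-1 ^+ j * D V).
Proof.
move=> P0 nQ mom; have [W [gW fracW]] := @luroth_generator _ _ phi P Q phi_inj phi_frac nQ.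
have [V [p1 [p2 [q1 [q2 [gV [[cp cq p20 q20] [EP EQ sq]]]]]]]] :=
  @generator_with_pole _ _ cst P Q W gW nQ fracW.
exists V, p1, p2, q1, q2; do 2!split => //.
(* Induction over the algebra: a multiplication by [P] or [Q] raises an exponent, so the lower
   bounds are preserved. *)
have momA x i j : genalg cst P Q x -> (i0 <= i)%N -> (j0 <= j)%N ->
    vint (P ^+ i * Q ^+ j * x * D Q).
  move=> Ax; elim: Ax i j => {x} [c|x y _ IH _ IH'|x _ IH|x _ IH] i j lei lej.
  - have -> : P ^+ i * Q ^+ j * cst c * D Q = cst c * (P ^+ i * Q ^+ j * D Q) by ring.
    by apply: vint_scale; apply: mom.
  - by rewrite mulrDr mulrDl; apply: vint_add; [apply: IH|apply: IH'].
  - have -> : P ^+ i * Q ^+ j * (P * x) * D Q = P ^+ i.+1 * Q ^+ j * x * D Q.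
      by rewrite exprS; ring.
    by apply: IH => //; rewrite leqW.
  - have -> : P ^+ i * Q ^+ j * (Q * x) * D Q = P ^+ i * Q ^+ j.+1 * x * D Q.
      by rewrite exprS; ring.
    by apply: IH => //; rewrite leqW.
have Q0 : Q != 0 by have := nQ 0; rewrite /= !rmorph0.
have key y : genfield cst P Q y -> integral_over_genalg cst P Q y -> exists2 N, N != 0 &
     forall p j, vint (pev V (N * p) * y ^+ j * D V).
  move=> gy iy.
  have iV : integral_over_genalg cst P Q V.
    by apply: (@integral_generator _ _ _ _ _ Q V q1 q2) => //; exact: genalg_Q.
  (* The conductor is formed for the powers of V, then enlarged for their products with the powers
     of y. *)
  have [||h1 [h10 Ah1 h1B]] :=
    @integral_conductor _ _ cst P Q (fun b => b = 1) 1 V _ _ gV iV (oner_neq0 _).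
  - exact: genalg_1.
  - by move=> b ->; rewrite mulr1; exact: genalg_1.
  have [|h2 [h20 Ah2 h2B]] :=
    @integral_conductor _ _ cst P Q (fun b => exists i, b = 1 * V ^+ i) h1 y Ah1 _ gy iy h10.
    by move=> b [i ->]; exact: h1B.
  have [n1 [d1 [d10 Enum]]] : exists a b, pev V b != 0 /\
      P ^+ i0 * Q ^+ j0 * h2 = pev V a / pev V b.
    apply: (genalg_value p20 q20 EP EQ); rewrite -mulrA.
    apply: genalg_mul; first by apply: genalg_exp; exact: genalg_P.
    by apply: genalg_mul => //; apply: genalg_exp; exact: genalg_Q.
  pose w := q1^`() * q2 - q1 * q2^`().
  have q2n0 : q2 != 0 by apply: contraNneq q20 => ->; rewrite rmorph0.
  have w0 : w != 0.
    apply: wronskian_neq0 => //; apply: leq_ltn_trans sq.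
    by rewrite size_poly_gt0.
  have n10 : n1 != 0.
    have : P ^+ i0 * Q ^+ j0 * h2 != 0 by rewrite !mulf_neq0 ?expf_neq0.
    by rewrite Enum; apply: contraNneq => ->; rewrite rmorph0 mul0r.
  (* N is the numerator of P^i0 Q^j0 h2 times the Wronskian in dQ = w(V) / q2(V)^2 dV; both
     denominators are compensated by [r]. *)
  exists (n1 * w); first exact: mulf_neq0.
  move=> p j; pose r := d1 * q2 ^+ 2 * p.
  have -> : pev V (n1 * w * p) * y ^+ j * D V =
      P ^+ i0 * Q ^+ j0 * h2 * pev V r * y ^+ j * D Q.
    have := derivation_pev_frac q1 D_add D_mul D_cst q20; rewrite -EQ -/w => E.
    rewrite /r Enum !rmorphM.
    transitivity (pev V n1 * pev V p * y ^+ j * (pev V w * D V)); first by ring.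
    by rewrite -E; field.
  rewrite (@pev_sum _ _ cst V r (size r)) // mulr_sumr !mulr_suml.
  apply: (@vint_sum _ (fun i => P ^+ i0 * Q ^+ j0 * h2 * (cst r`_i * V ^+ i) * y ^+ j * D Q)).
    have := vint_scale 0 (mom i0 j0 (leqnn _) (leqnn _)).
    by rewrite rmorph0 mul0r.
  move=> i; have -> : P ^+ i0 * Q ^+ j0 * h2 * (cst r`_i * V ^+ i) * y ^+ j * D Q =
     cst r`_i * (P ^+ i0 * Q ^+ j0 * (h2 * (1 * V ^+ i * y ^+ j)) * D Q) by ring.
  by apply: vint_scale; apply: momA => //; apply: h2B; exists i.
have gcst c : genfield cst P Q (V - cst c).
  by apply: genfield_add => //; rewrite -rmorphN; exact: genfield_cst.
split.
  have [||N N0 hN] := key 1.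
  - by rewrite -(rmorph1 cst); constructor.
  - exists 1%N, (fun=> 1); rewrite big_ord1 expr1 expr0 mul1r; split => // _.
    exact: genalg_1.
  by exists N => // p; have := hN p 0; rewrite expr0 mulr1.
move=> a ra; apply: key; first exact/genfield_inv/gcst.
case: ra => [pa|qa].
  apply: (@integral_pole _ _ cst P Q P V p1 p2) => //; first exact: genalg_P.
  rewrite coprimep_sym in cp; apply: (coprimep_root cp); exact/rootP.
apply: (@integral_pole _ _ cst P Q Q V q1 q2) => //; first exact: genalg_Q.
rewrite coprimep_sym in cq; apply: (coprimep_root cq); exact/rootP.
Qed.

End MomentCore.

(** * Values and derivatives of rational functions *)

Section RationalFunctions.
Variable K : fieldType.
Implicit Types (f g : ratfun K) (p q : {poly K}) (z : K).

Lemma tofrac_inj : injective (@tofrac {poly K}).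
Proof. by move=> p q /eqP; rewrite tofrac_eq => /eqP. Qed.

Lemma divf_unfold (G : fieldType) (x y u : G) : y != 0 -> x * y = u -> x = u / y.
Proof. by move=> y0 <-; rewrite mulfK. Qed.

Lemma repr_fracE f : f = tofrac (repr f).1 / tofrac (repr f).2.
Proof.
apply: divf_unfold; first by rewrite tofrac_eq0 denom_ratioP.
have d0 := denom_ratioP (repr f).
rewrite -[X in X * _ = _](@reprK _ (ratfun K)) -[LHS]/(FracField.mul _ _).
rewrite !piE; apply/eqmodP; rewrite /= FracField.equivfE /FracField.mulf.
rewrite !numden_Ratio ?mulf_neq0 ?oner_neq0 //.
by rewrite !mulr1 mulrC.
Qed.

Lemma ratden_neq0 f : ratden f != 0.
Proof.
rewrite /ratden divp_eq0 negb_or denom_ratioP /= negb_or gcdp_eq0 negb_and.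
by rewrite denom_ratioP orbT -leqNgt leq_gcdpr // denom_ratioP.
Qed.

Lemma coprimep_ratnum_ratden f : coprimep (ratnum f) (ratden f).
Proof. by rewrite coprimep_div_gcd // denom_ratioP orbT. Qed.

Lemma mulf_cancel (G : fieldType) (a b g : G) : g != 0 -> (a * g) / (b * g) = a / b.
Proof. by move=> g0; rewrite -mulf_div divff ?mulr1. Qed.

Lemma ratfunE f : f = tofrac (ratnum f) / tofrac (ratden f).
Proof.
pose h := gcdp (repr f).1 (repr f).2.
have h0 : h != 0 by rewrite gcdp_eq0 negb_and denom_ratioP orbT.
have En : (repr f).1 = ratnum f * h by rewrite divpK // dvdp_gcdl.
have Ed : (repr f).2 = ratden f * h by rewrite divpK // dvdp_gcdr.
rewrite [LHS]repr_fracE En Ed !tofracM; apply: mulf_cancel.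
by rewrite tofrac_eq0.
Qed.

Lemma ratfun_frac f : exists p q, q != 0 /\ f = tofrac p / tofrac q.
Proof. by exists (ratnum f), (ratden f); split; [exact: ratden_neq0|exact: ratfunE]. Qed.

Lemma cross_mul (G : fieldType) (x y u v : G) : y != 0 -> v != 0 -> x / y = u / v -> x * v = u * y.
Proof. by move=> y0 v0 E; rewrite -[x](divfK y0) E; field. Qed.

(** By coprimality the reduced denominator divides every other one; values and derivatives can thus
    be computed from any fraction. *)
Lemma ratfun_common_factor f p q : q != 0 -> f = tofrac p / tofrac q ->
  exists h : {poly K}, p = h * ratnum f /\ q = h * ratden f.
Proof.
move=> q0 Ef; have d0 := ratden_neq0 f.
have E : ratnum f * q = p * ratden f.
  apply: tofrac_inj; rewrite !tofracM; apply: cross_mul; rewrite ?tofrac_eq0 //.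
  by rewrite -ratfunE.
have /divpK Eq : ratden f %| q.
  rewrite -(@Gauss_dvdpr _ _ (ratnum f)) ?E ?dvdp_mull //.
  by rewrite coprimep_sym coprimep_ratnum_ratden.
exists (q %/ ratden f); split => //; apply: (mulIf d0).
by rewrite -E -{1}Eq; ring.
Qed.

Definition regular f z := (ratden f).[z] != 0.

Lemma rateval_frac f p q z : f = tofrac p / tofrac q -> q.[z] != 0 ->
  regular f z /\ rateval f z = p.[z] / q.[z].
Proof.
move=> Ef qz; have q0 : q != 0 by apply: contraNneq qz => ->; rewrite horner0.
have [g [Ep Eq]] := ratfun_common_factor q0 Ef.
move: qz; rewrite Eq Ep !hornerM mulf_eq0 negb_or => /andP[gz dz]; split => //.
by rewrite /rateval mulrC [in RHS]mulrC -[RHS]mulrC ![g.[z] * _]mulrC mulf_cancel // mulrC.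
Qed.

Lemma rateval_poly p z : regular (tofrac p) z /\ rateval (tofrac p) z = p.[z].
Proof.
have [||r ->] := @rateval_frac (tofrac p) p 1 z; rewrite ?hornerC ?oner_eq0 ?tofrac1 ?divr1 //.
Qed.

Lemma rateval_cst (c z : K) : regular (tofrac c%:P) z /\ rateval (tofrac c%:P) z = c.
Proof. by have [? ->] := rateval_poly c%:P z; rewrite hornerC. Qed.

Lemma addf_div' (G : fieldType) (x y u v : G) : y != 0 -> v != 0 ->
  x / y + u / v = (x * v + u * y) / (y * v).
Proof. by move=> y0 v0; rewrite addf_div. Qed.

Lemma ratevalD f g z : regular f z -> regular g z ->
  regular (f + g) z /\ rateval (f + g) z = rateval f z + rateval g z.
Proof.
move=> fz gz; have := @rateval_frac (f + g) (ratnum f * ratden g + ratnum g * ratden f)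
  (ratden f * ratden g) z.
rewrite !hornerE mulf_neq0 // -addf_div' //; apply => //.
rewrite tofracD !tofracM -addf_div' ?tofrac_eq0 ?ratden_neq0 //.
by rewrite -!ratfunE.
Qed.

Lemma mulf_div' (G : fieldType) (x y u v : G) : (x * u) / (y * v) = x / y * (u / v).
Proof. by rewrite mulf_div. Qed.

Lemma ratevalM f g z : regular f z -> regular g z ->
  regular (f * g) z /\ rateval (f * g) z = rateval f z * rateval g z.
Proof.
move=> fz gz; have [||r ->] := @rateval_frac (f * g) (ratnum f * ratnum g)
  (ratden f * ratden g) z.
- by rewrite !tofracM mulf_div' -!ratfunE.
- by rewrite hornerM mulf_neq0.
by split => //; rewrite !hornerM mulf_div'.
Qed.

Lemma invf_div' (G : fieldType) (x y : G) : (x / y)^-1 = y / x.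
Proof. by rewrite invf_div. Qed.

Lemma ratevalV f z : regular f z -> rateval f z != 0 ->
  regular f^-1 z /\ rateval f^-1 z = (rateval f z)^-1.
Proof.
move=> fz; rewrite /rateval mulf_eq0 negb_or invf_div => /andP[nz _].
apply: (@rateval_frac f^-1 (ratden f) (ratnum f)) => //.
by rewrite -invf_div' -ratfunE.
Qed.

Lemma ratevalX f z n : regular f z ->
  regular (f ^+ n) z /\ rateval (f ^+ n) z = rateval f z ^+ n.
Proof.
move=> fz; elim: n => [|n [rn IH]].
  by rewrite !expr0; have := rateval_cst 1 z; rewrite polyC1 tofrac1.
by rewrite !exprS -IH; apply: ratevalM.
Qed.

Lemma ratderiv_frac f p q : q != 0 -> f = tofrac p / tofrac q ->
  ratderiv f = tofrac (p^`() * q - p * q^`()) / tofrac (q ^+ 2).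
Proof.
move=> q0 Ef; have [g [Ep Eq]] := ratfun_common_factor q0 Ef.
have g0 : g != 0 by apply: contraNneq q0; rewrite Eq => ->; rewrite mul0r.
rewrite Ep Eq !derivM /ratderiv; set n := ratnum f; set d := ratden f.
have -> : (g^`() * n + g * n^`()) * (g * d) - g * n * (g^`() * d + g * d^`()) =
  (n^`() * d - n * d^`()) * g ^+ 2 by ring.
by rewrite exprMn [g ^+ 2 * _]mulrC 2!(tofracM _ (g ^+ 2)) mulf_cancel // tofrac_eq0 expf_neq0.
Qed.

Lemma ratderiv_cst c : ratderiv (tofrac c%:P : ratfun K) = 0.
Proof.
rewrite (@ratderiv_frac _ c%:P 1) ?oner_neq0 ?tofrac1 ?divr1 //.
by rewrite derivC -polyC1 derivC mulr0 mul0r subrr tofrac0 mul0r.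
Qed.

(** Additivity of the quotient rule; n1, d1, m1, e1 stand for the derivatives of n, d, m, e. *)
Lemma quotient_additive (G : fieldType) (n n1 d d1 m m1 e e1 : G) : d != 0 -> e != 0 ->
  (((n1 * e + n * e1) + (m1 * d + m * d1)) * (d * e) - (n * e + m * d) * (d1 * e + d * e1))
    / (d * e) ^+ 2 = (n1 * d - n * d1) / d ^+ 2 + (m1 * e - m * e1) / e ^+ 2.
Proof. by move=> d0 e0; field; rewrite ?d0 ?e0. Qed.

Lemma ratderivD f g : ratderiv (f + g) = ratderiv f + ratderiv g.
Proof.
rewrite (@ratderiv_frac _ (ratnum f * ratden g + ratnum g * ratden f)
  (ratden f * ratden g)); first last.
- rewrite tofracD !tofracM -addf_div' ?tofrac_eq0 ?ratden_neq0 //.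
  by rewrite -!ratfunE.
- by rewrite mulf_neq0 ?ratden_neq0.
rewrite /ratderiv derivD !derivM !(tofracM, tofracB, tofracD, tofracXn).
by apply: quotient_additive; rewrite tofrac_eq0 ratden_neq0.
Qed.

Lemma quotient_leibniz (G : fieldType) (n n1 d d1 m m1 e e1 : G) : d != 0 -> e != 0 ->
  ((n1 * m + n * m1) * (d * e) - n * m * (d1 * e + d * e1)) / (d * e) ^+ 2 =
  (n1 * d - n * d1) / d ^+ 2 * (m / e) + n / d * ((m1 * e - m * e1) / e ^+ 2).
Proof. by move=> d0 e0; field; rewrite ?d0 ?e0. Qed.

Lemma ratderivM f g : ratderiv (f * g) = ratderiv f * g + f * ratderiv g.
Proof.
rewrite (@ratderiv_frac _ (ratnum f * ratnum g) (ratden f * ratden g)); first last.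
- by rewrite !tofracM mulf_div' -!ratfunE.
- by rewrite mulf_neq0 ?ratden_neq0.
rewrite -[in RHS]/(ratderiv f) -[in RHS]/(ratderiv g) !derivM.
rewrite [X in _ = _ * X + _]ratfunE [X in _ = _ + X * _]ratfunE /ratderiv.
rewrite !(tofracM, tofracB, tofracD, tofracXn).
by apply: quotient_leibniz; rewrite tofrac_eq0 ratden_neq0.
Qed.

Lemma regular_ratderiv f z : regular f z -> regular (ratderiv f) z.
Proof.
move=> fz; have [] := @rateval_frac (ratderiv f) _ _ z erefl => //.
by rewrite hornerE expf_neq0.
Qed.

Lemma rateval_ratderiv f z : regular f z -> rateval (ratderiv f) z =
  ((ratnum f)^`().[z] * (ratden f).[z] - (ratnum f).[z] * (ratden f)^`().[z]) / (ratden f).[z] ^+ 2.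
Proof.
move=> fz; have [] := @rateval_frac (ratderiv f) _ _ z erefl.
  by rewrite hornerE expf_neq0.
by move=> _ ->; rewrite !hornerE.
Qed.

Lemma regular_inv_sub f z c : regular f z -> rateval f z != c ->
  regular (f - tofrac c%:P)^-1 z /\ rateval (f - tofrac c%:P)^-1 z = (rateval f z - c)^-1.
Proof.
move=> fz fc; have [r1 e1] := rateval_cst (- c) z.
rewrite polyCN tofracN in r1 e1; have [r2 e2] := ratevalD fz r1.
by rewrite -e1 -e2; apply: ratevalV => //; rewrite e2 e1 subr_eq0.
Qed.

End RationalFunctions.

(** * Homogenization of polynomials and composition *)

Section HomogeneousForms.

(** The homogenization y^D a(x / y) for a of degree at most D; it also covers the point at infinity,
    y = 0. *)
Definition homform (S : comNzRingType) (a : {poly S}) (D : nat) (x y : S) : S :=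
  \sum_(i < D.+1) a`_i * x ^+ i * y ^+ (D - i).

Lemma rmorph_homform (S T : comNzRingType) (h : {rmorphism S -> T}) a D x y :
  h (homform a D x y) = homform (map_poly h a) D (h x) (h y).
Proof.
rewrite rmorph_sum; apply: eq_bigr => i _.
by rewrite !rmorphM !rmorphXn coef_map.
Qed.

Lemma homform0r (S : comNzRingType) (a : {poly S}) D x : homform a D x 0 = a`_D * x ^+ D.
Proof.
rewrite /homform big_ord_recr /= subnn mulr1 big1 ?add0r // => i _.
by rewrite expr0n subn_eq0 leqNgt ltn_ord /= mulr0.
Qed.

Lemma homform_div (G : fieldType) (a : {poly G}) D x y : (size a <= D.+1)%N -> y != 0 ->
  homform a D x y = y ^+ D * a.[x / y].
Proof.
move=> sa y0; rewrite (@horner_coef_wide _ D.+1) // mulr_sumr; apply: eq_bigr => i _.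
have : (i <= D)%N by rewrite -ltnS.
move: (nat_of_ord i) => k lek; rewrite expr_div_n -{2}(subnK lek) exprD.
by field; rewrite expf_neq0.
Qed.

Lemma top_coefM (S : comNzRingType) (p q : {poly S}) n m : (size p <= n.+1)%N ->
  (size q <= m.+1)%N -> (size (p * q)%R <= (n + m).+1)%N /\ (p * q)`_(n + m) = p`_n * q`_m.
Proof.
move=> sp sq; split.
  apply: leq_trans (size_polyMleq _ _) _; move: sp sq.
  by move: (size p) (size q) => u v; lia.
have ltn : (n < (n + m).+1)%N by rewrite ltnS leq_addr.
rewrite coefM (bigD1 (Ordinal ltn)) //= addKn big1 ?addr0 // => i /eqP ni.
have [lti|lei] := ltnP i n.
  rewrite [q`__]nth_default ?mulr0 //; apply: leq_trans sq _; lia.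
rewrite [p`__]nth_default ?mul0r //; apply: leq_trans sp _; rewrite ltn_neqAle lei andbT.
by apply/eqP => E; apply: ni; exact/val_inj/esym.
Qed.

Lemma top_coefX (S : comNzRingType) (p : {poly S}) e k : (size p <= e.+1)%N ->
  (size (p ^+ k)%R <= (k * e).+1)%N /\ (p ^+ k)`_(k * e) = p`_e ^+ k.
Proof.
move=> sp; elim: k => [|k [IH1 IH2]]; first by rewrite !expr0 size_poly1 coef1.
by rewrite !exprS mulSn -IH2; apply: top_coefM.
Qed.

(** The coefficients of degree e are homogeneous coordinates of the value of f / g at infinity; the
    form acts on them as on finite values. *)
Lemma homform_top (S : comNzRingType) (a : {poly S}) D (f g : {poly S}) e :
    (size f <= e.+1)%N -> (size g <= e.+1)%N ->
  (size (homform (map_poly polyC a) D f g) <= (D * e).+1)%N /\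
  (homform (map_poly polyC a) D f g)`_(D * e) = homform a D f`_e g`_e.
Proof.
move=> sf sg.
have term (i : 'I_D.+1) : (size (((map_poly polyC a)`_i * f ^+ i * g ^+ (D - i))%R) <= (D * e).+1)%N /\
    ((map_poly polyC a)`_i * f ^+ i * g ^+ (D - i))`_(D * e) = a`_i * f`_e ^+ i * g`_e ^+ (D - i).
  have : (i <= D)%N by rewrite -ltnS.
  move: (nat_of_ord i) => k lek; rewrite coef_map /=.
  have [s1 c1] := top_coefX k sf; have [s2 c2] := top_coefX (D - k) sg.
  have [s3 c3] := @top_coefM _ (a`_k)%:P _ 0 _ (size_polyC_leq1 _) s1.
  have := top_coefM s3 s2; rewrite c3 coefC /= c1 c2 add0n -mulnDl subnKC //.
split.
  apply: leq_trans (size_sum _ _ _) _; apply/bigmax_leqP => i _; exact: (term i).1.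
by rewrite /homform coef_sum; apply: eq_bigr => i _; exact: (term i).2.
Qed.

(** Coprimality excludes a common finite zero, and the choice of D as the larger degree excludes one
    at infinity. *)
Lemma homform_coprime (G : fieldType) (a b : {poly G}) D (x y : G) : coprimep a b ->
    (x != 0) || (y != 0) -> D.+1 = maxn (size a) (size b) ->
  (homform a D x y != 0) || (homform b D x y != 0).
Proof.
move=> cab xy DE.
have [y0|y0] := eqVneq y 0; last first.
  rewrite !homform_div ?DE ?leq_maxl ?leq_maxr // !mulf_eq0 expf_eq0 (negPf y0) andbF /=.
  rewrite -negb_and; apply/negP => /andP[ra rb].
  by have := coprimep_root cab ra; rewrite rb.
move: xy; rewrite y0 eqxx orbF !homform0r => x0.
rewrite !mulf_eq0 expf_eq0 (negPf x0) andbF !orbF -negb_and; apply/negP => /andP[aD bD].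
have h (p : {poly G}) : (size p <= D.+1)%N -> p`_D == 0 -> (size p <= D)%N.
  move=> sp pD; apply/leq_sizeP => j; rewrite leq_eqVlt => /orP[/eqP <-|]; first exact/eqP.
  by move=> ltj; rewrite nth_default // (leq_trans sp).
have : (maxn (size a) (size b) <= D)%N.
  by rewrite geq_max !h // DE ?leq_maxl ?leq_maxr.
by rewrite -DE ltnn.
Qed.

End HomogeneousForms.

Section CompositionForm.
Variable K : fieldType.
Implicit Types (P W : ratfun K) (a b : {poly K}).
Local Notation cst := (@tofrac {poly K} \o polyC).

(** For a of degree at most D this is a(W) times the D-th power of the denominator of W, hence a
    polynomial. *)
Definition compform W a D := homform (map_poly polyC a) D (ratnum W) (ratden W).

Lemma compform_horner W a D z :
  (compform W a D).[z] = homform a D (ratnum W).[z] (ratden W).[z].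
Proof.
have E : map_poly (horner_eval z) (map_poly polyC a) = a.
  by apply/polyP => i; rewrite !coef_map /= /horner_eval hornerC.
by rewrite -[LHS]/(horner_eval z _) rmorph_homform E.
Qed.

Lemma compform_tofrac W a D : (size a <= D.+1)%N ->
  tofrac (compform W a D) = tofrac (ratden W) ^+ D * pev cst W a.
Proof.
move=> sa; rewrite rmorph_homform homform_div ?tofrac_eq0 ?ratden_neq0 //.
  by rewrite -ratfunE -map_poly_comp.
by apply: leq_trans (size_poly _ _) _; rewrite size_map_polyC.
Qed.

Lemma ratden_exp_neq0 W D : tofrac (ratden W) ^+ D != 0.
Proof. by apply: expf_neq0; rewrite tofrac_eq0 ratden_neq0. Qed.

Lemma cross_fraction (G : fieldType) (p q x y d : G) : q != 0 -> p / q * y = x ->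
  (d * x) * q = p * (d * y).
Proof. by move=> q0 <-; field. Qed.

Lemma cross_fraction_inv (G : fieldType) (p q x y d : G) : q != 0 -> d != 0 ->
  d * x * q = p * (d * y) -> p / q * y = x.
Proof. by move=> q0 d0 e; apply: (mulfI d0); apply: (mulIf q0); rewrite e; field. Qed.

Lemma compform_cross P W a b D : (size a <= D.+1)%N -> (size b <= D.+1)%N ->
    pev cst W b != 0 -> P * pev cst W b = pev cst W a ->
  compform W b D != 0 /\ compform W a D * ratden P = ratnum P * compform W b D.
Proof.
move=> sa sb b0 E; split.
  rewrite -tofrac_eq0 (compform_tofrac _ sb); apply: mulf_neq0 b0.
  exact: ratden_exp_neq0.
apply: tofrac_inj; rewrite !tofracM (compform_tofrac _ sa) (compform_tofrac _ sb).
apply: cross_fraction; first by rewrite tofrac_eq0 ratden_neq0.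
by rewrite -ratfunE.
Qed.

Lemma compform_cross_inv P W a b D : (size a <= D.+1)%N -> (size b <= D.+1)%N ->
    compform W b D != 0 -> compform W a D * ratden P = ratnum P * compform W b D ->
  pev cst W b != 0 /\ P * pev cst W b = pev cst W a.
Proof.
move=> sa sb B0 AB; split.
  apply: contraNneq B0 => b0; have := compform_tofrac W sb.
  by rewrite b0 mulr0 => /eqP; rewrite tofrac_eq0.
move/(congr1 (@tofrac {poly K})): AB; rewrite !tofracM.
rewrite (compform_tofrac _ sa) (compform_tofrac _ sb) => AB.
rewrite [in LHS](ratfunE P); apply: cross_fraction_inv AB.
  by rewrite tofrac_eq0 ratden_neq0.
exact: ratden_exp_neq0.
Qed.

End CompositionForm.

(** * Rational maps of the sphere in homogeneous coordinates *)

Section SphereMap.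
Variable R : realType.
Local Notation K := R[i].
Implicit Types (f P W : ratfun K) (z x y : K) (A B : {poly K}).

(* The point with homogeneous coordinates [x : y]. *)
Definition ratio_point x y : CP1 R := if y == 0 then None else Some (x / y).

Lemma ratio_point_scale c x y : c != 0 -> ratio_point (c * x) (c * y) = ratio_point x y.
Proof.
move=> c0; rewrite /ratio_point mulf_eq0 (negPf c0) /=; case: eqP => // /eqP y0.
by rewrite -mulf_div divff ?mul1r.
Qed.

Lemma ratio_point_cross x y x' y' : ratio_point x y = ratio_point x' y' -> x * y' = x' * y.
Proof.
rewrite /ratio_point; case: eqP => [->|/eqP y0]; case: eqP => [->|/eqP y'0] //.
  by rewrite !mulr0.
by move=> [E]; apply: cross_mul.
Qed.

(** The fraction A / B may be reducible; only a common zero at [z] itself would spoil the value. *)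
Lemma ratmap_some f A B z : B != 0 -> A * ratden f = ratnum f * B ->
  (A.[z] != 0) || (B.[z] != 0) -> ratmap f (Some z) = ratio_point A.[z] B.[z].
Proof.
move=> B0 E AB; rewrite /ratmap /ratio_point /rateval.
have Ez : A.[z] * (ratden f).[z] = (ratnum f).[z] * B.[z] by rewrite -!hornerM E.
have [Bz|Bz] := eqVneq B.[z] 0.
  move: AB; rewrite Bz eqxx orbF => Az; move/eqP: Ez.
  by rewrite Bz mulr0 mulf_eq0 (negPf Az) /= => ->.
have [dz|dz] := eqVneq (ratden f).[z] 0; last first.
  by congr Some; apply: (mulIf Bz); rewrite divfK // mulrAC -Ez mulfK.
move/eqP: Ez; rewrite dz mulr0 eq_sym mulf_eq0 (negPf Bz) orbF => nz.
have := coprimep_root (coprimep_ratnum_ratden f) nz; by rewrite dz eqxx.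
Qed.

(** As the coefficients of degree n are not both 0, n is the larger of the two degrees; the leading
    coefficient of the common factor [h] of A and B then cancels. *)
Lemma ratmap_infty f A B n : B != 0 -> A * ratden f = ratnum f * B ->
  (size A <= n.+1)%N -> (size B <= n.+1)%N ->
  (A`_n != 0) || (B`_n != 0) -> ratmap f None = ratio_point A`_n B`_n.
Proof.
move=> B0 E sA sB AB; set u := ratnum f in E *; set v := ratden f in E *.
have v0 : v != 0 := ratden_neq0 f.
have [h [EA EB]] : exists h : {poly K}, A = h * u /\ B = h * v.
  apply: ratfun_common_factor => //.
  rewrite [LHS]ratfunE -/u -/v; apply: divf_unfold; first by rewrite tofrac_eq0.
  have key (G : fieldType) (a b c d : G) : d != 0 -> a * d = c * b -> c / d * b = a.
    by move=> d0 e; apply: (mulIf d0); rewrite e; field.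
  by apply: key; rewrite ?tofrac_eq0 // -!tofracM E.
have h0 : h != 0 by apply: contraNneq B0 => h0; rewrite EB h0 mul0r.
pose m := (maxn (size u) (size v)).-1.
have mv : (0 < maxn (size u) (size v))%N by rewrite leq_max !size_poly_gt0 v0 orbT.
have su : (size u <= m.+1)%N by rewrite prednK ?leq_maxl.
have sv : (size v <= m.+1)%N by rewrite prednK ?leq_maxr.
have sh : (size h <= (size h).-1.+1)%N by rewrite leqSpred.
have [sA' cA] := top_coefM sh su; have [sB' cB] := top_coefM sh sv.
rewrite -!EA -!EB in sA' cA sB' cB.
have nE : ((size h).-1 + m)%N = n.
  have uv : (u`_m != 0) || (v`_m != 0).
    case: (leqP (size u) (size v)) => [/maxn_idPr|/ltnW/maxn_idPl] e.
      by apply/orP; right; rewrite /m e -lead_coefE lead_coef_eq0.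
    apply/orP; left; rewrite /m e -lead_coefE lead_coef_eq0 -size_poly_gt0 -e.
    exact: mv.
  apply/eqP; rewrite eqn_leq; apply/andP; split.
    have big (C c : {poly K}) : C`_((size h).-1 + m) = h`_(size h).-1 * c`_m -> c`_m != 0 ->
        (size C <= n.+1)%N -> ((size h).-1 + m <= n)%N.
      move=> eC cm sC; rewrite leqNgt; apply/negP => lt; move: cm.
      have : C`_((size h).-1 + m) = 0 by rewrite nth_default // (leq_trans sC).
      rewrite eC => /eqP; rewrite mulf_eq0 -lead_coefE lead_coef_eq0 (negPf h0) /= => /eqP ->.
      by rewrite eqxx.
    by case/orP: uv => [um|vm]; [exact: big cA um sA|exact: big cB vm sB].
  rewrite leqNgt; apply/negP => lt; move: AB.
  by rewrite !nth_default ?eqxx // ?(leq_trans sA') ?(leq_trans sB').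
have lh : h`_(size h).-1 != 0 by rewrite -lead_coefE lead_coef_eq0.
rewrite -nE cA cB ratio_point_scale // /ratmap -/u -/v /ratio_point.
case: (leqP (size u) (size v)) => [luv|lvu].
  by rewrite /m (maxn_idPr luv) -lead_coefE lead_coef_eq0 (negPf v0).
by rewrite /m (maxn_idPl (ltnW lvu)) [v`__]nth_default ?eqxx // -ltnS (ltn_predK lvu).
Qed.

Lemma poly_vanishing A : (forall z, A.[z] = 0) -> A = 0.
Proof.
move=> h; apply/eqP/negPn/negP => A0.
have := @max_poly_roots _ A [seq i%:R | i <- iota 0 (size A)] A0.
rewrite map_inj_uniq ?iota_uniq ?size_map ?size_iota ?ltnn; last first.
  by move=> i j /eqP; rewrite eqr_nat => /eqP.
by move=> H; suff : false by []; apply: H => //; apply/allP => z _; apply/rootP/h.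
Qed.

Lemma max_size_coprime (a b : {poly K}) : coprimep a b ->
  (maxn (size a) (size b)).-1.+1 = maxn (size a) (size b).
Proof.
move=> cab; rewrite prednK // lt0n; apply/eqP => E0; move: cab.
have := leq_maxl (size a) (size b); have := leq_maxr (size a) (size b).
rewrite E0 !leqn0 !size_poly_eq0 => /eqP -> /eqP ->.
by rewrite coprimep0 -size_poly_eq1 size_poly0.
Qed.

Lemma ratmap_ratio_point f x y : (x != 0) || (y != 0) ->
    let D := (maxn (size (ratnum f)) (size (ratden f))).-1 in
  ratmap f (ratio_point x y) = ratio_point (homform (ratnum f) D x y) (homform (ratden f) D x y).
Proof.
move=> xy; set D := _.-1; cbn zeta.
have cab := coprimep_ratnum_ratden f; have DE : D.+1 = _ := max_size_coprime cab.
have sn : (size (ratnum f) <= D.+1)%N by rewrite DE leq_maxl.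
have sd : (size (ratden f) <= D.+1)%N by rewrite DE leq_maxr.
have hc := homform_coprime cab xy DE.
rewrite {1}/ratio_point; have [y0|y0] := eqVneq y 0.
  move: xy hc; rewrite y0 eqxx orbF !homform0r => x0; rewrite ![_`_D * _]mulrC => hc.
  rewrite ratio_point_scale ?expf_neq0 //; apply: ratmap_infty => //; first exact: ratden_neq0.
  by move: hc; rewrite !mulf_eq0 expf_eq0 (negPf x0) andbF.
move: hc; by rewrite !homform_div // ratio_point_scale ?expf_neq0.
Qed.

Section Composition.
Local Notation cst := (@tofrac {poly K} \o polyC).
Variables P Pt W : ratfun K.
Let a := ratnum Pt.
Let b := ratden Pt.
Let D := (maxn (size a) (size b)).-1.
Let A := compform W a D.
Let B := compform W b D.
Let cab : coprimep a b := coprimep_ratnum_ratden Pt.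
Let DE : D.+1 = maxn (size a) (size b) := max_size_coprime cab.
Let sa : (size a <= D.+1)%N. Proof. by rewrite DE leq_maxl. Qed.
Let sb : (size b <= D.+1)%N. Proof. by rewrite DE leq_maxr. Qed.

Let Wz z : ((ratnum W).[z] != 0) || ((ratden W).[z] != 0).
Proof.
rewrite -negb_and; apply/negP => /andP[nz dz].
by have := coprimep_root (coprimep_ratnum_ratden W) nz; rewrite dz.
Qed.

Let ABz z : (A.[z] != 0) || (B.[z] != 0).
Proof. by rewrite !compform_horner; apply: homform_coprime. Qed.

Let ratmap_W z : ratmap W (Some z) = ratio_point (ratnum W).[z] (ratden W).[z].
Proof. by apply: ratmap_some => //; exact: ratden_neq0. Qed.

Lemma ratmap_comp : pev cst W b != 0 -> P * pev cst W b = pev cst W a ->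
  forall x : CP1 R, ratmap P x = ratmap Pt (ratmap W x).
Proof.
move=> b0 E.
have [B0 AB] := compform_cross sa sb b0 E.
case=> [z|].
  by rewrite ratmap_W ratmap_ratio_point // (ratmap_some B0 AB) // !compform_horner.
pose e := (maxn (size (ratnum W)) (size (ratden W))).-1.
have eE : e.+1 = _ := max_size_coprime (coprimep_ratnum_ratden W).
have sn : (size (ratnum W) <= e.+1)%N by rewrite eE leq_maxl.
have sd : (size (ratden W) <= e.+1)%N by rewrite eE leq_maxr.
have We : ((ratnum W)`_e != 0) || ((ratden W)`_e != 0).
  case: (leqP (size (ratnum W)) (size (ratden W))) => [/maxn_idPr|/ltnW/maxn_idPl] m.
    by apply/orP; right; rewrite /e m -lead_coefE lead_coef_eq0 ratden_neq0.
  apply/orP; left; rewrite /e m -lead_coefE lead_coef_eq0 -size_poly_gt0 -m.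
  by rewrite leq_max !size_poly_gt0 ratden_neq0 orbT.
rewrite [ratmap W None](@ratmap_infty W _ _ e _ erefl) ?ratden_neq0 // ratmap_ratio_point //.
have [sA cA] := homform_top a D sn sd; have [sB cB] := homform_top b D sn sd.
have := homform_coprime cab We DE; rewrite -cA -cB => h.
by rewrite (ratmap_infty B0 AB sA sB h) cA cB.
Qed.

(** Equal values at infinitely many points give a polynomial identity; so the factorization of maps
    on the sphere becomes one of rational functions. *)
Lemma ratmap_comp_inv : (forall x : CP1 R, ratmap P x = ratmap Pt (ratmap W x)) ->
  pev cst W b != 0 /\ P * pev cst W b = pev cst W a.
Proof.
move=> E.
have AB : A * ratden P = ratnum P * B.
  apply/eqP; rewrite -subr_eq0; apply/eqP/poly_vanishing => z.
  have := E (Some z); rewrite ratmap_W ratmap_ratio_point // -!compform_horner.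
  rewrite (@ratmap_some P (ratnum P) (ratden P)) ?ratden_neq0 //; last first.
    rewrite -negb_and; apply/negP => /andP[nz dz].
    by have := coprimep_root (coprimep_ratnum_ratden P) nz; rewrite dz.
  by move=> /ratio_point_cross; rewrite !hornerE => ->; rewrite subrr.
have B0 : B != 0.
  apply/eqP => B0; move/eqP: AB; rewrite B0 mulr0 mulf_eq0 (negPf (ratden_neq0 P)) orbF => /eqP A0.
  by have := ABz 0; rewrite A0 B0 !horner0 eqxx.
exact: compform_cross_inv AB.
Qed.

End Composition.

Lemma poles_some f z : poles f (Some z) <-> ~ regular f z.
Proof.
rewrite /poles /= /regular; case: eqP => //= ne; split=> //; by case: ne.
Qed.

End SphereMap.

(* The unqualified name [coef1] denotes a lemma on polynomials. *)
Notation one_chain := Defs.coef1.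

(** * Singular chains given by their coefficients *)

Section Chains.
Variable R : realType.

(** Compactness of [0, 1] in a form fit for subdivisions: a local step at the supremum of the x with
    [G 0 x] would pass beyond it. *)
Lemma interval_induction (G : R -> R -> Prop) :
    (forall a b c, a <= b -> b <= c -> G a b -> G b c -> G a c) ->
    (forall t, 0 <= t <= 1 -> exists2 e, 0 < e & forall a b, 0 <= a -> a <= b -> b <= 1 ->
       t - e < a -> b < t + e -> G a b) ->
  G 0 1.
Proof.
move=> Gtrans Gloc; pose S := [set x : R | 0 <= x <= 1 /\ G 0 x].
have S0 : S 0.
  split; first by rewrite lexx ler01.
  have [|e e0 he] := Gloc 0; first by rewrite lexx ler01.
  by apply: he; rewrite ?ler01 // ?add0r ?sub0r ?oppr_lt0.
have supS : has_sup S.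
  by split; [exists 0|exists 1 => x [/andP[]]].
have s01 : 0 <= sup S <= 1.
  apply/andP; split; first exact: (ub_le_sup supS.2 S0).
  by apply: ge_sup; [exists 0|move=> x [/andP[]]].
have [e e0 he] := Gloc _ s01.
have [x [/andP[x0 x1] Gx] ltx] := sup_adherent e0 supS.
have xs : x <= sup S by apply: ub_le_sup => //; [exact: supS.2|split => //; rewrite x0].
pose y := Num.min 1 (sup S + e / 2).
have xy : x <= y by rewrite le_min x1; lra.
have y1 : y <= 1 by rewrite ge_min lexx.
have Gy : G 0 y.
  apply: (Gtrans _ x) => //; apply: he => //.
  by rewrite gt_min; apply/orP; right; lra.
have [E|ne] := eqVneq y 1; first by rewrite -E.
have : y <= sup S by apply: ub_le_sup; [exact: supS.2|split => //; rewrite y1 (le_trans x0)].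
move: ne; rewrite /y; case: (leP 1 (sup S + e / 2)) => [|_ _]; first by rewrite eqxx.
by lra.
Qed.

Definition clamp01 (t : R) : R := Num.max 0 (Num.min 1 t).

Lemma clamp01_itv t : 0 <= clamp01 t <= 1.
Proof. by rewrite /clamp01 le_max lexx /= ge_max ler01 ge_min lexx. Qed.

Lemma clamp01_id t : 0 <= t <= 1 -> clamp01 t = t.
Proof. by case/andP=> t0 t1; rewrite /clamp01 (min_idPr t1) (max_idPr t0). Qed.

Lemma clamp01_continuous : continuous clamp01.
Proof.
move=> t; apply: continuous_max; first exact: cst_continuous.
by apply: continuous_min; [exact: cst_continuous|exact: cvg_id].
Qed.

Lemma continuous_compT (X Y Z : topologicalType) (f : X -> Y) (g : Y -> Z) :
  continuous f -> continuous g -> continuous (fun x => g (f x)).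
Proof. by move=> cf cg x; apply: (@continuous_comp _ _ _ f g); [exact: cf|exact: cg]. Qed.

Lemma pair_continuous (X Y Z : topologicalType) (f : X -> Y) (g : X -> Z) :
  continuous f -> continuous g -> continuous (fun x => (f x, g x)).
Proof. by move=> cf cg x; apply: cvg_pair; [exact: cf|exact: cg]. Qed.

Section Boundaries.
Variable X : topologicalType.
Implicit Types (A : set X) (c p : R -> X) (s : R * R -> X) (h : (R -> X) -> int).

Lemma one_chain_ext c c' p : (forall t, 0 <= t <= 1 -> c t = c' t) -> one_chain c p = one_chain c' p.
Proof.
move=> E; rewrite /Defs.coef1; do 2 f_equal; apply/asbool_equiv_eq; split => H t Ht.
  by rewrite -E ?H //; move: Ht; rewrite in_itv.
by rewrite E ?H //; move: Ht; rewrite in_itv.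
Qed.

(** A chain is represented by its coefficient function [h], so that combinations of paths are sums
    of functions with values in the integers. *)
Definition boundary A h := exists B : seq (int * (R * R -> X)),
  (forall d k, (k < size B)%N -> singular2 A (nth d B k).2) /\
  forall p, \sum_(b <- B)
     b.1 * (one_chain (face0 b.2) p - one_chain (face1 b.2) p + one_chain (face2 b.2) p) = h p.

Lemma boundary_ext A h h' : (forall p, h p = h' p) -> boundary A h -> boundary A h'.
Proof. by move=> E [B [sB hB]]; exists B; split => // p; rewrite hB E. Qed.

Lemma boundary0 A : boundary A (fun=> 0).
Proof. by exists [::]; split => // p; rewrite big_nil. Qed.

Lemma boundaryD A h h' : boundary A h -> boundary A h' -> boundary A (fun p => h p + h' p).
Proof.
move=> [B [sB hB]] [B' [sB' hB']]; exists (B ++ B'); split.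
  move=> d k; rewrite size_cat nth_cat => lt; case: ltnP => [|le]; first exact: sB.
  by apply: sB'; rewrite ltn_subLR.
by move=> p; rewrite big_cat /= hB hB'.
Qed.

Lemma boundaryN A h : boundary A h -> boundary A (fun p => - h p).
Proof.
move=> [B [sB hB]]; exists [seq (- b.1, b.2) | b <- B]; split.
  move=> [n s] k; rewrite size_map => lt.
  by rewrite (nth_map (n, s)) //=; exact: sB.
by move=> p; rewrite big_map -hB -sumrN; apply: eq_bigr => b _; rewrite mulNr.
Qed.

Lemma boundaryB A h h' : boundary A h -> boundary A h' -> boundary A (fun p => h p - h' p).
Proof. by move=> bh bh'; apply: boundaryD => //; apply: boundaryN. Qed.

Lemma boundary_simplex A s : singular2 A s ->
  boundary A (fun p => one_chain (face0 s) p - one_chain (face1 s) p + one_chain (face2 s) p).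
Proof.
move=> ss; exists [:: (1, s)]; split; first by move=> d [|].
by move=> p; rewrite big_seq1 mul1r.
Qed.

Lemma boundaryS A A' h : A `<=` A' -> boundary A h -> boundary A' h.
Proof.
move=> AA' [B [sB hB]]; exists B; split => // d k lt; have [cs sA] := sB d k lt.
by split => //; apply: subset_trans AA'.
Qed.

Lemma singular2_continuous A s : continuous s ->
  (forall x y, 0 <= x -> 0 <= y -> x + y <= 1 -> A (s (x, y))) -> singular2 A s.
Proof.
move=> cs sA; split; first exact: continuous_subspaceT.
by move=> _ [[x y] [x0 y0 xy] <-]; exact: sA.
Qed.

(** The three faces of a constant simplex agree, and the signs 1 - 1 + 1 leave one copy. *)
Lemma boundary_cst A x : A x -> boundary A (one_chain (fun=> x)).
Proof.
move=> Ax; have ss : @singular2 R X A (fun=> x).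
  by apply: singular2_continuous => //; exact: cst_continuous.
by apply: boundary_ext (boundary_simplex ss) => p; rewrite /face0 /face1 /face2 subrr add0r.
Qed.

(** The square is cut along its diagonal into two simplices, whose diagonal faces cancel. *)
Lemma boundary_square A (H : R * R -> X) : continuous H ->
    (forall x y, 0 <= x <= 1 -> 0 <= y <= 1 -> A (H (x, y))) ->
  boundary A (fun p => one_chain (fun t => H (t, 0)) p + one_chain (fun t => H (1, t)) p
     - one_chain (fun t => H (0, t)) p - one_chain (fun t => H (t, 1)) p).
Proof.
move=> cH HA.
have b1 : boundary A (fun p => one_chain (fun t => H (1, t)) p - one_chain (fun t => H (t, t)) p
    + one_chain (fun t => H (t, 0)) p).
  have /boundary_simplex : singular2 A (fun z => H (z.1 + z.2, z.2)).
    apply: singular2_continuous => [z|x y x0 y0 xy] /=; last first.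
      by apply: HA; apply/andP; split; lra.
    apply: (continuous_compT _ cH) => {z} z.
    apply: pair_continuous => {z} z; last exact: cvg_snd.
    by apply: cvgD; [exact: cvg_fst|exact: cvg_snd].
  apply: boundary_ext => p; rewrite /face0 /face1 /face2 /=.
  congr (_ - _ + _); apply: one_chain_ext => t _; congr H; congr pair; lra.
have b2 : boundary A (fun p => one_chain (fun t => H (t, 1)) p - one_chain (fun t => H (t, t)) p
    + one_chain (fun t => H (0, t)) p).
  have /boundary_simplex : singular2 A (fun z => H (z.2, z.1 + z.2)).
    apply: singular2_continuous => [z|x y x0 y0 xy] /=; last first.
      by apply: HA; apply/andP; split; lra.
    apply: (continuous_compT _ cH) => {z} z.
    apply: pair_continuous => {z} z; first exact: cvg_snd.
    by apply: cvgD; [exact: cvg_fst|exact: cvg_snd].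
  apply: boundary_ext => p; rewrite /face0 /face1 /face2 /=.
  congr (_ - _ + _); apply: one_chain_ext => t _; congr H; congr pair; lra.
apply: boundary_ext (boundaryB b1 b2) => p; ring.
Qed.

Definition subpath c a b : R -> X := fun t => c (a + t * (b - a)).

(** The simplex is mapped affinely to the parameter line with its vertices at a, b, d, in whatever
    order these lie. *)
Lemma boundary_concat A c a b d : continuous c -> (forall t, 0 <= t <= 1 -> A (c t)) ->
    0 <= a <= 1 -> 0 <= b <= 1 -> 0 <= d <= 1 ->
  boundary A (fun p => one_chain (subpath c a b) p + one_chain (subpath c b d) p - one_chain (subpath c a d) p).
Proof.
move=> cc cA a01 b01 d01.
have /boundary_simplex : singular2 A (fun z => c (a + z.1 * (b - a) + z.2 * (d - a))).
  apply: singular2_continuous => [z|x y x0 y0 xy] /=; last first.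
    have -> : a + x * (b - a) + y * (d - a) = (1 - x - y) * a + x * b + y * d by ring.
    apply: cA; case/andP: a01 => a0 a1; case/andP: b01 => b0 b1; case/andP: d01 => d0 d1.
    apply/andP; split; first by rewrite !addr_ge0 // mulr_ge0 //; lra.
    have : (1 - x - y) * a <= (1 - x - y) * 1 by apply: ler_wpM2l => //; lra.
    have : x * b <= x * 1 by apply: ler_wpM2l.
    have : y * d <= y * 1 by apply: ler_wpM2l.
    lra.
  apply: (continuous_compT _ cc) => {z} z.
  apply: cvgD; last by apply: cvgMl; exact: cvg_snd.
  by apply: cvgD; [exact: cvg_cst|apply: cvgMl; exact: cvg_fst].
apply: boundary_ext => p; rewrite /face0 /face1 /face2 /=.
have -> : one_chain (fun t => c (a + (1 - t) * (b - a) + t * (d - a))) p = one_chain (subpath c b d) p.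
  by apply: one_chain_ext => t _; congr c; ring.
have -> : one_chain (fun t => c (a + 0 * (b - a) + t * (d - a))) p = one_chain (subpath c a d) p.
  by apply: one_chain_ext => t _; congr c; ring.
have -> : one_chain (fun t => c (a + t * (b - a) + 0 * (d - a))) p = one_chain (subpath c a b) p.
  by apply: one_chain_ext => t _; congr c; ring.
by ring.
Qed.

(** A chain with all coefficients 0 is killed by the additive extension of any function of paths. To
    collect the terms of one path, [rep] picks a representative among the functions equal on
    [0, 1]. *)
Lemma chain_functional (M : zmodType) (Phi : (R -> X) -> M) (L : seq (int * (R -> X))) :
    (forall c c', (forall t, 0 <= t <= 1 -> c t = c' t) -> Phi c = Phi c') ->
    (forall p, \sum_(l <- L) l.1 * one_chain l.2 p = 0) ->
  \sum_(l <- L) Phi l.2 *~ l.1 = 0.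
Proof.
move=> hPhi hL; pose rep c : {classic R -> X} := c \o clamp01.
have repE c p : one_chain c p = ((rep c == rep p) : nat)%:Z.
  rewrite /Defs.coef1; do 2 f_equal; apply/asboolP/eqP => [H|H t Ht].
    by apply/funext => t /=; apply: H; rewrite in_itv /= clamp01_itv.
  have := congr1 (fun f => f t) H; rewrite /rep /= clamp01_id //.
have Prep c : Phi (rep c) = Phi c.
  by apply: hPhi => t t01; rewrite /rep /= clamp01_id.
pose U := undup [seq rep l.2 | l <- L].
have -> : \sum_(l <- L) Phi l.2 *~ l.1 =
    \sum_(l <- L) \sum_(q <- U) (if rep l.2 == q then Phi q *~ l.1 else 0).
  rewrite big_seq [in RHS]big_seq; apply: eq_bigr => l lL.
  have mU : rep l.2 \in U by rewrite mem_undup; exact: (map_f (fun l => rep l.2)).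
  rewrite (bigD1_seq (rep l.2) mU (undup_uniq _)) /=; case: eqP => // _; rewrite Prep.
  by rewrite big1 ?addr0 // => q /negPf; rewrite eq_sym => ->.
rewrite exchange_big /= big_seq big1 // => q; rewrite mem_undup => /mapP[l0 l0L ->].
rewrite (eq_bigr (fun l => Phi (rep l0.2) *~ (l.1 * one_chain l.2 (l0.2)))).
  by rewrite -mulrz_sumr hL mulr0z.
by move=> l _; rewrite repE; case: ifP => _; rewrite ?mulr1 ?mulr0 ?mulr0z.
Qed.

(** The preceding fact for the formal difference between the boundary of [B] and [c]. *)
Lemma boundary_functional (M : zmodType) (Phi : (R -> X) -> M) (B : seq (int * (R * R -> X))) c :
    (forall c c', (forall t, 0 <= t <= 1 -> c t = c' t) -> Phi c = Phi c') ->
    (forall p, \sum_(b <- B)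
     b.1 * (one_chain (face0 b.2) p - one_chain (face1 b.2) p + one_chain (face2 b.2) p) = one_chain c p) ->
  \sum_(b <- B) (Phi (face0 b.2) - Phi (face1 b.2) + Phi (face2 b.2)) *~ b.1 = Phi c.
Proof.
move=> hPhi hB.
pose L := (-1, c) :: flatten [seq [:: (b.1, face0 b.2); (- b.1, face1 b.2); (b.1, face2 b.2)] | b <- B].
have sumL (N : zmodType) (F : int * (R -> X) -> N) : \sum_(l <- L) F l =
    F (-1, c) + \sum_(b <- B) (F (b.1, face0 b.2) + F (- b.1, face1 b.2) + F (b.1, face2 b.2)).
  rewrite big_cons; congr (_ + _); elim: (B) => [|b B' IH]; first by rewrite !big_nil.
  by rewrite big_cons /= 3!big_cons IH !addrA.
have := @chain_functional M Phi L hPhi; rewrite sumL mulrN1z => H.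
apply/esym/eqP; rewrite -subr_eq0 -opprB oppr_eq0 addrC; apply/eqP.
rewrite -{}[RHS]H.
  by congr (_ + _); apply: eq_bigr => b _; rewrite mulrNz !mulrzDl mulNrz.
move=> p; rewrite sumL mulN1r -hB addrC; apply/eqP; rewrite subr_eq0; apply/eqP.
by apply: eq_bigr => b _ /=; ring.
Qed.

End Boundaries.

(** Different paths may have equal images under [f], so coefficients cannot be carried over one by
    one; the coefficient of the image at [p] serves as a functional instead. *)
Lemma boundary_push (X Y : topologicalType) (A : set X) (A' : set Y) (f : X -> Y) c :
    (forall s : R * R -> X, singular2 A s -> singular2 A' (f \o s)) ->
  boundary A (one_chain c) -> boundary A' (one_chain (f \o c)).
Proof.
move=> fs [B [sB hB]]; exists [seq (b.1, f \o b.2) | b <- B]; split.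
  case=> n s k; rewrite size_map => lt.
  have d : int * (R * R -> X) := (0, fun=> c 0).
  by rewrite (nth_map d) //=; apply: fs; exact: sB.
move=> p; rewrite big_map.
have := @boundary_functional X int (fun q => one_chain (f \o q) p) B c _ hB => <-.
  by apply: eq_bigr => b _; rewrite mulrzz [RHS]mulrC.
by move=> q q' E; apply: one_chain_ext => t t01; rewrite /= E.
Qed.

Lemma singular2_comp (X Y : topologicalType) (A : set X) (A' : set Y) (f : X -> Y)
  (s : R * R -> X) : continuous f -> (forall x, A x -> A' (f x)) ->
  singular2 A s -> singular2 A' (f \o s).
Proof.
move=> cf fA [cs sA]; split.
  by move=> x; apply: (@continuous_comp (subspace _) X Y s f x); [exact: cs|exact: cf].
by move=> _ [x sx <-]; apply: fA; apply: sA; exists x.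
Qed.

End Chains.

(** * Continuous choice of the argument *)

Section PlaneAngles.
Variable R : realType.
Implicit Types (u w : R * R) (theta : R).

Definition dot u w : R := u.1 * w.1 + u.2 * w.2.
Definition cross u w : R := u.1 * w.2 - u.2 * w.1.
(* The angle from u to w, provided that [dot u w] is positive. *)
Definition turn u w : R := atan (cross u w / dot u w).
Definition polar u theta := exists2 r, 0 < r & u = (r * cos theta, r * sin theta).

Lemma sin_atan (x : R) : sin (atan x) = x * cos (atan x).
Proof.
have {2}-> : x = sin (atan x) / cos (atan x) by rewrite -/(tan _) atanK.
rewrite divfK //; apply: lt0r_neq0; apply: cos_gt0_pihalf.
by rewrite atan_gtNpi2 atan_ltpi2.
Qed.

Lemma polar_turn u w theta : polar u theta -> 0 < dot u w -> polar w (theta + turn u w).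
Proof.
case=> r r0 -> d0; set d := dot _ _ in d0; set phi := turn _ _.
have k0 : 0 < cos phi by apply: cos_gt0_pihalf; rewrite atan_gtNpi2 atan_ltpi2.
have Es : sin phi = cross (r * cos theta, r * sin theta) w / d * cos phi by exact: sin_atan.
exists (d / (cos phi * r)); first by rewrite divr_gt0 ?mulr_gt0.
have ct := cos2Dsin2 theta.
have c0 : cos phi != 0 by rewrite gt_eqF.
have rn0 : r != 0 by rewrite gt_eqF.
have dn0 : d != 0 by rewrite gt_eqF.
have E1 : d * cos theta - cross (r * cos theta, r * sin theta) w * sin theta = r * w.1.
  rewrite /d /dot /cross /=.
  transitivity (r * w.1 * (cos theta ^+ 2 + sin theta ^+ 2)); first by ring.
  by rewrite ct mulr1.
have E2 : d * sin theta + cross (r * cos theta, r * sin theta) w * cos theta = r * w.2.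
  rewrite /d /dot /cross /=.
  transitivity (r * w.2 * (cos theta ^+ 2 + sin theta ^+ 2)); first by ring.
  by rewrite ct mulr1.
rewrite [LHS]surjective_pairing cosD sinD Es; congr pair.
  apply: (mulfI rn0); rewrite -E1; by field; rewrite c0 rn0 dn0.
apply: (mulfI rn0); rewrite -E2; by field; rewrite c0 rn0 dn0.
Qed.

(** Every nonzero vector has a positive scalar product with one of the four unit vectors on the
    axes. *)
Lemma polar_exists u : u != (0, 0) -> exists theta, polar u theta.
Proof.
case: u => x y; rewrite xpair_eqE negb_and => nz.
have p1 : polar (1, 0) 0 by exists 1; rewrite ?cos0 ?sin0 ?mulr1 ?mulr0.
have p2 : polar (0, 1) (pi / 2).
  by exists 1; rewrite ?cos_pihalf ?sin_pihalf ?mulr1 ?mulr0.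
have p3 : polar (0, -1) (- (pi / 2)).
  by exists 1; rewrite ?cosN ?sinN ?cos_pihalf ?sin_pihalf ?mulrN ?mulr1 ?mulr0.
have p4 : polar (-1, 0) pi.
  by exists 1; rewrite ?cospi ?sinpi ?mulr0 ?mul1r.
have [y0|y0|y0] := ltgtP y 0.
- by eexists; apply: (polar_turn p3); rewrite /dot /= mul0r add0r mulN1r oppr_gt0.
- by eexists; apply: (polar_turn p2); rewrite /dot /= mul0r add0r mul1r.
- have [x0|x0|x0] := ltgtP x 0.
  + by eexists; apply: (polar_turn p4); rewrite /dot /= mul0r addr0 mulN1r oppr_gt0.
  + by eexists; apply: (polar_turn p1); rewrite /dot /= mul0r addr0 mul1r.
  + by move: nz; rewrite x0 y0 eqxx.
Qed.

Lemma polar_unique u theta theta' : polar u theta -> polar u theta' ->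
  cos (theta' - theta) = 1 /\ sin (theta' - theta) = 0.
Proof.
case=> r r0 -> [r' r'0 [E1 E2]].
have ct := cos2Dsin2 theta; have ct' := cos2Dsin2 theta'.
have : r ^+ 2 * (cos theta ^+ 2 + sin theta ^+ 2) = r' ^+ 2 * (cos theta' ^+ 2 + sin theta' ^+ 2).
  by rewrite !mulrDr -!exprMn E1 E2.
rewrite ct ct' !mulr1 => /eqP; rewrite eqrXn2 ?ltW // => /eqP Er.
move: E1 E2; rewrite Er => /(mulfI (lt0r_neq0 r'0)) E1 /(mulfI (lt0r_neq0 r'0)) E2.
rewrite cosD sinD cosN sinN -E1 -E2; split; last by ring.
by rewrite -ct; ring.
Qed.

Lemma dot_gt0 u : u != (0, 0) -> 0 < dot u u.
Proof.
case: u => x y; rewrite xpair_eqE negb_and /dot /= -!expr2.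
by case/orP => h; [apply: ltr_wpDr|apply: ltr_wpDl]; rewrite ?sqr_ge0 // exprn_even_gt0.
Qed.

Lemma polar_neq0 u theta : polar u theta -> u != (0, 0).
Proof.
case=> r r0 ->; rewrite xpair_eqE !mulf_eq0 (gt_eqF r0) /=; apply/negP => /andP[/eqP c /eqP s].
by have := cos2Dsin2 theta; rewrite c s !expr0n addr0 => /eqP; rewrite eq_sym oner_eq0.
Qed.

Lemma continuous_fst (T X Y : topologicalType) (f : T -> X * Y) : continuous f -> continuous (fun t => (f t).1).
Proof. by move=> cf; apply: (continuous_compT cf) => z; exact: cvg_fst. Qed.

Lemma continuous_snd (T X Y : topologicalType) (f : T -> X * Y) : continuous f -> continuous (fun t => (f t).2).
Proof. by move=> cf; apply: (continuous_compT cf) => z; exact: cvg_snd. Qed.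

Section Continuity.
Variable T : topologicalType.
Implicit Types f g : T -> R * R.

Lemma continuous_add (a b : T -> R) : continuous a -> continuous b ->
  continuous (fun t => a t + b t).
Proof. by move=> ca cb t; apply: cvgD; [exact: ca|exact: cb]. Qed.

Lemma continuous_sub (a b : T -> R) : continuous a -> continuous b ->
  continuous (fun t => a t - b t).
Proof. by move=> ca cb t; apply: cvgB; [exact: ca|exact: cb]. Qed.

Lemma continuous_mul (a b : T -> R) : continuous a -> continuous b ->
  continuous (fun t => a t * b t).
Proof. by move=> ca cb t; apply: cvgM; [exact: ca|exact: cb]. Qed.

Lemma continuous_dot f g : continuous f -> continuous g -> continuous (fun t => dot (f t) (g t)).
Proof.
move=> cf cg; apply: continuous_add; apply: continuous_mul;
  by [exact: continuous_fst|exact: continuous_snd].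
Qed.

Lemma continuous_turn f g : continuous f -> continuous g -> (forall t, 0 < dot (f t) (g t)) ->
  continuous (fun t => turn (f t) (g t)).
Proof.
move=> cf cg d0; apply: (@continuous_compT _ _ _ _ (@atan R)); last first.
  by move=> x; exact: continuous_atan.
apply: continuous_mul; last first.
  move=> t; apply: (@cvgV R T (nbhs t) _ (fun t => dot (f t) (g t))).
    by rewrite gt_eqF.
  exact: continuous_dot.
apply: continuous_sub; apply: continuous_mul;
  by [exact: continuous_fst|exact: continuous_snd].
Qed.

End Continuity.

(** [G] is positive near each (x, 0), and compactness makes one step size work for all x. *)
Lemma compact_small_step (T : topologicalType) (K : set T) (G : T * R -> R) :
  compact K -> continuous G -> (forall x, K x -> 0 < G (x, 0)) ->
  exists N, forall x, K x -> 0 < G (x, N.+1%:R^-1).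
Proof.
move=> /compact_near_coveringP cK cG G0.
have := cK nat (\oo)%classic (fun n x => 0 < G (x, n.+1%:R^-1)) _.
case.
  move=> x Kx; have : \forall z \near (x, 0 : R), 0 < G z.
    by apply: (cvgr_gt _ (cG (x, 0))); exact: G0.
  case=> -[U V] /= [Ux V0] UV.
  exists (U, [set n | V (n.+1%:R^-1)]) => /=; last by move=> [y n] [] Uy Vn; exact: UV.
  split => //; exact: (@cvg_harmonic R).
by move=> N _ h; exists N; apply: h => /=.
Qed.

Lemma polar_telescope (v : nat -> R * R) theta N : polar (v 0) theta ->
    (forall k, (k < N)%N -> 0 < dot (v k) (v k.+1)) ->
  polar (v N) (theta + \sum_(0 <= k < N) turn (v k) (v k.+1)).
Proof.
move=> p0; elim: N => [|N IH] h; first by rewrite big_nil addr0.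
rewrite big_nat_recr //= addrA; apply: polar_turn; last exact: h.
by apply: IH => k lt; apply: h; rewrite ltnW.
Qed.

Lemma continuous_sum (T : topologicalType) (f : nat -> T -> R) N :
  (forall k, (k < N)%N -> continuous (f k)) -> continuous (fun t => \sum_(0 <= k < N) f k t).
Proof.
elim: N => [|N IH] h.
  by under eq_fun do rewrite big_nil; exact: cst_continuous.
under eq_fun do rewrite big_nat_recr //=.
apply: continuous_add; last exact: h.
by apply: IH => k lt; apply: h; rewrite ltnW.
Qed.

(** The argument is transported from 0 to x along the segment, in N + 1 equal steps that turn by
    less than a right angle. As N is the same for all x, the lift is a finite sum of continuous
    functions. *)
Lemma polar_lift_square (u : R * R -> R * R) : continuous u -> (forall x, u x != (0, 0)) ->
  exists2 theta : R * R -> R, continuous theta &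
    forall x, 0 <= x.1 <= 1 -> 0 <= x.2 <= 1 -> polar (u x) (theta x).
Proof.
move=> cu u0.
(* The variables are x, s and h: this is the scalar product of the values of [u] at s x and (s + h)
   x. *)
pose G (z : (R * R * R) * R) := dot (u (z.1.2 * z.1.1.1, z.1.2 * z.1.1.2))
  (u ((z.1.2 + z.2) * z.1.1.1, (z.1.2 + z.2) * z.1.1.2)).
have cs1 : continuous (fun z : (R * R * R) * R => z.1.2).
  by apply: continuous_snd => z; exact: cvg_fst.
have cx1 : continuous (fun z : (R * R * R) * R => z.1.1.1).
  apply: continuous_fst; apply: (@continuous_compT _ _ _ fst fst) => z; exact: cvg_fst.
have cx2 : continuous (fun z : (R * R * R) * R => z.1.1.2).
  apply: continuous_snd; apply: (@continuous_compT _ _ _ fst fst) => z; exact: cvg_fst.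
have cs2 : continuous (fun z : (R * R * R) * R => z.2) by move=> z; exact: cvg_snd.
have cG : continuous G.
  apply: continuous_dot; apply: (continuous_compT _ cu); apply: pair_continuous;
    apply: continuous_mul => //; exact: continuous_add.
have cK : compact ((`[0, 1] `*` `[0, 1]) `*` `[0, 1] : set (R * R * R)).
  by do 2?apply: compact_setX; exact: segment_compact.
have [|N hN] := compact_small_step cK cG.
  by move=> [[x y] s] _; rewrite /G /= addr0; exact: dot_gt0.
(* Clamping to the unit square keeps all turns well defined, and the lift continuous, on the whole
   plane. *)
pose cl (x : R * R) := (clamp01 x.1, clamp01 x.2).
pose v (x : R * R) (k : nat) := u (k%:R / N.+1%:R * (cl x).1, k%:R / N.+1%:R * (cl x).2).
have ccl : continuous cl.
  apply: pair_continuous; apply: (@continuous_compT _ _ _ _ (@clamp01 R)).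
  - by move=> z; exact: cvg_fst.
  - exact: clamp01_continuous.
  - by move=> z; exact: cvg_snd.
  - exact: clamp01_continuous.
have cv k : continuous (fun x => v x k).
  apply: (continuous_compT _ cu); apply: pair_continuous; apply: continuous_mul.
  - exact: cst_continuous.
  - exact: continuous_fst.
  - exact: cst_continuous.
  - exact: continuous_snd.
have vdot x k : (k < N.+1)%N -> 0 < dot (v x k) (v x k.+1).
  move=> lt; have := hN ((clamp01 x.1, clamp01 x.2), k%:R / N.+1%:R); rewrite /G /=.
  have -> : k%:R / N.+1%:R + N.+1%:R^-1 = k.+1%:R / N.+1%:R :> R.
    by rewrite -[X in _ + X]mul1r -mulrDl natr1.
  apply.
  split; first by split; rewrite /= in_itv /= clamp01_itv.
  rewrite /= in_itv /= divr_ge0 //= ler_pdivrMr ?ltr0n // mul1r ler_nat.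
  exact: ltnW.
have [theta0 h0] := polar_exists (u0 (0, 0)).
exists (fun x => theta0 + \sum_(0 <= k < N.+1) turn (v x k) (v x k.+1)).
  apply: continuous_add; first exact: cst_continuous.
  apply: continuous_sum => k lt; apply: continuous_turn => // x; exact: vdot.
move=> [x1 x2] x01 y01.
have -> : u (x1, x2) = v (x1, x2) N.+1.
  by rewrite /v /cl /= !clamp01_id // divff ?mul1r // pnatr_eq0.
by apply: polar_telescope; [rewrite /v !mul0r|move=> k lt; exact: vdot].
Qed.

Lemma polar_lift_path (u : R -> R * R) : continuous u -> (forall t, u t != (0, 0)) ->
  exists2 theta : R -> R, continuous theta & forall t, 0 <= t <= 1 -> polar (u t) (theta t).
Proof.
move=> cu u0; have [||theta ct h] := @polar_lift_square (u \o fst).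
- by apply: (continuous_compT _ cu) => z; exact: cvg_fst.
- by move=> x; exact: u0.
exists (fun t => theta (t, 0)).
  by apply: (continuous_compT _ ct); apply: pair_continuous => t; [exact: cvg_id|exact: cvg_cst].
by move=> t t01; apply: (h (t, 0)) => //=; rewrite lexx ler01.
Qed.

(** The difference d of two arguments satisfies cos d = 1 and sin d = 0; values of d closer than pi
    coincide, so a continuous d is locally constant. *)
Lemma polar_lift_unique (u : R -> R * R) (theta theta' : R -> R) :
    continuous theta -> continuous theta' ->
    (forall t, 0 <= t <= 1 -> polar (u t) (theta t)) ->
    (forall t, 0 <= t <= 1 -> polar (u t) (theta' t)) ->
  theta 1 - theta 0 = theta' 1 - theta' 0.
Proof.
move=> ct ct' h h'; pose d t := theta' t - theta t.
suff : d 0 = d 1 by rewrite /d; lra.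
have cd : continuous d by exact: continuous_sub.
have dP t : 0 <= t <= 1 -> cos (d t) = 1 /\ sin (d t) = 0.
  by move=> t01; apply: polar_unique; [exact: h|exact: h'].
have small (x : R) : sin x = 0 -> `|x| < pi -> x = 0 :> R.
  move=> sx; rewrite ltr_norml => /andP[x1 x2]; have [x0|x0|//] := ltgtP x 0.
    have : 0 < sin (- x) by apply: sin_gt0_pi; lra.
    by rewrite sinN sx oppr0 ltxx.
  have : 0 < sin x by apply: sin_gt0_pi; rewrite x0.
  by rewrite sx ltxx.
apply: (interval_induction (G := fun a b => d a = d b)) => [a b c _ _ -> //|t t01].
have /cvgrPdist_lt /(_ (pi / 2)) := cd t; case; first by rewrite divr_gt0 ?pi_gt0.
move=> e /= e0 he; exists e => // a b a0 ab b1 lea ltb.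
have close x : t - e < x -> x < t + e -> `|d t - d x| < pi / 2.
  by move=> h1 h2; apply: he; rewrite /= ltr_norml; lra.
apply/esym/eqP; rewrite -subr_eq0; apply/eqP.
have [ca sa] : cos (d a) = 1 /\ sin (d a) = 0 by apply: dP; rewrite a0 (le_trans ab).
have [cb sb] : cos (d b) = 1 /\ sin (d b) = 0 by apply: dP; rewrite b1 (le_trans a0).
apply: small; first by rewrite sinB ca sa cb sb mulr0 mul0r subr0.
have := close a lea (le_lt_trans ab ltb); have := close b (lt_le_trans lea ab) ltb.
by rewrite !ltr_norml; lra.
Qed.

(** For a loop avoiding 0 this means winding number 0 around 0. *)
Definition closed_angle (u : R -> R * R) := exists theta : R -> R,
  [/\ continuous theta, forall t, 0 <= t <= 1 -> polar (u t) (theta t) & theta 0 = theta 1].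

(** The angle from u to w stays below a right angle and returns to its initial value, so both loops
    wind equally often. *)
Lemma closed_angle_turn (u w : R -> R * R) : continuous u -> continuous w ->
    (forall t, 0 < dot (u t) (w t)) -> u 0 = u 1 -> w 0 = w 1 ->
  closed_angle u -> closed_angle w.
Proof.
move=> cu cw d0 u01 w01 [theta [ct h e]]; exists (fun t => theta t + turn (u t) (w t)); split.
- by apply: continuous_add => //; exact: continuous_turn.
- by move=> t t01; apply: polar_turn; [exact: h|exact: d0].
- by rewrite e u01 w01.
Qed.

End PlaneAngles.

(** * Winding number 0 of null-homologous loops *)

Section Winding.
Variable R : realType.

Lemma within_compT (X Y Z : topologicalType) (B : set X) (f : X -> Y) (g : Z -> X) :
  {within B, continuous f} -> continuous g -> (forall z, B (g z)) -> continuous (fun z => f (g z)).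
Proof.
move=> /subspace_continuousP cf cg gB z.
have gw : g x @[x --> z] --> within B (nbhs (g z)).
  move=> P wP; have : \forall x \near z, B (g x) -> P (g x) by exact: cg z _ wP.
  by apply: filterS => x; apply; exact: gB.
exact: (cvg_comp g f gw (cf _ (gB z))).
Qed.

Lemma continuous_minf (T : topologicalType) (f g : T -> R) : continuous f -> continuous g ->
  continuous (fun t => Num.min (f t) (g t)).
Proof. by move=> cf cg t; exact: (@continuous_min R T f g t (cf t) (cg t)). Qed.

Lemma continuous_maxf (T : topologicalType) (f g : T -> R) : continuous f -> continuous g ->
  continuous (fun t => Num.max (f t) (g t)).
Proof. by move=> cf cg t; exact: (@continuous_max R T f g t (cf t) (cg t)). Qed.

(** A continuous retraction of the plane onto the simplex; it extends singular simplices to the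
    plane, where arguments are lifted. *)
Definition simplex_retract (z : R * R) : R * R :=
  (clamp01 z.1, Num.min (clamp01 z.2) (1 - clamp01 z.1)).

Lemma simplex_retract_simplex z : simplex2 (simplex_retract z).
Proof.
have /andP[x0 x1] := clamp01_itv z.1; have /andP[y0 y1] := clamp01_itv z.2.
split => //=; first by rewrite le_min y0 subr_ge0.
by rewrite -lerBrDl ge_min lexx orbT.
Qed.

Lemma simplex_retract_id x y : 0 <= x -> 0 <= y -> x + y <= 1 -> simplex_retract (x, y) = (x, y).
Proof.
move=> x0 y0 xy; rewrite /simplex_retract /= !clamp01_id; try by apply/andP; split; lra.
by congr pair; apply/min_idPl; lra.
Qed.

Lemma simplex_retract_continuous : continuous simplex_retract.
Proof.
have c1 : continuous (fun z : R * R => clamp01 z.1).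
  by apply: (continuous_compT _ (@clamp01_continuous R)) => z; exact: cvg_fst.
apply: pair_continuous; first exact: c1.
apply: continuous_minf.
  by apply: (continuous_compT _ (@clamp01_continuous R)) => z; exact: cvg_snd.
by move=> z; apply: cvgB; [exact: cvg_cst|exact: c1].
Qed.

(** The total variation of the argument, independent of the lift by uniqueness; 0 is the default for
    paths without a lift. *)
Definition angle_value (u : R -> R * R) : R :=
  xget 0 [set d | exists theta : R -> R, [/\ continuous theta,
    forall t, 0 <= t <= 1 -> polar (u t) (theta t) & d = theta 1 - theta 0]].

Lemma angle_valueE (u : R -> R * R) (theta : R -> R) : continuous theta ->
  (forall t, 0 <= t <= 1 -> polar (u t) (theta t)) -> angle_value u = theta 1 - theta 0.
Proof.
move=> ct h; apply: xget_unique; first by exists theta.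
by move=> _ [theta' [ct' h' ->]]; exact: polar_lift_unique ct' ct h' h.
Qed.

Lemma angle_value_ext (u v : R -> R * R) : (forall t, 0 <= t <= 1 -> u t = v t) ->
  angle_value u = angle_value v.
Proof.
move=> E; rewrite /angle_value; congr xget; apply/seteqP; split => d [theta [ct h e]].
  by exists theta; split => // t t01; rewrite -E //; exact: h.
by exists theta; split => // t t01; rewrite E //; exact: h.
Qed.

(** The variation of the argument extends additively to chains and vanishes on the boundary of each
    2-simplex, over which the argument lifts. *)
Lemma homologous_closed_angle (X : topologicalType) (A : set X) (c : R -> X) (y : X -> R * R) :
    homologous_to_zero A c -> (forall x, A x -> {for x, continuous y}) ->
    (forall x, A x -> y x != (0, 0)) -> closed_angle (y \o c).
Proof.
move=> [[cc cA] [B [sB hB]]] cy y0.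
have cA' t : A (c (clamp01 t)).
  by apply: cA; exists (clamp01 t) => //=; rewrite in_itv /= clamp01_itv.
have cc' : continuous (fun t => c (clamp01 t)).
  apply: (within_compT cc (@clamp01_continuous R)) => t.
  by rewrite /= in_itv /= clamp01_itv.
have [||theta ct h] := @polar_lift_path R (fun t => y (c (clamp01 t))).
- move=> t; apply: (@continuous_comp _ _ _ (fun t => c (clamp01 t)) y); first exact: cc'.
  exact: cy.
- by move=> t; apply: y0.
have h' t : 0 <= t <= 1 -> polar ((y \o c) t) (theta t).
  by move=> t01; have := h t t01; rewrite clamp01_id.
exists theta; split => //; apply/esym/eqP; rewrite -subr_eq0 -(angle_valueE ct h'); apply/eqP.
have := @boundary_functional R X R (fun q => angle_value (y \o q)) B c _ hB => <-; last first.
  by move=> q q' E; apply: angle_value_ext => t t01 /=; rewrite E.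
rewrite (big_nth (0, fun=> c 0)) big_mkord big1 // => -[k lt] _ /=.
set s := (nth _ B k).2; have [cs sA] : singular2 A s by exact: sB.
pose u z := y (s (simplex_retract z)).
have sA' z : A (s (simplex_retract z)).
  by apply: sA; exists (simplex_retract z) => //; exact: simplex_retract_simplex.
have [||Th cTh hTh] := @polar_lift_square R u.
- move=> z; apply: (@continuous_comp _ _ _ (fun z => s (simplex_retract z)) y); last exact: cy.
  apply: (within_compT cs simplex_retract_continuous) => {z} z; exact: simplex_retract_simplex.
- by move=> z; exact: y0.
(* Along a face the variation is the difference of the values of the lift at two vertices. *)
have key (f g : R -> R) : continuous f -> continuous g ->
    (forall t, 0 <= t <= 1 -> [/\ 0 <= f t, 0 <= g t & f t + g t <= 1]) ->
    angle_value (fun t => y (s (f t, g t))) = Th (f 1, g 1) - Th (f 0, g 0).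
  move=> cf cg fg; apply: (@angle_valueE _ (fun t => Th (f t, g t))).
    by apply: (continuous_compT _ cTh); exact: pair_continuous.
  move=> t t01; have [ft gt fgt] := fg t t01.
  have := hTh (f t, g t); rewrite /u simplex_retract_id //=; apply; apply/andP; split; lra.
have cid : continuous (fun t : R => t) by move=> t; exact: cvg_id.
have czero : continuous (fun t : R => 0 : R) by move=> t; exact: cvg_cst.
have c1 : continuous (fun t : R => 1 - t : R).
  by move=> t; apply: cvgB; [exact: cvg_cst|exact: cvg_id].
rewrite (_ : angle_value (y \o face0 s) = Th (0, 1) - Th (1, 0)); last first.
  rewrite [LHS](key (fun t => 1 - t) (fun t => t)) ?subrr ?subr0 // => t /andP[t0 t1].
  by split; lra.
rewrite (_ : angle_value (y \o face1 s) = Th (0, 1) - Th (0, 0)); last first.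
  by rewrite [LHS](key (fun t => 0) (fun t => t)) // => t /andP[t0 t1]; split; lra.
rewrite (_ : angle_value (y \o face2 s) = Th (1, 0) - Th (0, 0)); last first.
  by rewrite [LHS](key (fun t => t) (fun t => 0)) // => t /andP[t0 t1]; split; lra.
by rewrite [X in X *~ _](_ : _ = 0) ?mul0rz //; ring.
Qed.

End Winding.

(** * Loops in the plane without finitely many points *)

Section PlaneLoops.
Variable R : realType.
Local Notation E := (R * R)%type.
Implicit Types (q x : E) (c p : R -> E) (S : seq E) (b : bool) (beta : R).

Definition lin q (s : R) x : E := (q.1 + s * (x.1 - q.1), q.2 + s * (x.2 - q.2)).

Lemma continuous_lin (T : topologicalType) (f : T -> R) (g : T -> E) q :
  continuous f -> continuous g -> continuous (fun t => lin q (f t) (g t)).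
Proof.
move=> cf cg; apply: pair_continuous => t; apply: cvgD; try exact: cvg_cst;
  apply: cvgM; try exact: cf; apply: cvgB; try exact: cvg_cst.
- exact: continuous_fst.
- exact: continuous_snd.
Qed.

Lemma lin1 q x : lin q 1 x = x.
Proof. by case: x q => x y [a d]; rewrite /lin /=; congr pair; ring. Qed.

Definition convex D := forall q x (s : R), D q -> D x -> 0 <= s <= 1 -> D (lin q s x).

(** The segments from [q] to the points of [p] form a square with one constant side, which is itself
    a boundary. The two remaining sides cancel for a loop. *)
Lemma cone_boundary (D A : set E) q p : convex D -> D `<=` A -> D q -> continuous p ->
    (forall t, 0 <= t <= 1 -> D (p t)) ->
  boundary A (fun g => one_chain p g + one_chain (fun s => lin q s (p 0)) g
     - one_chain (fun s => lin q s (p 1)) g).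
Proof.
move=> cD DA Dq cp pD.
have cH : continuous (fun z : R * R => lin q z.1 (p z.2)).
  apply: continuous_lin => [z|]; first exact: cvg_fst.
  by apply: (continuous_compT _ cp) => z; exact: cvg_snd.
have HA (x y : R) : 0 <= x <= 1 -> 0 <= y <= 1 -> A (lin q x (p y)).
  by move=> x01 y01; apply: DA; apply: cD => //; exact: pD.
have := boundaryD (boundary_square cH HA) (boundary_cst R (DA _ Dq)).
apply: boundary_ext => g /=.
have -> : one_chain (fun t => lin q 1 (p t)) g = one_chain p g.
  by apply: one_chain_ext => t _; exact: lin1.
have -> : one_chain (fun t => lin q 0 (p t)) g = one_chain (fun=> q) g.
  by apply: one_chain_ext => t _; rewrite /lin !mul0r !addr0 -surjective_pairing.
by ring.
Qed.

Lemma convex_loop_boundary (D A : set E) p : convex D -> D `<=` A -> continuous p ->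
  (forall t, 0 <= t <= 1 -> D (p t)) -> p 0 = p 1 -> boundary A (one_chain p).
Proof.
move=> cD DA cp pD p01.
have Dq : D (p 0) by apply: pD; rewrite lexx ler01.
have := cone_boundary cD DA Dq cp pD; apply: boundary_ext => g.
by rewrite -p01; ring.
Qed.

Definition coord b x := if b then x.1 else x.2.
Definition setcoord b (v : R) x : E := if b then (v, x.2) else (x.1, v).
(* Retractions onto the two closed half planes bounded by the line [coord b x = beta], and
   onto this line. *)
Definition clampU b beta x := setcoord b (Num.max (coord b x) beta) x.
Definition clampV b beta x := setcoord b (Num.min (coord b x) beta) x.
Definition clampL b beta x := setcoord b beta x.

Lemma coord_setcoord b v x : coord b (setcoord b v x) = v. Proof. by case: b. Qed.
Lemma coord_setcoordN b v x : coord (~~ b) (setcoord b v x) = coord (~~ b) x.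
Proof. by case: b. Qed.

Lemma coord_ext b x y : coord b x = coord b y -> coord (~~ b) x = coord (~~ b) y -> x = y.
Proof. by case: b x y => -[a a'] [d d'] /= -> ->. Qed.

Lemma clampU_ge b beta x : beta <= coord b x -> clampU b beta x = x.
Proof. by move=> h; apply: (@coord_ext b); rewrite ?coord_setcoord ?coord_setcoordN ?(max_idPl h). Qed.
Lemma clampU_le b beta x : coord b x <= beta -> clampU b beta x = clampL b beta x.
Proof. by move=> h; rewrite /clampU (max_idPr h). Qed.
Lemma clampV_le b beta x : coord b x <= beta -> clampV b beta x = x.
Proof. by move=> h; apply: (@coord_ext b); rewrite ?coord_setcoord ?coord_setcoordN ?(min_idPl h). Qed.
Lemma clampV_ge b beta x : beta <= coord b x -> clampV b beta x = clampL b beta x.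
Proof. by move=> h; rewrite /clampV (min_idPr h). Qed.

Lemma continuous_coord (T : topologicalType) (f : T -> E) b : continuous f ->
  continuous (fun t => coord b (f t)).
Proof. by case: b => cf; [exact: continuous_fst|exact: continuous_snd]. Qed.

Lemma continuous_setcoord (T : topologicalType) (v : T -> R) (f : T -> E) b :
  continuous v -> continuous f -> continuous (fun t => setcoord b (v t) (f t)).
Proof.
case: b => cv cf; apply: pair_continuous => //; [exact: continuous_snd|exact: continuous_fst].
Qed.

Lemma continuous_idE : continuous (fun x : E => x).
Proof. by move=> x; exact: cvg_id. Qed.

Lemma continuous_cstf (T : topologicalType) (v : R) : continuous (fun _ : T => v).
Proof. by move=> x; exact: cvg_cst. Qed.

Lemma clampU_continuous b beta : continuous (clampU b beta).
Proof.
apply: continuous_setcoord; last exact: continuous_idE.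
apply: continuous_maxf; last exact: continuous_cstf.
exact: continuous_coord continuous_idE.
Qed.

Lemma clampV_continuous b beta : continuous (clampV b beta).
Proof.
apply: continuous_setcoord; last exact: continuous_idE.
apply: continuous_minf; last exact: continuous_cstf.
exact: continuous_coord continuous_idE.
Qed.

Lemma clampL_continuous b beta : continuous (clampL b beta).
Proof. by apply: continuous_setcoord; [exact: continuous_cstf|exact: continuous_idE]. Qed.

Lemma avoiding_box S q : q \notin S -> exists2 e : R, 0 < e &
  forall x, `|x.1 - q.1| < e -> `|x.2 - q.2| < e -> x \notin S.
Proof.
elim: S => [|a S IH]; first by exists 1.
rewrite inE negb_or => /andP[qa /IH[e e0 he]].
have d0 : 0 < Num.max `|a.1 - q.1| `|a.2 - q.2|.
  rewrite lt_max !normr_gt0 !subr_eq0 -negb_and; apply: contra qa => /andP[/eqP h1 /eqP h2].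
  by apply/eqP; rewrite [q]surjective_pairing -h1 -h2 -surjective_pairing.
exists (Num.min e (Num.max `|a.1 - q.1| `|a.2 - q.2|)); first by rewrite lt_min e0 d0.
move=> x; rewrite !lt_min => /andP[x1 x1'] /andP[x2 x2']; rewrite inE negb_or he // andbT.
apply/eqP => xa; move: x1' x2'; rewrite xa !lt_max.
by rewrite !ltxx /= orbF; move=> h1 h2; have := lt_trans h1 h2; rewrite ltxx.
Qed.

Lemma box_convex q (e : R) : convex [set x : E | `|x.1 - q.1| < e /\ `|x.2 - q.2| < e].
Proof.
have key (u v w s : R) : `|u - w| < e -> `|v - w| < e -> 0 <= s <= 1 -> `|u + s * (v - u) - w| < e.
  rewrite !ltr_norml => /andP[u1 u2] /andP[v1 v2] /andP[s0 s1].
  have [->|ns1] := eqVneq s 1; first by apply/andP; split; lra.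
  have s1' : 0 < 1 - s by rewrite subr_gt0 lt_neqAle ns1.
  have A1 : 0 < (1 - s) * (e - (u - w)) by apply: mulr_gt0 => //; lra.
  have A2 : 0 < (1 - s) * (e + (u - w)) by apply: mulr_gt0 => //; lra.
  have B1 : 0 <= s * (e - (v - w)) by apply: mulr_ge0 => //; lra.
  have B2 : 0 <= s * (e + (v - w)) by apply: mulr_ge0 => //; lra.
  by apply/andP; split; lra.
by move=> a x s [a1 a2] [x1 x2] s01; split; apply: key.
Qed.

Lemma coord_box_convex b beta : convex [set x : E | coord b x = beta].
Proof. by case: b => a x s /= -> ->; rewrite subrr mulr0 addr0. Qed.

Definition avoiding S : set E := [set x | x \notin S].

Lemma clamp_avoids S b beta x : (forall s, s \in S -> coord b s != beta) -> x \notin S ->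
  [/\ clampU b beta x \notin S, clampV b beta x \notin S & clampL b beta x \notin S].
Proof.
move=> Sb xS; have L : clampL b beta x \notin S.
  by apply/negP => /Sb; rewrite coord_setcoord eqxx.
split => //; have [h|/ltW h] := leP beta (coord b x).
- by rewrite clampU_ge.
- by rewrite clampU_le.
- by rewrite clampV_ge.
- by rewrite clampV_le.
Qed.

(** The combination c + L c - U c - V c of the clamps: a path is compared with its parts in the two
    half planes, whose excess is a path on the line. *)
Definition clamp_combination b beta c (a d : R) g : int :=
  one_chain (subpath c a d) g + one_chain (subpath (clampL b beta \o c) a d) g
  - one_chain (subpath (clampU b beta \o c) a d) g
  - one_chain (subpath (clampV b beta \o c) a d) g.

Lemma subpath_continuous (X : topologicalType) (f : R -> X) (a d : R) :
  continuous f -> continuous (subpath f a d).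
Proof.
move=> cf; apply: (@continuous_compT _ _ _ _ f) => // t.
by apply: cvgD; [exact: cvg_cst|apply: cvgMl; exact: cvg_id].
Qed.

Lemma affine_between (a d lo hi t : R) : lo < a -> a <= d -> d < hi -> 0 <= t <= 1 ->
  lo < a + t * (d - a) /\ a + t * (d - a) < hi.
Proof.
move=> la ad dh /andP[t0 t1].
have A1 : 0 <= t * (d - a) by apply: mulr_ge0 => //; lra.
have A2 : 0 <= (1 - t) * (d - a) by apply: mulr_ge0 => //; lra.
by split; lra.
Qed.

(** On one side of the line one clamp is the identity and the other the projection to the line, so
    the four terms cancel in pairs. *)
Lemma clamp_combination_split b beta c (a d : R) A :
    (forall t, 0 <= t <= 1 -> beta <= coord b (c (a + t * (d - a)))) \/
    (forall t, 0 <= t <= 1 -> coord b (c (a + t * (d - a))) <= beta) ->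
  boundary A (clamp_combination b beta c a d).
Proof.
case=> h; apply: boundary_ext (@boundary0 R E A) => g; rewrite /clamp_combination.
  rewrite (_ : one_chain (subpath (clampU b beta \o c) a d) g = one_chain (subpath c a d) g).
    rewrite (_ : one_chain (subpath (clampV b beta \o c) a d) g =
      one_chain (subpath (clampL b beta \o c) a d) g); first by ring.
    by apply: one_chain_ext => t t01; rewrite /subpath /= clampV_ge ?h.
  by apply: one_chain_ext => t t01; rewrite /subpath /= clampU_ge ?h.
rewrite (_ : one_chain (subpath (clampV b beta \o c) a d) g = one_chain (subpath c a d) g).
  rewrite (_ : one_chain (subpath (clampU b beta \o c) a d) g =
    one_chain (subpath (clampL b beta \o c) a d) g); first by ring.
  by apply: one_chain_ext => t t01; rewrite /subpath /= clampU_le ?h.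
by apply: one_chain_ext => t t01; rewrite /subpath /= clampV_le ?h.
Qed.

(** The clamps preserve a box centered on the line. Each of the four paths bounds in it up to
    segments from the center to its end points, and these cancel because at every point the clamps
    agree in pairs. *)
Lemma clamp_combination_box S b beta c q (e a d : R) : continuous c ->
    (forall x, `|x.1 - q.1| < e -> `|x.2 - q.2| < e -> x \notin S) -> 0 < e ->
    coord b q = beta ->
    (forall t, 0 <= t <= 1 -> `|(c (a + t * (d - a))).1 - q.1| < e /\
       `|(c (a + t * (d - a))).2 - q.2| < e) ->
  boundary (avoiding S) (clamp_combination b beta c a d).
Proof.
move=> cc boxS e0 qb cbox; pose D := [set x : E | `|x.1 - q.1| < e /\ `|x.2 - q.2| < e].
have DP x : D x <-> `|coord b x - coord b q| < e /\ `|coord (~~ b) x - coord (~~ b) q| < e.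
  by case: (b); split => -[h1 h2]; split.
have DA : D `<=` avoiding S by move=> x [x1 x2]; exact: boxS.
have Dq : D q by rewrite /D /= !subrr normr0.
have cD : convex D := @box_convex q e.
have DL x : D x -> D (clampL b beta x).
  by rewrite !DP coord_setcoord coord_setcoordN qb subrr normr0 => -[_ h2].
have DU x : D x -> D (clampU b beta x).
  move=> Dx; have [h|/ltW h] := leP beta (coord b x); first by rewrite clampU_ge.
  by rewrite clampU_le //; exact: DL.
have DV x : D x -> D (clampV b beta x).
  move=> Dx; have [h|/ltW h] := leP beta (coord b x); last by rewrite clampV_le.
  by rewrite clampV_ge //; exact: DL.
pose g0 x h := one_chain (fun s => lin q s x) h.
have cone f : continuous f -> (forall x, D x -> D (f x)) -> boundary (avoiding S)
    (fun h => one_chain (subpath (f \o c) a d) h + g0 (f (c a)) h - g0 (f (c d)) h).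
  move=> cf fD; have cfc : continuous (subpath (f \o c) a d).
    by apply: subpath_continuous; exact: continuous_compT.
  have := @cone_boundary D (avoiding S) q (subpath (f \o c) a d) cD DA Dq cfc.
  rewrite (_ : subpath (f \o c) a d 0 = f (c a)); last by rewrite /subpath mul0r addr0.
  rewrite (_ : subpath (f \o c) a d 1 = f (c d)); last by rewrite /subpath mul1r addrC subrK.
  apply => t t01.
  by apply: fD; exact: cbox.
have B := boundaryB (boundaryB (boundaryD (cone id continuous_idE (fun x Dx => Dx))
  (cone _ (@clampL_continuous b beta) DL)) (cone _ (@clampU_continuous b beta) DU))
  (cone _ (@clampV_continuous b beta) DV).
apply: boundary_ext B => h; rewrite /clamp_combination /=.
have gx x : g0 x h + g0 (clampL b beta x) h - g0 (clampU b beta x) h - g0 (clampV b beta x) h = 0.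
  have [l|/ltW l] := leP beta (coord b x).
    by rewrite clampU_ge // clampV_ge //; ring.
  by rewrite clampU_le // clampV_le //; ring.
move: (gx (c a)) (gx (c d)); rewrite -[id \o c]/c.
set A1 := g0 (c a) h; set A2 := g0 _ h; set A3 := g0 _ h; set A4 := g0 _ h.
set B1 := g0 (c d) h; set B2 := g0 _ h; set B3 := g0 _ h; set B4 := g0 _ h.
by move=> h1 h2; lia.
Qed.

(** Locally the path lies on one side of the line or in a box, free of points of [S], around a point
    of the line. *)
Lemma clamp_boundary S b beta c : continuous c -> (forall t, 0 <= t <= 1 -> c t \notin S) ->
    (forall s, s \in S -> coord b s != beta) ->
  boundary (avoiding S) (fun g => one_chain c g + one_chain (clampL b beta \o c) g
    - one_chain (clampU b beta \o c) g - one_chain (clampV b beta \o c) g).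
Proof.
move=> cc cS Sb.
pose G (a d : R) := 0 <= a -> a <= d -> d <= 1 -> boundary (avoiding S) (clamp_combination b beta c a d).
suff /(_ (lexx _) ler01 (lexx _)) : G 0 1.
  apply: boundary_ext => g; rewrite /clamp_combination.
  have sub01 (f : R -> E) : one_chain (subpath f 0 1) g = one_chain f g.
    by apply: one_chain_ext => t _; rewrite /subpath add0r subr0 mulr1.
  by rewrite !sub01.
apply: interval_induction => [a x d ax xd G1 G2 a0 ad d1|t t01].
  have b1 := G1 a0 ax (le_trans xd d1); have b2 := G2 (le_trans a0 ax) xd d1.
  have cat (f : E -> E) : continuous f -> (forall z, z \notin S -> f z \notin S) ->
      boundary (avoiding S) (fun g => one_chain (subpath (f \o c) a x) g +
       one_chain (subpath (f \o c) x d) g - one_chain (subpath (f \o c) a d) g).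
    move=> cf fS; apply: boundary_concat.
    - exact: continuous_compT.
    - by move=> s s01; apply: fS; exact: cS.
    - by apply/andP; split; lra.
    - by apply/andP; split; lra.
    - by apply/andP; split; lra.
  have B := boundaryB (boundaryB (boundaryD (cat id continuous_idE (fun x Dx => Dx))
    (cat _ (@clampL_continuous b beta) (fun z zS => let: And3 _ _ h := clamp_avoids Sb zS in h)))
    (cat _ (@clampU_continuous b beta) (fun z zS => let: And3 h _ _ := clamp_avoids Sb zS in h)))
    (cat _ (@clampV_continuous b beta) (fun z zS => let: And3 _ h _ := clamp_avoids Sb zS in h)).
  apply: boundary_ext (boundaryB (boundaryD b1 b2) B) => g.
  by rewrite /clamp_combination -[id \o c]/c; ring.
have ccb : continuous (fun t => coord b (c t)) by exact: continuous_coord.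
have near_ball (P : R -> Prop) : (\forall s \near t, P s) ->
    exists2 e, 0 < e & forall s, t - e < s -> s < t + e -> P s.
  move=> /nbhs_ballP[e /= e0 he]; exists e => // s h1 h2; apply: he.
  by rewrite /ball /= ltr_norml; apply/andP; split; lra.
have [lt|gt|eq] := ltgtP (coord b (c t)) beta.
- have [|e e0 he] := near_ball (fun s => coord b (c s) < beta); first exact: cvgr_lt (ccb t) _ lt.
  exists e => // a d a0 ad d1 ta dt _ _ _; apply: clamp_combination_split; right => s s01.
  by have [h1 h2] := affine_between ta ad dt s01; apply: ltW; exact: he.
- have [|e e0 he] := near_ball (fun s => beta < coord b (c s)); first exact: cvgr_gt (ccb t) _ gt.
  exists e => // a d a0 ad d1 ta dt _ _ _; apply: clamp_combination_split; left => s s01.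
  by have [h1 h2] := affine_between ta ad dt s01; apply: ltW; exact: he.
have [e e0 boxS] := avoiding_box (cS t t01).
have [|e1 e10 he1] := near_ball (fun s => `|(c s).1 - (c t).1| < e).
  have cc1 := continuous_fst cc; have /cvgrPdist_lt /(_ e e0) := cc1 t.
  by apply: filterS => s; rewrite distrC.
have [|e2 e20 he2] := near_ball (fun s => `|(c s).2 - (c t).2| < e).
  have cc2 := continuous_snd cc; have /cvgrPdist_lt /(_ e e0) := cc2 t.
  by apply: filterS => s; rewrite distrC.
exists (Num.min e1 e2); first by rewrite lt_min e10 e20.
move=> a d a0 ad d1; rewrite ltrBlDr -ltrBlDl !lt_min.
move=> /andP[h1 h2]; rewrite -ltrBlDl lt_min => /andP[h3 h4] _ _ _.
apply: (@clamp_combination_box S b beta c (c t) e) => // s s01; split.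
  have [||h5 h6] := @affine_between a d (t - e1) (t + e1) s _ ad _ s01; try lra.
  exact: he1.
have [||h5 h6] := @affine_between a d (t - e2) (t + e2) s _ ad _ s01; try lra.
exact: he2.
Qed.

Lemma avoid_value (l : seq R) (x y : R) : x < y -> exists2 beta, x < beta < y & beta \notin l.
Proof.
elim: l x y => [|h l IH] x y xy; first by exists ((x + y) / 2) => //; apply/andP; split; lra.
have [/andP[xh hy]|nh] := boolP (x < h < y).
  have [beta /andP[b1 b2] bl] := IH x h xh.
  by exists beta; rewrite ?b1 ?(lt_trans b2) // inE negb_or bl lt_eqF.
have [beta bxy bl] := IH x y xy; exists beta => //; rewrite inE negb_or bl andbT.
by apply: contra nh => /eqP <-.
Qed.

Definition shift_by (a x : E) : E := (x.1 - a.1, x.2 - a.2).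

Lemma continuous_shift_by (T : topologicalType) (f : T -> E) a : continuous f ->
  continuous (fun t => shift_by a (f t)).
Proof.
move=> cf; apply: pair_continuous => t; apply: cvgB; try exact: cvg_cst.
  exact: continuous_fst.
exact: continuous_snd.
Qed.

Lemma shift_by_eq0 a x : (shift_by a x == (0, 0)) = (x == a).
Proof. by case: a x => a1 a2 [x1 x2]; rewrite /shift_by !xpair_eqE /= !subr_eq0. Qed.

(** The exponential a + e^x with x read as a complex number, the universal covering of the plane
    without [a]. *)
Definition polar_map (a x : E) : E := (a.1 + expR x.1 * cos x.2, a.2 + expR x.1 * sin x.2).

Lemma polar_map_continuous a : continuous (polar_map a).
Proof.
have ce : continuous (fun x : E => expR x.1).
  by apply: (@continuous_compT _ _ _ fst (@expR R)) => x; [exact: cvg_fst|exact: continuous_expR].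
have cc : continuous (fun x : E => cos x.2).
  by apply: (@continuous_compT _ _ _ snd (@cos R)) => x; [exact: cvg_snd|exact: continuous_cos].
have cs : continuous (fun x : E => sin x.2).
  by apply: (@continuous_compT _ _ _ snd (@sin R)) => x; [exact: cvg_snd|exact: continuous_sin].
apply: pair_continuous => x; apply: cvgD; try exact: cvg_cst; apply: cvgM;
  [exact: ce|exact: cc|exact: ce|exact: cs].
Qed.

(** With winding number 0 the loop lifts through the exponential to a loop in the plane, which
    bounds by convexity; the chain is then pushed down. *)
Lemma punctured_plane_boundary a c : continuous c -> (forall t, c t != a) -> c 0 = c 1 ->
  closed_angle (fun t => shift_by a (c t)) -> boundary [set~ a] (one_chain c).
Proof.
move=> cc ca c01 [theta [ct h e]].
pose rho t := ln (Num.sqrt (dot (shift_by a (c t)) (shift_by a (c t)))).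
have d0 t : 0 < dot (shift_by a (c t)) (shift_by a (c t)).
  by apply: dot_gt0; rewrite shift_by_eq0.
have csh := continuous_shift_by (a := a) cc.
have crho : continuous rho.
  move=> t; apply: (@continuous_comp _ _ _ (fun t => Num.sqrt (dot (shift_by a (c t)) (shift_by a (c t)))) (@ln R)).
    apply: (@continuous_comp _ _ _ (fun t => dot (shift_by a (c t)) (shift_by a (c t))) Num.sqrt).
      exact: (continuous_dot csh csh).
    exact: sqrt_continuous.
  by apply: continuous_ln; rewrite sqrtr_gt0.
have Ec t : 0 <= t <= 1 -> c t = polar_map a (rho t, theta t).
  move=> t01; have [r r0 Er] := h t t01.
  have eR : expR (rho t) = r.
    rewrite /rho lnK ?posrE ?sqrtr_gt0 // Er /dot /=.
    rewrite (_ : _ + _ = r ^+ 2 * (cos (theta t) ^+ 2 + sin (theta t) ^+ 2)); last by ring.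
    by rewrite cos2Dsin2 mulr1 sqrtr_sqr gtr0_norm.
  move: Er; rewrite /shift_by => -[E1 E2]; rewrite /polar_map /= eR -E1 -E2.
  by rewrite ![_ + (_ - _)]addrC !subrK -surjective_pairing.
have B : boundary [set~ a] (one_chain (polar_map a \o (fun t => (rho t, theta t)))).
  apply: (@boundary_push R E E setT); last first.
    apply: (@convex_loop_boundary setT) => //; first exact: pair_continuous.
    by rewrite e /rho c01.
  move=> s; apply: singular2_comp; first exact: polar_map_continuous.
  move=> x _ /= xa; have : polar (shift_by a (polar_map a x)) x.2.
    exists (expR x.1); first exact: expR_gt0.
    by rewrite /shift_by /polar_map /=; congr pair; ring.
  by move/polar_neq0; rewrite xa shift_by_eq0 eqxx.
apply: boundary_ext B => g; apply: one_chain_ext => t t01.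
by rewrite [RHS]Ec.
Qed.

Lemma clamp_closed_angle (f : E -> E) a c : continuous f -> continuous c -> c 0 = c 1 ->
    (forall x, x != a -> 0 < dot (shift_by a x) (shift_by a (f x))) -> (forall t, c t != a) ->
  closed_angle (fun t => shift_by a (c t)) -> closed_angle (fun t => shift_by a (f (c t))).
Proof.
move=> cf cc c01 fd ca; apply: closed_angle_turn.
- exact: continuous_shift_by.
- by apply: continuous_shift_by; exact: continuous_compT.
- by move=> t; apply: fd.
- by rewrite c01.
- by rewrite c01.
Qed.

(** One coordinate is kept and the other moves at most towards that of [a] without reaching it, so x
    - a turns by less than a right angle. Hence the clamp preserves winding around [a]. *)
Lemma clampU_dot b beta a x : beta < coord b a -> x != a ->
  0 < dot (shift_by a x) (shift_by a (clampU b beta x)).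
Proof.
move=> ba xa; have [h|h] := leP beta (coord b x).
  by rewrite clampU_ge //; apply: dot_gt0; rewrite shift_by_eq0.
rewrite clampU_le ?ltW // /clampL /dot /shift_by; move: ba h.
case: b; case: a xa => a1 a2; case: x => x1 x2 _ /= ba h.
  apply: ltr_wpDr; first by rewrite -expr2 sqr_ge0.
  by rewrite nmulr_rgt0 subr_lt0 // (lt_trans h).
apply: ltr_wpDl; first by rewrite -expr2 sqr_ge0.
by rewrite nmulr_rgt0 subr_lt0 // (lt_trans h).
Qed.

Lemma clampV_dot b beta a x : coord b a < beta -> x != a ->
  0 < dot (shift_by a x) (shift_by a (clampV b beta x)).
Proof.
move=> ba xa; have [h|h] := leP (coord b x) beta.
  by rewrite clampV_le //; apply: dot_gt0; rewrite shift_by_eq0.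
rewrite clampV_ge ?ltW // /clampL /dot /shift_by; move: ba h.
case: b; case: a xa => a1 a2; case: x => x1 x2 _ /= ba h.
  apply: ltr_wpDr; first by rewrite -expr2 sqr_ge0.
  by rewrite mulr_gt0 // subr_gt0 // (lt_trans ba).
apply: ltr_wpDl; first by rewrite -expr2 sqr_ge0.
by rewrite mulr_gt0 // subr_gt0 // (lt_trans ba).
Qed.

(* Induction on the number of points: a line separating them splits the loop, up
   to a boundary, into its clamps to the two half planes and to the line; the
   first two avoid fewer points, and the clamps carry the resulting chains back. *)
Lemma plane_boundary S c : continuous c -> (forall t, c t \notin S) -> c 0 = c 1 ->
    (forall a, a \in S -> closed_angle (fun t => shift_by a (c t))) ->
  boundary (avoiding S) (one_chain c).
Proof.
have [n] := ubnP (size S); elim: n S c => // n IH S c ltn cc cS c01 angS.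
have [/all_pred1P|] := boolP (all (pred1 (head (0, 0) S)) S).
  (* The list may repeat its entries; here it consists of no point or of copies of a single one. *)
  case: S ltn cS angS => [|a S] ltn cS angS.
    move=> _; apply: (@convex_loop_boundary setT) => // x _; by rewrite /avoiding /= in_nil.
  move=> Sa; apply: (@boundaryS R E [set~ a]).
    move=> x /= xa; rewrite /avoiding /= Sa; apply/negP; rewrite mem_nseq => /andP[_ /eqP].
    exact: xa.
  apply: punctured_plane_boundary => //; last by apply: angS; rewrite mem_head.
  by move=> t; apply: contraNneq (cS t) => ->; rewrite mem_head.
rewrite -has_predC => /hasP[s2 s2S /= s12]; set s1 := head _ S in s12.
have s1S : s1 \in S.
  by rewrite /s1; case: (S) s2S => [|u S'] //= _; rewrite mem_head.
have [b [x [y [xS yS xy]]]] : exists b x y, [/\ x \in S, y \in S & coord b x < coord b y].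
  have : (coord true s1 != coord true s2) || (coord false s1 != coord false s2).
    rewrite -negb_and; apply: contra s12 => /andP[/eqP h1 /eqP h2].
    by apply/eqP; apply: (@coord_ext true).
  case/orP; rewrite neq_lt => /orP[] h; [exists true, s1, s2|exists true, s2, s1|
    exists false, s1, s2|exists false, s2, s1]; by split.
have [beta /andP[xb byy] bS] := avoid_value [seq coord b s | s <- S] xy.
have Sb s : s \in S -> coord b s != beta.
  by move=> sS; apply: contraNneq bS => <-; exact: map_f.
pose SU := [seq s <- S | beta < coord b s]; pose SV := [seq s <- S | coord b s < beta].
have ltfilter (P : pred E) z : z \in S -> ~~ P z -> (size (seq.filter P S) < n)%N.
  move=> zS Pz; apply: leq_trans (ltn : (size S <= n)%N).
  rewrite size_filter -(count_predC P S) -[X in (X < _)%N]addn0 ltn_add2l -has_count.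
  by apply/hasP; exists z.
have ltU : (size SU < n)%N by apply: (ltfilter _ x) => //; rewrite -leNgt ltW.
have ltV : (size SV < n)%N by apply: (ltfilter _ y) => //; rewrite -leNgt ltW.
have half (f : E -> E) (P : pred E) : continuous f ->
    (forall a z, P a -> z != a -> 0 < dot (shift_by a z) (shift_by a (f z))) ->
    (forall z, z \notin seq.filter P S -> f z \notin S) -> (forall z, f (f z) = f z) ->
    (size (seq.filter P S) < n)%N -> boundary (avoiding S) (one_chain (f \o c)).
  move=> cf fd fS ff lt.
  (* The clamped loop bounds off the points of its half plane; applying the idempotent clamp again
     fixes the loop and moves the chain off the other points as well. *)
  have -> : f \o c = f \o (f \o c) by apply/funext => t /=; rewrite ff.
  apply: (@boundary_push R E E (avoiding (seq.filter P S))).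
    by move=> s; apply: singular2_comp.
  have ca a t : a \in S -> c t != a by move=> aS; apply: contraNneq (cS t) => ->.
  apply: IH => //.
  - exact: continuous_compT.
  - move=> t; rewrite mem_filter negb_and orbC fS // mem_filter negb_and.
    by rewrite cS orbT.
  - by rewrite /= c01.
  - move=> a; rewrite mem_filter => /andP[Pa aS].
    apply: clamp_closed_angle => //; last exact: angS.
      by move=> z; exact: fd.
    by move=> t; exact: ca.
have BU : boundary (avoiding S) (one_chain (clampU b beta \o c)).
  apply: (half _ (fun s => beta < coord b s)) => //; first exact: clampU_continuous.
  - by move=> a z; exact: clampU_dot.
  - move=> z; rewrite mem_filter negb_and -leNgt => h; have [l|l] := leP (coord b z) beta.
      by rewrite clampU_le //; apply/negP => /Sb; rewrite coord_setcoord eqxx.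
    by rewrite clampU_ge ?ltW //; move: h; rewrite leNgt l.
  - by move=> z; rewrite [LHS]clampU_ge // /clampU coord_setcoord le_max lexx orbT.
have BV : boundary (avoiding S) (one_chain (clampV b beta \o c)).
  apply: (half _ (fun s => coord b s < beta)) => //; first exact: clampV_continuous.
  - by move=> a z; exact: clampV_dot.
  - move=> z; rewrite mem_filter negb_and -leNgt => h; have [l|l] := leP beta (coord b z).
      by rewrite clampV_ge //; apply/negP => /Sb; rewrite coord_setcoord eqxx.
    by rewrite clampV_le ?ltW //; move: h; rewrite leNgt l.
  - by move=> z; rewrite [LHS]clampV_le // /clampV coord_setcoord ge_min lexx orbT.
have BL : boundary (avoiding S) (one_chain (clampL b beta \o c)).
  apply: (convex_loop_boundary (@coord_box_convex b beta)).
  - by move=> z /= zb; apply/negP => /Sb; rewrite zb eqxx.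
  - by apply: continuous_compT => //; exact: clampL_continuous.
  - by move=> t _ /=; rewrite coord_setcoord.
  - by rewrite /= c01.
have B := clamp_boundary cc (fun t _ => cS t) Sb.
apply: boundary_ext (boundaryD (boundaryB B BL) (boundaryD BU BV)) => g.
by ring.
Qed.

End PlaneLoops.

(** * The fundamental theorem of calculus on subdivided intervals *)

Section PiecewiseIntegral.
Variable R : realType.
Local Notation mu := (@lebesgue_measure R).
Implicit Types (f F g : R -> R) (a b c : R).

(** A subdivision without explicit break points, suited to induction by concatenation. *)
Inductive pieces (T : R -> R -> Prop) : R -> R -> Prop :=
| pieces_one a b of a < b & T a b : pieces T a b
| pieces_cat a b c of pieces T a b & pieces T b c : pieces T a c.

Lemma pieces_lt T a b : pieces T a b -> a < b.
Proof. by elim=> // x y z _ xy _ yz; exact: lt_trans yz. Qed.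

Lemma pieces_partition (T : R -> R -> Prop) a b s : a < b -> itv_partition a b s ->
  (forall k, (k < size s)%N -> T (nth a (a :: s) k) (nth a s k)) -> pieces T a b.
Proof.
move=> ab [pas /eqP E]; have : s != [::] by case: s E {pas} => // /esym E; rewrite E ltxx in ab.
move: E pas; elim: s a {ab} => // x s IH a /= E /andP[ax pxs] _ h.
have Tax : T a x by exact: h 0 isT.
case: s IH E pxs h => [|y s] IH E pxs h; first by rewrite -E; exact: pieces_one.
apply: (@pieces_cat _ _ x); first exact: pieces_one.
apply: IH => // k lt; have := h k.+1 lt.
have -> : nth a [:: a, x, y & s] k.+1 = nth x [:: x, y & s] k.
  by apply: set_nth_default; exact: leqW.
by have -> : nth a [:: x, y & s] k.+1 = nth x (y :: s) k by exact: set_nth_default.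
Qed.

Lemma integrable_closed_itv f a b : a < b -> mu.-integrable `]a, b[ (EFin \o f) ->
  mu.-integrable `[a, b] (EFin \o f).
Proof.
move=> ab fi; have E : `[a, b]%classic = `]a, b[%classic `|` ([set a] `|` [set b]).
  apply/seteqP; split => x /=; rewrite !in_itv /=.
    rewrite !le_eqVlt => /andP[/orP[/eqP ->|ax] /orP[/eqP xb|xb]]; try by right; left.
      by right; right.
    by left; rewrite ax xb.
  case=> [/andP[ax xb]|[->|->]]; first by rewrite !ltW.
    by rewrite lexx ltW.
  by rewrite lexx ltW.
have mN : measurable ([set a] `|` [set b] : set R) by apply: measurableU.
apply: (iffRL (@negligible_integrable _ _ R mu `[a, b] ([set a] `|` [set b]) (EFin \o f) _ _ _ _)) => //.
- rewrite E; apply/measurable_funU => //; split; first exact: measurable_int fi.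
  apply/measurable_funU => //; split; exact: measurable_fun_set1.
- by rewrite measureU0 //; exact: lebesgue_measure_set1.
apply: integrableS fi => //; first exact: measurableD.
move=> x [/=]; rewrite !in_itv /= !le_eqVlt => /andP[/orP[/eqP ->|ax] xb] n.
  by case: n; left.
rewrite ax; case/orP: xb => // /eqP xb; case: n; by right.
Qed.

Lemma integrable_cat f a b c : a <= b -> b <= c -> mu.-integrable `[a, b] (EFin \o f) ->
  mu.-integrable `[b, c] (EFin \o f) -> mu.-integrable `[a, c] (EFin \o f).
Proof.
move=> ab bc fab fbc.
have E : `[a, c]%classic = `[a, b]%classic `|` `]b, c]%classic.
  by rewrite -itv_bndbnd_setU // ?bnd_simp.
have fbc' : mu.-integrable `]b, c] (EFin \o f).
  apply: integrableS fbc => //; apply: subset_itvr; by rewrite bnd_simp.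
case/integrableP: (fab) => mab iab; case/integrableP: (fbc') => mbc ibc.
apply/integrableP; rewrite E; split; first by apply/measurable_funU.
rewrite ge0_integral_setU //.
- by rewrite lte_add_pinfty.
- apply/measurable_funU => //; split.
    exact: measurable_int (integrable_abse fab).
  exact: measurable_int (integrable_abse fbc').
- apply/disj_setPS => x [] /=; rewrite !in_itv /= => /andP[_ xb] /andP[bx _].
  by move: (lt_le_trans bx xb); rewrite ltxx.
Qed.

(** The values of [f] at the two ends stay free, since the derivative of a piecewise smooth curve is
    not controlled at break points. *)
Definition continuous_piece f a b := exists2 g, {within `[a, b], continuous g} &
  forall t, a < t < b -> f t = g t.

Lemma integrable_piece f g a b : a < b -> {within `[a, b], continuous g} ->
    (forall t, a < t < b -> f t = g t) ->
  mu.-integrable `[a, b] (EFin \o f) /\ mu.-integrable `[a, b] (EFin \o g).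
Proof.
move=> ab cg h.
have gi : mu.-integrable `[a, b] (EFin \o g).
  by apply: continuous_compact_integrable => //; exact: segment_compact.
split => //; apply: integrable_closed_itv => //.
have gio : mu.-integrable `]a, b[ (EFin \o g).
  by apply: integrableS gi => //; apply: subset_itv; rewrite bnd_simp.
by apply: eq_integrable gio => // t; rewrite inE /= in_itv /= => tab; rewrite h.
Qed.

Lemma integrable_pieces f a b : pieces (continuous_piece f) a b ->
  mu.-integrable `[a, b] (EFin \o f).
Proof.
elim=> {a b} [a b ab [g cg h]|a b c ab i1 bc i2]; first by have [] := integrable_piece ab cg h.
by apply: integrable_cat i1 i2; apply/ltW/pieces_lt; eassumption.
Qed.

Definition primitive_piece F f a b := {within `[a, b], continuous F} /\
  exists2 g, {within `[a, b], continuous g} &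
    forall t, a < t < b -> f t = g t /\ is_derive t 1 F (f t).

(** [F] is known to be differentiable only inside, so [f] is replaced by its continuous extension
    [g], equal to it off the end points. *)
Lemma FTC_piece F f a b : a < b -> primitive_piece F f a b ->
  mu.-integrable `[a, b] (EFin \o f) /\ \int[mu]_(x in `[a, b]) f x = F b - F a.
Proof.
move=> ab [cF [g cg h]].
have [fi gi] := integrable_piece ab cg (fun t tab => (h t tab).1); split => //.
have fg : {in `]a, b[%classic, g =1 f}.
  by move=> t; rewrite inE /= in_itv /= => /h[].
have close (u : R -> R) : mu.-integrable `[a, b] (EFin \o u) ->
    \int[mu]_(x in `[a, b]) u x = \int[mu]_(x in `]a, b[) u x.
  move=> ui; rewrite -Rintegral_itv_obnd_cbnd.
    rewrite -Rintegral_itv_bndo_bndc //; apply: integrableS ui => //.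
    by apply: subset_itv; rewrite bnd_simp.
  apply: integrableS ui => //; apply: subset_itv; by rewrite bnd_simp.
rewrite (close f fi) -(eq_Rintegral mu fg) -(close g gi) /Rintegral.
rewrite (@continuous_FTC2 R g F) //.
  have [h1 h2 h3] : [/\ {in `]a, b[, continuous F}, F x @[x --> a^'+] --> F a & F x @[x --> b^'-] --> F b].
    by apply/continuous_within_itvP.
  by split => // t; rewrite in_itv /= => /h[_ []].
by move=> t; rewrite in_itv /= => tab; have [<- d] := h t tab; rewrite derive1E; exact: derive_val.
Qed.

Lemma FTC_piecewise F f a b : pieces (primitive_piece F f) a b ->
  mu.-integrable `[a, b] (EFin \o f) /\ \int[mu]_(x in `[a, b]) f x = F b - F a.
Proof.
elim=> {a b} [a b ab h|a b c ab [i1 e1] bc [i2 e2]]; first exact: FTC_piece.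
have lab := pieces_lt ab; have lbc := pieces_lt bc.
have i := integrable_cat (ltW lab) (ltW lbc) i1 i2; split => //.
have := @Rintegral_itvB R f (BLeft a) (BRight c) b i.
rewrite !bnd_simp => /(_ (ltW lab) (ltW lbc)); rewrite Rintegral_itv_obnd_cbnd.
  by rewrite e1 e2 => /eqP; rewrite subr_eq => /eqP ->; ring.
apply: integrableS i2 => //; apply: subset_itvr; by rewrite bnd_simp.
Qed.

End PiecewiseIntegral.

(** * Calculus of complex functions of a real variable *)

Section ComplexPaths.
Variable R : realType.
Local Notation K := R[i].
Local Notation Re := (@complex.Re R).
Local Notation Im := (@complex.Im R).

Lemma Re_continuous : continuous (Re : K^o -> R).
Proof.
move=> z A /nbhs_ballP[e /= e0 hA]; apply/nbhs_ballP; exists e%:C%C; first by rewrite /= ltcR.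
move=> w zw; apply: hA; rewrite /ball /= -ltcR; apply: le_lt_trans zw.
by rewrite -raddfB; exact: normc_ge_Re.
Qed.

Lemma normc_ge_Im (x : K) : `|Im x|%:C%C <= `|x|.
Proof.
case: x => a b; rewrite normc_def lecR /= -sqrtr_sqr ler_sqrt ?addr_ge0 ?sqr_ge0 //.
by rewrite lerDr sqr_ge0.
Qed.

Lemma Im_continuous : continuous (Im : K^o -> R).
Proof.
move=> z A /nbhs_ballP[e /= e0 hA]; apply/nbhs_ballP; exists e%:C%C; first by rewrite /= ltcR.
move=> w zw; apply: hA; rewrite /ball /= -ltcR; apply: le_lt_trans zw.
by rewrite -raddfB; exact: normc_ge_Im.
Qed.

Lemma normc_le (x : K) : `|x| <= (`|Re x| + `|Im x|)%:C%C.
Proof.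
case: x => a b; rewrite normc_def lecR /= -[leRHS]ger0_norm ?addr_ge0 // -sqrtr_sqr.
rewrite ler_sqrt ?sqr_ge0 // sqrrD !real_normK ?num_real //.
by rewrite -addrA [_ *+ 2 + _]addrC addrA lerDl mulrn_wge0 // mulr_ge0.
Qed.

Lemma Complex_continuous : continuous (fun z : R * R => Complex z.1 z.2 : K^o).
Proof.
move=> z A /nbhs_ballP[e /= e0 hA].
have e2 : 0 < Re e / 2 by move: e0; rewrite ltcE /= => /andP[_ h]; rewrite divr_gt0.
have Ee : e = (Re e)%:C%C by move: e0; rewrite ltcE /= => /andP[/eqP h _]; case: (e) h => a b /= ->.
apply/nbhs_ballP; exists (Re e / 2) => // w [/= h1 h2]; apply: hA; rewrite /ball /= Ee.
apply: le_lt_trans (normc_le _) _; rewrite ltcR /= (splitr (Re e)).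
by apply: ltrD; [exact: h1|exact: h2].
Qed.

Lemma is_derive1D (f g : R -> R) (t a b : R) : is_derive t 1 f a -> is_derive t 1 g b ->
  is_derive t 1 (fun s => f s + g s) (a + b).
Proof. by move=> df dg; exact: is_deriveD. Qed.

Lemma is_derive1B (f g : R -> R) (t a b : R) : is_derive t 1 f a -> is_derive t 1 g b ->
  is_derive t 1 (fun s => f s - g s) (a - b).
Proof. by move=> df dg; exact: is_deriveB. Qed.

Lemma is_derive1M (f g : R -> R) (t a b : R) : is_derive t 1 f a -> is_derive t 1 g b ->
  is_derive t 1 (fun s => f s * g s) (a * g t + f t * b).
Proof.
move=> df dg; apply: (@is_derive_eq _ _ _ _ _ _ _ _ (is_deriveM df dg)).
by rewrite /GRing.scale /=; ring.
Qed.

Lemma is_derive1V (f : R -> R) (t a : R) : f t != 0 -> is_derive t 1 f a ->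
  is_derive t 1 (fun s => (f s)^-1) (- a / f t ^+ 2).
Proof.
move=> f0 df; apply: (@is_derive_eq _ _ _ _ _ _ _ _ (is_deriveV f0 df)).
by rewrite /GRing.scale /=; field.
Qed.

Lemma is_derive1_cst (c t : R) : is_derive t 1 (fun=> c) 0.
Proof. exact: is_derive_cst. Qed.

Definition is_cder (u : R -> K) (t : R) (d : K) :=
  is_derive t 1 (fun s : R => Re (u s)) (Re d) /\ is_derive t 1 (fun s : R => Im (u s)) (Im d).

Definition ccont (u : R -> K) :=
  continuous (fun t => Re (u t)) /\ continuous (fun t => Im (u t)).

Lemma is_cder_cst c t : is_cder (fun=> c) t 0.
Proof. by split; exact: is_derive1_cst. Qed.

Lemma is_cderD u v t d e : is_cder u t d -> is_cder v t e -> is_cder (fun s => u s + v s) t (d + e).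
Proof.
move=> [u1 u2] [v1 v2]; split.
  have := is_derive1D u1 v1; rewrite -raddfD; congr is_derive.
  by apply/funext => s /=; rewrite raddfD.
have := is_derive1D u2 v2; rewrite -raddfD; congr is_derive.
by apply/funext => s /=; rewrite raddfD.
Qed.

Lemma cReM (x y : K) : Re (x * y) = Re x * Re y - Im x * Im y.
Proof. by case: x y => a b [c d]. Qed.
Lemma cImM (x y : K) : Im (x * y) = Re x * Im y + Im x * Re y.
Proof. by case: x y => a b [c d]. Qed.
Lemma cReV (x : K) : Re x^-1 = Re x / (Re x ^+ 2 + Im x ^+ 2).
Proof. by case: x. Qed.
Lemma cImV (x : K) : Im x^-1 = - Im x / (Re x ^+ 2 + Im x ^+ 2).
Proof. by case: x => a b /=; rewrite mulNr. Qed.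
Lemma cReD (x y : K) : Re (x + y) = Re x + Re y. Proof. by case: x y => a b [c d]. Qed.
Lemma cImD (x y : K) : Im (x + y) = Im x + Im y. Proof. by case: x y => a b [c d]. Qed.
Lemma cReN (x : K) : Re (- x) = - Re x. Proof. by case: x. Qed.
Lemma cImN (x : K) : Im (- x) = - Im x. Proof. by case: x. Qed.

Lemma normsq_gt0 (x : K) : x != 0 -> 0 < Re x ^+ 2 + Im x ^+ 2.
Proof.
case: x => a b; rewrite eq_complex /= negb_and => /orP[] h.
  by apply: ltr_wpDr; rewrite ?sqr_ge0 // exprn_even_gt0.
by apply: ltr_wpDl; rewrite ?sqr_ge0 // exprn_even_gt0.
Qed.

Lemma is_cderM u v t d e : is_cder u t d -> is_cder v t e ->
  is_cder (fun s => u s * v s) t (d * v t + u t * e).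
Proof.
move=> [u1 u2] [v1 v2]; split.
  apply: (@is_derive_eq _ _ _ _ _ _ _ (Re d * Re (v t) + Re (u t) * Re e - (Im d * Im (v t) + Im (u t) * Im e))).
    have := is_derive1B (is_derive1M u1 v1) (is_derive1M u2 v2); congr is_derive.
    by apply/funext => s /=; rewrite cReM.
  by rewrite cReD !cReM; ring.
apply: (@is_derive_eq _ _ _ _ _ _ _ (Re d * Im (v t) + Re (u t) * Im e + (Im d * Re (v t) + Im (u t) * Re e))).
  have := is_derive1D (is_derive1M u1 v2) (is_derive1M u2 v1); congr is_derive.
  by apply/funext => s /=; rewrite cImM.
by rewrite cImD !cImM; ring.
Qed.

Lemma is_cderV u t d : u t != 0 -> is_cder u t d -> is_cder (fun s => (u s)^-1) t (- d / u t ^+ 2).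
Proof.
move=> u0 [u1 u2]; have n0 := normsq_gt0 u0.
pose n s := Re (u s) * Re (u s) + Im (u s) * Im (u s).
have nE : n t = Re (u t) ^+ 2 + Im (u t) ^+ 2 by rewrite /n -!expr2.
have dn : is_derive t 1 n (Re d * Re (u t) + Re (u t) * Re d + (Im d * Im (u t) + Im (u t) * Im d)).
  exact: is_derive1D (is_derive1M u1 u1) (is_derive1M u2 u2).
have nt0 : n t != 0 by rewrite nE gt_eqF.
have dV := is_derive1V nt0 dn.
have n0' : Re (u t) ^+ 2 + Im (u t) ^+ 2 != 0 by rewrite gt_eqF.
rewrite -exprVn expr2 mulNr; split.
  apply: (@is_derive_eq _ _ _ _ _ _ _ (Re d * (n t)^-1 + Re (u t) * (- (Re d * Re (u t) + Re (u t) * Re d + (Im d * Im (u t) + Im (u t) * Im d)) / n t ^+ 2))).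
    have := is_derive1M u1 dV; congr is_derive.
    by apply/funext => s /=; rewrite cReV /n -!expr2.
  by rewrite ?(cReN, cImN) !(cReM, cImM, cReV, cImV) nE; field.
apply: (@is_derive_eq _ _ _ _ _ _ _ (- (Im d * (n t)^-1 + Im (u t) * (- (Re d * Re (u t) + Re (u t) * Re d + (Im d * Im (u t) + Im (u t) * Im d)) / n t ^+ 2)))).
  have := is_derive1B (is_derive1_cst 0 t) (is_derive1M u2 dV); rewrite sub0r; congr is_derive.
  by apply/funext => s /=; rewrite cImV /n -!expr2 sub0r mulNr.
by rewrite ?(cReN, cImN) !(cReM, cImM, cReV, cImV) nE; field.
Qed.

Lemma eq_is_cder u v t d e : (forall s, u s = v s) -> d = e -> is_cder u t d -> is_cder v t e.
Proof. by move=> /funext -> ->. Qed.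

Lemma near_is_cder u v t d : (\forall s \near t, u s = v s) -> is_cder u t d -> is_cder v t d.
Proof.
move=> n [u1 u2]; split; [apply: near_eq_is_derive u1|apply: near_eq_is_derive u2];
  by apply: filterS n => s ->.
Qed.

Lemma is_cder_poly (p : {poly K}) u t d : is_cder u t d ->
  is_cder (fun s => p.[u s]) t (p^`().[u t] * d).
Proof.
move=> du; elim/poly_ind: p => [|p c IH].
  by apply: eq_is_cder (is_cder_cst 0 t) => [s|]; rewrite ?deriv0 !horner0 ?mul0r.
apply: eq_is_cder (is_cderD (is_cderM IH du) (is_cder_cst c t)) => [s|].
  by rewrite !hornerE.
by rewrite derivMXaddC !hornerE; ring.
Qed.

Lemma ccontD u v : ccont u -> ccont v -> ccont (fun t => u t + v t).
Proof.
move=> [u1 u2] [v1 v2]; split; under eq_fun do rewrite ?cReD ?cImD; exact: continuous_add.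
Qed.

Lemma ccontM u v : ccont u -> ccont v -> ccont (fun t => u t * v t).
Proof.
move=> [u1 u2] [v1 v2]; split; under eq_fun do rewrite ?cReM ?cImM.
  by apply: continuous_sub; apply: continuous_mul.
by apply: continuous_add; apply: continuous_mul.
Qed.

Lemma ccont_cst c : ccont (fun=> c).
Proof. by split => t; exact: cvg_cst. Qed.

Lemma ccontV u : ccont u -> (forall t, u t != 0) -> ccont (fun t => (u t)^-1).
Proof.
move=> [u1 u2] u0.
have c2 : continuous (fun t => Re (u t) * Re (u t) + Im (u t) * Im (u t)).
  by apply: continuous_add; apply: continuous_mul.
have cn : continuous (fun t => (Re (u t) * Re (u t) + Im (u t) * Im (u t))^-1).
  move=> t; apply: (@cvgV R _ (nbhs t) _ (fun t => Re (u t) * Re (u t) + Im (u t) * Im (u t))).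
    by rewrite -!expr2 gt_eqF // normsq_gt0.
  exact: c2.
have cN : continuous (fun t => - Im (u t)) by move=> t; apply: cvgN; exact: u2.
by split; under eq_fun do rewrite ?cReV ?cImV !expr2; exact: continuous_mul.
Qed.

Lemma ccont_poly (p : {poly K}) u : ccont u -> ccont (fun t => p.[u t]).
Proof.
move=> cu; elim/poly_ind: p => [|p c IH].
  by under eq_fun do rewrite horner0; exact: ccont_cst.
under eq_fun do rewrite !hornerE.
by apply: ccontD; [exact: ccontM|exact: ccont_cst].
Qed.

Definition plane_point (x : K) : R * R := (Re x, Im x).

Lemma plane_point_eq0 x : (plane_point x == (0, 0)) = (x == 0).
Proof. by rewrite eq_complex. Qed.

Lemma ccont_plane u : ccont u -> continuous (fun t => plane_point (u t)).
Proof. by case=> u1 u2; exact: pair_continuous. Qed.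

(** At s = t the arctangent has argument 0 and slope 1, so only the derivative of its argument
    counts. *)
Lemma is_derive1_turn (u : R -> K) t d : u t != 0 -> is_cder u t d ->
  is_derive t 1 (fun s => turn (plane_point (u t)) (plane_point (u s))) (Im (d / u t)).
Proof.
move=> u0 [u1 u2]; have n0 := normsq_gt0 u0.
have n0' : Re (u t) ^+ 2 + Im (u t) ^+ 2 != 0 by rewrite gt_eqF.
pose x := Re (u t); pose y := Im (u t).
have dc : is_derive t 1 (fun s => x * Im (u s) - y * Re (u s)) (0 * Im (u t) + x * Im d - (0 * Re (u t) + y * Re d)).
  by apply: is_derive1B; apply: is_derive1M => //; exact: is_derive1_cst.
have dd : is_derive t 1 (fun s => x * Re (u s) + y * Im (u s)) (0 * Re (u t) + x * Re d + (0 * Im (u t) + y * Im d)).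
  by apply: is_derive1D; apply: is_derive1M => //; exact: is_derive1_cst.
have d0 : x * Re (u t) + y * Im (u t) != 0 by rewrite /x /y -!expr2.
have dq := is_derive1M dc (@is_derive1V (fun s => x * Re (u s) + y * Im (u s)) t _ d0 dd).
have da := @is_derive1_comp _ (@atan R)
  (fun s => (x * Im (u s) - y * Re (u s)) / (x * Re (u s) + y * Im (u s))) _ _ _ (is_derive1_atan _) dq.
apply: (@is_derive_eq _ _ _ _ _ _ _ _ da).
rewrite cImM cReV cImV /= /x /y.
have -> : Re (u t) * Im (u t) - Im (u t) * Re (u t) = 0 by ring.
by rewrite mul0r expr0n addr0 invr1 /=; rewrite -!expr2; field.
Qed.

(** Near t, [theta] equals [theta t] plus the turn from u t to u s: their difference has sine 0, is
    continuous and vanishes at t. Thus continuity of the argument yields its differentiability. *)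
Lemma is_derive_angle (u : R -> K) (theta : R -> R) t d : u t != 0 -> is_cder u t d ->
    continuous theta -> (\forall s \near t, polar (plane_point (u s)) (theta s)) ->
  is_derive t 1 theta (Im (d / u t)).
Proof.
move=> u0 du ct np; have dt := is_derive1_turn u0 du.
have d1 : is_derive t 1 (fun s => theta t + turn (plane_point (u t)) (plane_point (u s))) (Im (d / u t)).
  by have := is_derive1D (is_derive1_cst (theta t) t) dt; rewrite add0r.
apply: near_eq_is_derive d1.
pose e s := theta s - (theta t + turn (plane_point (u t)) (plane_point (u s))).
have pt := nbhs_singleton np.
have cturn : {for t, continuous (fun s => turn (plane_point (u t)) (plane_point (u s)))}.
  by apply: differentiable_continuous; apply/derivable1_diffP; exact: ex_derive.
have ce : {for t, continuous e}.
  by apply: cvgB; [exact: ct|apply: cvgD; [exact: cvg_cst|exact: cturn]].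
have et : e t = 0.
  rewrite /e /turn (_ : cross _ _ = 0) ?mul0r ?atan0 ?addr0 ?subrr //.
  by rewrite /cross mulrC subrr.
have cdot : {for t, continuous (fun s => dot (plane_point (u t)) (plane_point (u s)))}.
  case: du => u1 u2.
  have c1 : {for t, continuous (fun s => Re (u s))}.
    by apply: differentiable_continuous; apply/derivable1_diffP; exact: ex_derive.
  have c2 : {for t, continuous (fun s => Im (u s))}.
    by apply: differentiable_continuous; apply/derivable1_diffP; exact: ex_derive.
  by apply: cvgD; apply: cvgM => //; exact: cvg_cst.
have nd : \forall s \near t, 0 < dot (plane_point (u t)) (plane_point (u s)).
  by apply: (cvgr_gt _ cdot); apply: dot_gt0; rewrite plane_point_eq0.
have ne : \forall s \near t, `|e t - e s| < pi.
  by move/cvgrPdist_lt: ce; apply; exact: pi_gt0.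
near=> s; have ps : polar (plane_point (u s)) (theta s) by near: s.
have pu : polar (plane_point (u s)) (theta t + turn (plane_point (u t)) (plane_point (u s))).
  by apply: polar_turn => //; near: s.
have [_ sin0] := polar_unique pu ps; rewrite -/(e s) in sin0.
have : `|e s| < pi by rewrite -normrN -sub0r -et; near: s.
rewrite ltr_norml => /andP[h1 h2]; apply/esym/eqP; rewrite -subr_eq0 -/(e s).
have [l|l|//] := ltgtP (e s) 0.
  have : 0 < sin (- e s) by apply: sin_gt0_pi; lra.
  by rewrite sinN sin0 oppr0 ltxx.
have : 0 < sin (e s) by apply: sin_gt0_pi; rewrite l.
by rewrite sin0 ltxx.
Unshelve. all: by end_near. Qed.

Lemma is_derive_ln_modulus (u : R -> K) t d : u t != 0 -> is_cder u t d ->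
  is_derive t 1 (fun s => ln (Re (u s) * Re (u s) + Im (u s) * Im (u s)) / 2) (Re (d / u t)).
Proof.
move=> u0 [u1 u2]; have n0 := normsq_gt0 u0.
have n0' : Re (u t) ^+ 2 + Im (u t) ^+ 2 != 0 by rewrite gt_eqF.
have dn := is_derive1D (is_derive1M u1 u1) (is_derive1M u2 u2).
have np : 0 < Re (u t) * Re (u t) + Im (u t) * Im (u t) by rewrite -!expr2.
have dl := @is_derive1_comp _ (@ln R)
  (fun s => Re (u s) * Re (u s) + Im (u s) * Im (u s)) _ _ _ (is_derive1_ln np) dn.
have da := is_derive1M dl (is_derive1_cst 2^-1 t).
apply: (@is_derive_eq _ _ _ _ _ _ _ _ da).
by rewrite cReM cReV cImV /= -!expr2; field.
Qed.

End ComplexPaths.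

(** * Integrals of rational functions along the curve *)

Section ContourIntegrals.
Variable R : realType.
Local Notation K := R[i].
Local Notation Re := (@complex.Re R).
Local Notation Im := (@complex.Im R).
Local Notation mu := (@lebesgue_measure R).
Variable gamma : R -> K.
Hypothesis gamma_smooth : piecewise_smooth gamma.
Implicit Types (f Y : ratfun K) (h : K -> K).

(** This version of the curve is continuous on the whole line, whereas [gamma] is arbitrary outside
    [0, 1]. *)
Let gammac t := gamma (clamp01 t).

Lemma gammac_id t : 0 <= t <= 1 -> gammac t = gamma t.
Proof. by move=> t01; rewrite /gammac clamp01_id. Qed.

Lemma curve_pieces : pieces (smooth_arc gamma) 0 1.
Proof.
have [s [ps h]] := gamma_smooth; apply: (pieces_partition ltr01 ps) => k lt.
exact: h k lt.
Qed.

Lemma pieces_bounds (T : R -> R -> Prop) a b lo hi : pieces T a b -> lo <= a -> b <= hi ->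
  pieces (fun x y => [/\ T x y, lo <= x & y <= hi]) a b.
Proof.
elim=> {a b} [a b ab Tab la bh|a b c ab IH bc IH' la ch]; first exact: pieces_one.
have lab := pieces_lt ab; have lbc := pieces_lt bc.
apply: pieces_cat (IH la _) (IH' _ ch); last exact: le_trans (ltW lab).
exact: le_trans (ltW lbc) ch.
Qed.

Lemma pieces_sub (T T' : R -> R -> Prop) a b : (forall x y, x < y -> T x y -> T' x y) ->
  pieces T a b -> pieces T' a b.
Proof.
move=> TT'; elim=> {a b} [a b ab Tab|a b c _ h _ h']; last exact: pieces_cat h h'.
by apply: pieces_one => //; exact: TT'.
Qed.

Lemma curve_continuous : {within `[0, 1], continuous (gamma : R -> K^o)}.
Proof.
have : pieces (smooth_arc gamma) 0 1 := curve_pieces.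
have gen a b : pieces (smooth_arc gamma) a b -> {within `[a, b], continuous (gamma : R -> K^o)}.
  elim=> {a b} [a b _ []//|a b c ab IH bc IH'].
  have -> : `[a, c]%classic = (`[a, b] `|` `[b, c])%classic :> set R.
    have lab := pieces_lt ab; have lbc := pieces_lt bc.
    apply/seteqP; split => x /=; rewrite !in_itv /=; last by case=> /andP[h1 h2]; apply/andP; split; lra.
    by case/andP => h1 h2; have [h3|h3] := leP x b; [left|right]; apply/andP; split => //; exact: ltW.
  by apply: withinU_continuous => //; exact: interval_closed.
exact: gen.
Qed.

Lemma ccont_gammac : ccont gammac.
Proof.
have cg : continuous (fun t => gammac t : K^o).
  apply: (within_compT curve_continuous (@clamp01_continuous R)) => t.
  by rewrite /= in_itv /= clamp01_itv.
by split; [exact: continuous_compT cg (@Re_continuous R)|exact: continuous_compT cg (@Im_continuous R)].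
Qed.

Lemma smooth_arc_derivative a b t : smooth_arc gamma a b -> a < t < b ->
  is_cder gamma t (cderive gamma t).
Proof.
move=> [_ [g [_ _ h]]] tab; have [d1 d2 _] := h t tab.
by split; rewrite /cderive /= derive1E; exact: derivableP.
Qed.

Definition integrand h t := h (gamma t) * cderive gamma t.

Lemma integrand_piece h a b : ccont (fun t => h (gammac t)) -> smooth_arc gamma a b ->
    0 <= a -> b <= 1 -> exists g : R -> K,
  [/\ {within `[a, b], continuous (fun t => Re (g t))},
      {within `[a, b], continuous (fun t => Im (g t))} &
      forall t, a < t < b -> integrand h t = g t].
Proof.
move=> [c1 c2] [_ [g [cg _ hg]]] a0 b1; exists (fun t => h (gammac t) * g t).
have g1 : {within `[a, b], continuous (fun t => Re (g t))}.
  by apply: (@continuous_compT (subspace `[a, b]) K^o R g Re); [exact: cg|exact: Re_continuous].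
have g2 : {within `[a, b], continuous (fun t => Im (g t))}.
  by apply: (@continuous_compT (subspace `[a, b]) K^o R g Im); [exact: cg|exact: Im_continuous].
have h1 : {within `[a, b], continuous (fun t => Re (h (gammac t)))} by exact: continuous_subspaceT.
have h2 : {within `[a, b], continuous (fun t => Im (h (gammac t)))} by exact: continuous_subspaceT.
split.
- rewrite (_ : (fun t => Re _) = fun t => Re (h (gammac t)) * Re (g t) - Im (h (gammac t)) * Im (g t)).
    by apply: (@continuous_sub R (subspace `[a, b])); apply: (@continuous_mul R (subspace `[a, b])).
  by apply/funext => t; rewrite cReM.
- rewrite (_ : (fun t => Im _) = fun t => Re (h (gammac t)) * Im (g t) + Im (h (gammac t)) * Re (g t)).
    by apply: (@continuous_add R (subspace `[a, b])); apply: (@continuous_mul R (subspace `[a, b])).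
  by apply/funext => t; rewrite cImM.
move=> t tab; rewrite /integrand gammac_id; last by case/andP: tab => h3 h4; apply/andP; split; lra.
by have [_ _ ->] := hg t tab.
Qed.

Lemma integrable_integrand h : ccont (fun t => h (gammac t)) ->
  mu.-integrable `[0, 1] (EFin \o (fun t => Re (integrand h t))) /\
  mu.-integrable `[0, 1] (EFin \o (fun t => Im (integrand h t))).
Proof.
move=> ch; have P := pieces_bounds curve_pieces (lexx 0) (lexx 1).
split; apply: integrable_pieces; apply: pieces_sub P => x y xy [sxy x0 y1];
  have [g [g1 g2 hg]] := integrand_piece ch sxy x0 y1.
  by exists (fun t => Re (g t)) => // t txy; rewrite hg.
by exists (fun t => Im (g t)) => // t txy; rewrite hg.
Qed.

(** [G] has to be differentiable only where [gamma] is, which allows break points; continuity of [G]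
    joins the pieces. *)
Lemma contour_FTC (G : R -> K) h : ccont (fun t => h (gammac t)) -> ccont G ->
    (forall t, 0 < t < 1 -> is_cder gamma t (cderive gamma t) -> is_cder G t (integrand h t)) ->
  contour_integral gamma h = G 1 - G 0.
Proof.
move=> ch [G1 G2] dG; have P := pieces_bounds curve_pieces (lexx 0) (lexx 1).
have [|_ E1] := @FTC_piecewise R (fun t => Re (G t)) (fun t => Re (integrand h t)) 0 1.
  apply: pieces_sub P => x y xy [sxy x0 y1]; have [g [g1 g2 hg]] := integrand_piece ch sxy x0 y1.
  split; first exact: continuous_subspaceT.
  exists (fun t => Re (g t)) => // t txy; split; first by rewrite hg.
  apply: (dG t _ _).1; last exact: smooth_arc_derivative sxy txy.
  by case/andP: txy => h1 h2; apply/andP; split; lra.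
have [|_ E2] := @FTC_piecewise R (fun t => Im (G t)) (fun t => Im (integrand h t)) 0 1.
  apply: pieces_sub P => x y xy [sxy x0 y1]; have [g [g1 g2 hg]] := integrand_piece ch sxy x0 y1.
  split; first exact: continuous_subspaceT.
  exists (fun t => Im (g t)) => // t txy; split; first by rewrite hg.
  apply: (dG t _ _).2; last exact: smooth_arc_derivative sxy txy.
  by case/andP: txy => h1 h2; apply/andP; split; lra.
rewrite /contour_integral E1 E2; by case: (G 1) (G 0) => a b [c d].
Qed.

Lemma eq_contour_integral h h' : (forall t, 0 <= t <= 1 -> h (gamma t) = h' (gamma t)) ->
  contour_integral gamma h = contour_integral gamma h'.
Proof.
move=> E; rewrite /contour_integral; congr Complex; apply: eq_Rintegral => t;
  by rewrite inE /= in_itv /= => t01; rewrite E.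
Qed.

Lemma contour_integralD h h' : ccont (fun t => h (gammac t)) -> ccont (fun t => h' (gammac t)) ->
  contour_integral gamma (fun z => h z + h' z) = contour_integral gamma h + contour_integral gamma h'.
Proof.
move=> /integrable_integrand[i1 i2] /integrable_integrand[i1' i2'].
rewrite /contour_integral; apply/eqP; rewrite eq_complex /=; apply/andP; split; apply/eqP.
  rewrite -RintegralD //; apply: eq_Rintegral => t _; by rewrite mulrDl cReD.
rewrite -RintegralD //; apply: eq_Rintegral => t _; by rewrite mulrDl cImD.
Qed.

Lemma contour_integralZ c h : ccont (fun t => h (gammac t)) ->
  contour_integral gamma (fun z => c * h z) = c * contour_integral gamma h.
Proof.
move=> /integrable_integrand[i1 i2].
have iZ (x : R) (u : R -> R) : mu.-integrable `[0, 1] (EFin \o u) ->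
    mu.-integrable `[0, 1] (EFin \o (fun t => x * u t)).
  by move=> iu; apply: eq_integrable (integrableZl _ x iu).
rewrite /contour_integral; apply/eqP; rewrite eq_complex cReM cImM /=; apply/andP; split; apply/eqP.
  rewrite -!RintegralZl // -RintegralB //; try exact: iZ.
  by apply: eq_Rintegral => t _; rewrite -mulrA cReM.
rewrite -!RintegralZl // -RintegralD //; try exact: iZ.
by apply: eq_Rintegral => t _; rewrite -mulrA cImM.
Qed.

Definition along f := forall t : R, 0 <= t <= 1 -> regular f (gamma t).

Lemma along_gammac f t : along f -> regular f (gammac t).
Proof. by move=> af; apply: af; exact: clamp01_itv. Qed.

Lemma ccont_rateval f : along f -> ccont (fun t => rateval f (gammac t)).
Proof.
move=> af; apply: ccontM; first exact: ccont_poly ccont_gammac.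
by apply: ccontV; [exact: ccont_poly ccont_gammac|move=> t; exact: along_gammac].
Qed.

Lemma is_cder_rateval f t d : regular f (gamma t) -> is_cder gamma t d ->
  is_cder (fun s => rateval f (gamma s)) t (rateval (ratderiv f) (gamma t) * d).
Proof.
move=> rf dg; have dn := is_cder_poly (ratnum f) dg.
have dd := is_cderV rf (is_cder_poly (ratden f) dg).
apply: eq_is_cder (is_cderM dn dd) => // .
by rewrite rateval_ratderiv //; move: rf; rewrite /regular => rf; field.
Qed.

Lemma near_gammac (t : R) : 0 < t < 1 -> \forall s \near t, gamma s = gammac s.
Proof.
move=> t01; have : \forall s \near t, s \in `]0, 1[ by exact: near_in_itvoo.
by apply: filterS => s; rewrite in_itv /= => /andP[s0 s1]; rewrite gammac_id // !ltW.
Qed.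

Lemma contour_ratderiv f : along f ->
  contour_integral gamma (rateval (ratderiv f)) = rateval f (gamma 1) - rateval f (gamma 0).
Proof.
move=> af; rewrite (@contour_FTC (fun t => rateval f (gammac t))).
- by rewrite !gammac_id ?lexx ?ler01.
- by apply: ccont_rateval => t t01; apply: regular_ratderiv; exact: af.
- exact: ccont_rateval.
move=> t t01 dg; have : is_cder (fun s => rateval f (gamma s)) t (integrand (rateval (ratderiv f)) t).
  by apply: is_cder_rateval => //; apply: af; case/andP: t01 => h1 h2; rewrite !ltW.
by apply: near_is_cder; apply: filterS (near_gammac t01) => s ->.
Qed.

Local Notation cst := (@tofrac {poly K} \o polyC).

Lemma along_inv_sub Y a : along Y -> (forall t, 0 <= t <= 1 -> rateval Y (gamma t) != a) ->
  along (Y - cst a)^-1.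
Proof. by move=> aY Ya t t01; have [] := regular_inv_sub (aY t t01) (Ya t t01). Qed.

(** The continuous logarithm ln |u| + i theta of u = Y - a is a primitive along the curve, and its
    real part returns to its initial value. *)
Lemma contour_log Y a (theta : R -> R) : along Y ->
    (forall t, 0 <= t <= 1 -> rateval Y (gamma t) != a) -> continuous theta ->
    (forall t, 0 <= t <= 1 -> polar (plane_point (rateval Y (gamma t) - a)) (theta t)) ->
    rateval Y (gamma 0) = rateval Y (gamma 1) ->
  contour_integral gamma (rateval ((Y - cst a)^-1 * ratderiv Y)) = Complex 0 (theta 1 - theta 0).
Proof.
move=> aY Ya ct pt Y01; pose u t := rateval Y (gammac t) - a.
have u0 t : u t != 0 by rewrite subr_eq0; apply: Ya; exact: clamp01_itv.
have cu : ccont u.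
  have := ccontD (ccont_rateval aY) (ccont_cst (- a)).
  by [].
pose L t := ln (Re (u t) * Re (u t) + Im (u t) * Im (u t)) / 2.
have cL : continuous L.
  apply: continuous_mul; last by move=> t; exact: cvg_cst.
  move=> t; apply: (@continuous_comp _ _ _ (fun t => Re (u t) * Re (u t) + Im (u t) * Im (u t)) (@ln R)).
    case: cu => c1 c2; have : continuous (fun t => Re (u t) * Re (u t) + Im (u t) * Im (u t)).
      by apply: continuous_add; exact: continuous_mul.
    exact.
  by apply: continuous_ln; rewrite -!expr2 normsq_gt0.
have aI := along_inv_sub aY Ya.
have aD : along (ratderiv Y) by move=> t t01; apply: regular_ratderiv; exact: aY.
have aM : along ((Y - cst a)^-1 * ratderiv Y).
  by move=> t t01; have [] := ratevalM (aI t t01) (aD t t01).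
rewrite (@contour_FTC (fun t => Complex (L t) (theta t))).
- have -> : L 1 = L 0 by rewrite /L /u !gammac_id ?lexx ?ler01 // Y01.
  by apply/eqP; rewrite eq_complex /= subrr !eqxx.
- exact: ccont_rateval.
- by split.
move=> t t01 dg; have t01' : 0 <= t <= 1 by case/andP: t01 => h1 h2; rewrite !ltW.
have du : is_cder u t (rateval (ratderiv Y) (gamma t) * cderive gamma t).
  have d1 := is_cderD (is_cder_rateval (aY t t01') dg) (is_cder_cst (- a) t).
  rewrite addr0 in d1; apply: near_is_cder d1.
  by apply: filterS (near_gammac t01) => s ->.
have -> : integrand (rateval ((Y - cst a)^-1 * ratderiv Y)) t =
    rateval (ratderiv Y) (gamma t) * cderive gamma t / u t.
  rewrite /integrand; have [_ ->] := ratevalM (aI t t01') (aD t t01').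
  have [_ ->] := regular_inv_sub (aY t t01') (Ya t t01').
  by rewrite /u gammac_id //; ring.
split; first exact: is_derive_ln_modulus.
apply: is_derive_angle => //.
have : \forall s \near t, s \in `]0, 1[ by exact: near_in_itvoo.
apply: filterS => s; rewrite in_itv /= => /andP[s0 s1].
have s01 : 0 <= s <= 1 by rewrite !ltW.
by rewrite /u gammac_id //; exact: pt.
Qed.

(** Regularity is part of the notion because [rateval] takes the default 0 at poles, where it does
    not respect sums and products. *)
Definition vint f := along f /\ contour_integral gamma (rateval f) = 0.

Lemma vint_add f g : vint f -> vint g -> vint (f + g).
Proof.
move=> [af ef] [ag eg]; split.
  by move=> t t01; have [] := ratevalD (af t t01) (ag t t01).
rewrite (@eq_contour_integral _ (fun z => rateval f z + rateval g z)).
  by rewrite contour_integralD ?ef ?eg ?addr0 //; exact: ccont_rateval.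
by move=> t t01; have [] := ratevalD (af t t01) (ag t t01).
Qed.

Lemma vint_scale c f : vint f -> vint (cst c * f).
Proof.
move=> [af ef]; have ac t : regular (cst c) (gamma t) by have [] := rateval_cst c (gamma t).
split.
  by move=> t t01; have [] := ratevalM (ac t) (af t t01).
rewrite (@eq_contour_integral _ (fun z => c * rateval f z)).
  by rewrite contour_integralZ ?ef ?mulr0 //; exact: ccont_rateval.
move=> t t01; have [_ ->] := ratevalM (ac t) (af t t01).
by have [_ ->] := rateval_cst c (gamma t).
Qed.

End ContourIntegrals.

(** * Primitives of polynomials and values of p(W) *)

Section PolynomialLemmas.
Variable K : fieldType.
Implicit Types p q N : {poly K}.

(* By the Chinese remainder theorem, G may be prescribed to be divisible by
   n^2 (X - w0) and congruent to 1 modulo (X - w1)^(b + 1), where N = n (X - w1)^b. *)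
Lemma separating_primitive N w0 w1 : N != 0 -> w0 != w1 ->
  exists G q, [/\ G^`() = N * q, G.[w0] = 0 & G.[w1] = 1].
Proof.
move=> N0 w01; have [b [n nw1 EN]] := multiplicity_XsubC N w1.
rewrite N0 /= in nw1.
have cn : coprimep n ('X - w1%:P) by rewrite coprimep_XsubC.
have cop : coprimep (n ^+ 2 * ('X - w0%:P)) (('X - w1%:P) ^+ b.+1).
  apply: coprimep_expr; rewrite coprimepMl coprimep_pexpl // cn /=.
  by rewrite coprimep_XsubC root_XsubC eq_sym.
have [[s t] /= E] := Bezout_eq1_coprimepP _ _ cop.
pose G := s * (n ^+ 2 * ('X - w0%:P)).
have EG : G = 1 - t * ('X - w1%:P) ^+ b.+1 by rewrite -E addrK.
have d1 : n %| G^`().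
  have -> : G^`() = n * (s^`() * n * ('X - w0%:P) + s * (n^`() *+ 2 * ('X - w0%:P) + n)).
    by rewrite /G !derivM derivXsubC; ring.
  exact: dvdp_mulr.
have d2 : ('X - w1%:P) ^+ b %| G^`().
  have -> : G^`() = ('X - w1%:P) ^+ b * (- (t^`() * ('X - w1%:P) + t *+ b.+1)).
    rewrite EG derivB derivM -polyC1 derivC deriv_exp derivXsubC exprS /=.
    move: (('X - w1%:P) ^+ b) ('X - w1%:P) (t^`()) => Y Z t'; by rewrite -[t *+ _]mulr_natr -[_ *+ _]mulr_natr; ring.
  exact: dvdp_mulr.
have /dvdpP[q Eq] : N %| G^`().
  by rewrite EN Gauss_dvdp ?d1 // coprimep_expr.
exists G, q; split; first by rewrite Eq mulrC.
  by rewrite /G mulrA hornerM hornerXsubC subrr mulr0.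
by rewrite EG !hornerE subrr expr0n /= mulr0 subr0.
Qed.

End PolynomialLemmas.

Lemma poly_primitive (K : numFieldType) (q : {poly K}) : exists G : {poly K}, G^`() = q.
Proof.
exists (\poly_(i < (size q).+1) (q`_i.-1 / i%:R)); apply/polyP => i.
rewrite coef_deriv coef_poly ltnS; case: ltnP => [lt|le].
  by rewrite /= -[_ *+ _]mulr_natr divfK // pnatr_eq0.
by rewrite mul0rn nth_default.
Qed.

Section PolyInRatfun.
Variable K : fieldType.
Implicit Types (f : ratfun K) (p : {poly K}).
Local Notation cst := (@tofrac {poly K} \o polyC).

Lemma rateval_pev f p z : regular f z ->
  regular (pev cst f p) z /\ rateval (pev cst f p) z = p.[rateval f z].
Proof.
move=> fz; elim/poly_ind: p => [|p c [r IH]].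
  by have := rateval_cst 0 z; rewrite horner0 (rmorph0 (pev cst f)) polyC0 tofrac0.
rewrite (rmorphD (pev cst f)) (rmorphM (pev cst f)) pevX pevC hornerMXaddC -IH.
have [rm em] := ratevalM r fz; have [rc ec] := rateval_cst c z.
by have [rD eD] := ratevalD rm rc; split; [exact: rD|exact: etrans eD (congr2 +%R em ec)].
Qed.

Lemma ratderiv_pev f p : ratderiv (pev cst f p) = pev cst f p^`() * ratderiv f.
Proof.
apply: (@derivation_pev _ _ cst (@ratderiv K) f p); [exact: ratderivD|exact: ratderivM|exact: ratderiv_cst].
Qed.

Lemma cancel_common (F : fieldType) (h n d : F) : h != 0 -> d != 0 -> h * n / (h * d) * d = n.
Proof. by move=> h0 d0; field; rewrite h0 d0. Qed.

(** Passes from the fractions of the algebraic part to the reduced ones through which [ratmap] is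
    defined. *)
Lemma pev_lowest_terms (P V : ratfun K) p q : pev cst V q != 0 -> P = pev cst V p / pev cst V q ->
    let Pt := tofrac p / tofrac q in
  pev cst V (ratden Pt) != 0 /\ P * pev cst V (ratden Pt) = pev cst V (ratnum Pt).
Proof.
move=> Vq ->; cbn zeta; set Pt := _ / _.
have q0 : q != 0 by apply: contraNneq Vq => ->; rewrite rmorph0.
have [h [Ep Eq]] := ratfun_common_factor q0 (erefl Pt).
move: Ep Eq Vq; move: (ratnum Pt) (ratden Pt) => n d -> ->.
rewrite !rmorphM mulf_eq0 negb_or; move: (pev _ _ h) (pev _ _ n) (pev _ _ d) => x y z.
by move=> /andP[x0 z0]; split; [exact: z0|apply: cancel_common; [exact: x0|exact: z0]].
Qed.

End PolyInRatfun.

(** * Closedness and null-homology from vanishing integrals *)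

Section IntegralsAlongCurve.
Variable R : realType.
Local Notation K := R[i].
Variable gamma : R -> K.
Hypothesis gamma_smooth : piecewise_smooth gamma.
Local Notation cst := (@tofrac {poly K} \o polyC).
Local Notation vint := (vint gamma).
Local Notation along := (along gamma).
Implicit Types (f W : ratfun K) (p : {poly K}).

Lemma along_pev W p : along W -> along (pev cst W p).
Proof. by move=> aW t t01; have [] := rateval_pev p (aW t t01). Qed.

Lemma along_ratderiv f : along f -> along (ratderiv f).
Proof. by move=> af t t01; apply: regular_ratderiv; exact: af. Qed.

Lemma alongM f g : along f -> along g -> along (f * g).
Proof. by move=> af ag t t01; have [] := ratevalM (af t t01) (ag t t01). Qed.

Lemma vint_ratderiv f : along f -> rateval f (gamma 0) = rateval f (gamma 1) -> vint (ratderiv f).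
Proof.
move=> af E; split; first exact: along_ratderiv.
by rewrite contour_ratderiv // E subrr.
Qed.

Lemma vint_pev W p : along W -> rateval W (gamma 0) = rateval W (gamma 1) ->
  vint (pev cst W p * ratderiv W).
Proof.
move=> aW E; have [G <-] := poly_primitive p; rewrite -ratderiv_pev.
apply: vint_ratderiv; first exact: along_pev.
by do 2![rewrite (rateval_pev _ (aW _ _)).2 ?lexx ?ler01 //]; rewrite E.
Qed.

(** If the end values of W differed, some G with G' a multiple of N would take the values 0 and 1
    there, and the integral of G'(W) W' would be 1. *)
Lemma closed_of_moments W N : along W -> N != 0 ->
    (forall p, vint (pev cst W (N * p) * ratderiv W)) ->
  rateval W (gamma 0) = rateval W (gamma 1).
Proof.
move=> aW N0 h; apply/eqP/negPn/negP => w01.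
have [G [q [EG G0 G1]]] := separating_primitive N0 w01.
have [_] := h q; rewrite -EG -ratderiv_pev contour_ratderiv //; last exact: along_pev.
do 2![rewrite (rateval_pev _ (aW _ _)).2 ?lexx ?ler01 //].
by rewrite G0 G1 subr0 => /eqP; rewrite oner_eq0.
Qed.

Lemma residue_field (F : fieldType) (x u v D : F) k : x != 0 ->
  (u + v * x) * x ^+ k * x^-1 ^+ k.+1 * D = u * (x^-1 * D) + v * D.
Proof.
move=> x0; rewrite exprVn exprS; have := expf_neq0 k x0; move: (x ^+ k) => y y0.
by field; rewrite x0 y0.
Qed.

Lemma cancel_field (F : fieldType) (c d m x y : F) : d * c = 1 -> m = -1 ->
  d * (c * x + y + m * y) = x.
Proof. by move=> dc ->; rewrite mulN1r addrK mulrA dc mul1r. Qed.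

(** With N = n (X - a)^k and n(a) != 0, division by (W - a)^(k + 1) leaves n(a) / (W - a) plus a
    polynomial in W, which has integral 0 as W takes equal end values. *)
Lemma vint_residue W a N : along W -> rateval W (gamma 0) = rateval W (gamma 1) ->
    (forall t, 0 <= t <= 1 -> rateval W (gamma t) != a) -> N != 0 ->
    (forall p j, vint (pev cst W (N * p) * (W - cst a)^-1 ^+ j * ratderiv W)) ->
  vint ((W - cst a)^-1 * ratderiv W).
Proof.
move=> aW E Wa N0 h; have [k [n na EN]] := multiplicity_XsubC N a.
rewrite N0 /= in na.
have Wa0 : W - cst a != 0.
  apply/eqP => W0; have := Wa 0; rewrite lexx ler01 => /(_ isT) /eqP; apply.
  by rewrite (_ : W = cst a) ?(rateval_cst _ _).2 //; apply/eqP; rewrite -subr_eq0 W0.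
have /dvdpP[q Eq] : 'X - a%:P %| n - n.[a]%:P by rewrite dvdp_XsubCl rootE !hornerE subrr.
have En : n = n.[a]%:P + q * ('X - a%:P) by rewrite -Eq addrC subrK.
have := h 1 k.+1; rewrite mulr1 EN {1}En rmorphM rmorphD rmorphM rmorphXn pevC pevXsubC.
have -> := @residue_field (ratfun K) (W - cst a) (cst n.[a]) (pev cst W q) (ratderiv W) k Wa0 => v.
have v' := vint_scale gamma_smooth (n.[a])^-1 (vint_add gamma_smooth v
  (vint_scale gamma_smooth (-1) (vint_pev q aW E))).
suff <- : cst (n.[a])^-1 * (cst n.[a] * ((W - cst a)^-1 * ratderiv W) +
    pev cst W q * ratderiv W + cst (- 1) * (pev cst W q * ratderiv W)) =
    (W - cst a)^-1 * ratderiv W by exact: v'.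
apply: cancel_field; first by rewrite -rmorphM mulVf ?rmorph1.
by rewrite rmorphN rmorph1.
Qed.


Lemma plane_point_inj : injective (@plane_point R).
Proof. by case=> a b [c d] [-> ->]. Qed.

Lemma closed_angle_of_vint W a : along W -> rateval W (gamma 0) = rateval W (gamma 1) ->
    (forall t, 0 <= t <= 1 -> rateval W (gamma t) != a) ->
    vint ((W - cst a)^-1 * ratderiv W) ->
  closed_angle (fun t => plane_point (rateval W (gamma (clamp01 t)) - a)).
Proof.
move=> aW E Wa [_ v0].
have Wa' t : rateval W (gamma (clamp01 t)) - a != 0.
  by rewrite subr_eq0; apply: Wa; exact: clamp01_itv.
have cu : ccont (fun t => rateval W (gamma (clamp01 t)) - a).
  exact: ccontD (ccont_rateval gamma_smooth aW) (ccont_cst (- a)).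
have [|theta ct h] := polar_lift_path (ccont_plane cu).
  by move=> t; rewrite plane_point_eq0.
have := contour_log gamma_smooth aW Wa ct _ E; rewrite v0 => H.
have {H} /eqP : Complex 0 0 = Complex 0 (theta 1 - theta 0) :> K.
  by apply: H => t t01; have := h t t01; rewrite clamp01_id.
rewrite eq_complex /= eqxx /= eq_sym subr_eq0 => /eqP E'.
by exists theta; split.
Qed.

Lemma ratmap_regular W z : regular W z -> ratmap W (Some z : CP1 R) = Some (rateval W z).
Proof. by rewrite /regular /ratmap => /negPf ->. Qed.

(** The bounding chain is built in the finite plane and carried to the sphere by the inclusion. *)
Lemma homologous_image_curve (S : seq K) (A : set (CP1 R)) W :
    (forall z, z \notin S -> A (Some z)) -> along W ->
    rateval W (gamma 0) = rateval W (gamma 1) ->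
    (forall a t, a \in S -> 0 <= t <= 1 -> rateval W (gamma t) != a) ->
    (forall a, a \in S -> vint ((W - cst a)^-1 * ratderiv W)) ->
  homologous_to_zero A (image_curve W gamma).
Proof.
move=> SA aW E WS vS.
pose c t := plane_point (rateval W (gamma (clamp01 t))).
pose f (x : R * R) : CP1 R := Some (Complex x.1 x.2).
have cc : continuous c by exact: ccont_plane (ccont_rateval gamma_smooth aW).
have cf : continuous f.
  apply: (continuous_compT (@Complex_continuous R)).
  exact: (@one_point_compactification_some_continuous K^o).
have Sf x : x \notin map (@plane_point R) S -> A (f x).
  move=> xS; apply: SA; apply: contra xS => h; apply/mapP; exists (Complex x.1 x.2) => //.
  by case: x h.
have cS t : c t \notin map (@plane_point R) S.
  apply/mapP => -[a aS /plane_point_inj Ea].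
  by have := WS a _ aS (clamp01_itv t); rewrite Ea eqxx.
have fc t : 0 <= t <= 1 -> (f \o c) t = image_curve W gamma t.
  move=> t01; rewrite /image_curve ratmap_regular; last exact: aW.
  by rewrite /f /c /= clamp01_id //; case: (rateval _ _).
have c01 : c 0 = c 1 by rewrite /c !clamp01_id ?lexx ?ler01 // E.
have Sf' x : avoiding (map (@plane_point R) S) x -> A (f x) by exact: Sf.
have [|B [sB hB]] := boundary_push (fun s => singular2_comp cf Sf') (plane_boundary cc cS c01 _).
  move=> a' /mapP[a aS ->]; have := closed_angle_of_vint aW E (fun t => WS a t aS) (vS a aS).
  by congr closed_angle; apply/funext => t; rewrite /shift_by /c /plane_point raddfB raddfB.
split.
  split.
    have : {within `[0, 1], continuous (f \o c)}.
      by apply: continuous_subspaceT; apply: continuous_compT.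
    apply: subspace_eq_continuous => t; rewrite inE /= in_itv /=; exact: fc.
  by move=> _ [t t01 <-]; rewrite -fc; [exact: Sf|move: t01; rewrite /= in_itv].
exists B; split; first exact: sB.
by move=> p; rewrite hB; exact: one_chain_ext.
Qed.

End IntegralsAlongCurve.

(** * From vanishing moments to the factorization *)

Section Necessity.
Variable R : realType.
Local Notation K := R[i].
Local Notation cst := (@tofrac {poly K} \o polyC).
Implicit Types (f W Pt : ratfun K) (p q : {poly K}).

Lemma poles_infty f : poles f (None : CP1 R) <-> (size (ratden f) < size (ratnum f))%N.
Proof. by rewrite /poles /= ltnNge; case: ifP. Qed.

Lemma ratden_root p q a : q != 0 -> (ratden (tofrac p / tofrac q)).[a] = 0 -> q.[a] = 0.
Proof.
move=> q0; have [h [_ {2}->]] := ratfun_common_factor q0 (erefl (tofrac p / tofrac q)).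
by rewrite hornerM => ->; rewrite mulr0.
Qed.

Lemma poles_infty_frac p q : q != 0 -> (size q < size p)%N ->
  poles (tofrac p / tofrac q) (None : CP1 R).
Proof.
move=> q0; have [h [Ep Eq]] := ratfun_common_factor q0 (erefl (tofrac p / tofrac q)).
rewrite poles_infty; have d0 := ratden_neq0 (tofrac p / tofrac q).
have h0 : h != 0 by apply: contraNneq q0; rewrite Eq => ->; rewrite mul0r.
move: Ep Eq d0; move: (ratnum _) (ratden _) => n d -> -> d0.
have [->|n0] := eqVneq n 0; first by rewrite mulr0 size_poly0 ltn0.
rewrite !size_mul //; move: h0; rewrite -size_poly_gt0.
by move: (size h) (size d) (size n) => x y z; lia.
Qed.

Variables (gamma : R -> K) (P Q : ratfun K) (i0 j0 : nat).
Hypothesis gamma_smooth : piecewise_smooth gamma.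
Hypotheses (nP : rat_nonconstant P) (nQ : rat_nonconstant Q).
Hypothesis no_poles : forall t : R, t \in `[0, 1] ->
  ~ poles P (Some (gamma t)) /\ ~ poles Q (Some (gamma t)).

Lemma along_no_poles f (t : R) : ~ poles f (Some (gamma t)) -> regular f (gamma t).
Proof. by rewrite poles_some => /contrapT. Qed.

Lemma along_P : along gamma P.
Proof. by move=> t t01; apply: along_no_poles; apply: (no_poles _).1; rewrite in_itv. Qed.

Lemma along_Q : along gamma Q.
Proof. by move=> t t01; apply: along_no_poles; apply: (no_poles _).2; rewrite in_itv. Qed.

Lemma contour_integral_moment i j :
  contour_integral gamma (rateval (P ^+ i * Q ^+ j * ratderiv Q)) =
  contour_integral gamma (fun z => rateval P z ^+ i * rateval Q z ^+ j * rateval (ratderiv Q) z).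
Proof.
apply: eq_contour_integral => t t01.
have [r1 e1] := ratevalX i (along_P t01); have [r2 e2] := ratevalX j (along_Q t01).
have [r3 e3] := ratevalM r1 r2; have r4 := along_ratderiv along_Q t01.
by rewrite (ratevalM r3 r4).2 e3 e1 e2.
Qed.

Lemma along_moment i j : along gamma (P ^+ i * Q ^+ j * ratderiv Q).
Proof.
apply: alongM; last exact: along_ratderiv along_Q.
apply: alongM => t t01; first exact: (ratevalX i (along_P t01)).1.
exact: (ratevalX j (along_Q t01)).1.
Qed.

Lemma one_side_of_moments :
    (forall i j, (i0 <= i)%N -> (j0 <= j)%N -> contour_integral gamma (fun z =>
      rateval P z ^+ i * rateval Q z ^+ j * rateval (ratderiv Q) z) = 0) ->
  exists Pt Qt W : ratfun R[i],
    [/\ forall x : CP1 R, ratmap P x = ratmap Pt (ratmap W x),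
        forall x : CP1 R, ratmap Q x = ratmap Qt (ratmap W x),
        closed_curve (image_curve W gamma) &
        on_one_side (poles Pt `|` poles Qt) (image_curve W gamma)].
Proof.
move=> moments.
have vmoments i j : (i0 <= i)%N -> (j0 <= j)%N -> vint gamma (P ^+ i * Q ^+ j * ratderiv Q).
  by move=> ii jj; split; [exact: along_moment|rewrite contour_integral_moment moments].
have P0 : P != 0 by apply/eqP => P0; apply: (nP (c := 0)); rewrite P0 polyC0 tofrac0.
have Qc c : Q != cst c by apply/eqP; exact: nQ.
have [V [p1 [p2 [q1 [q2 [[_ _ p20 q20] [[EP EQ sq] [[N N0 hN] res]]]]]]]] :=
  @moment_core K (ratfun K) (@tofrac {poly K}) (@tofrac_inj K) (@ratfun_frac K) (@ratderiv K)
    (@ratderivD K) (@ratderivM K) (@ratderiv_cst K) (vint gamma) (@vint_add R gamma gamma_smooth)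
    (@vint_scale R gamma gamma_smooth) P Q i0 j0 P0 Qc vmoments.
pose Pt := tofrac p1 / tofrac p2 : ratfun K; pose Qt := tofrac q1 / tofrac q2 : ratfun K.
have p2n0 : p2 != 0 by apply: contraNneq p20 => ->; rewrite rmorph0.
have q2n0 : q2 != 0 by apply: contraNneq q20 => ->; rewrite rmorph0.
have [d1 e1] := pev_lowest_terms p20 EP; have [d2 e2] := pev_lowest_terms q20 EQ.
have EPt := ratmap_comp d1 e1; have EQt := ratmap_comp d2 e2.
(* Because of this pole Q would be infinite wherever V is, so V is finite along the curve. *)
have inf : poles Qt None by exact: poles_infty_frac.
have aV : along gamma V.
  move=> t t01; apply/negP => /eqP r; have tI : t \in `[0, 1] by rewrite in_itv.
  apply: (no_poles tI).2; apply: (etrans (EQt _)).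
  by rewrite [ratmap V _]/ratmap r eqxx; exact: inf.
(* A point of the curve where V takes the value of a finite pole would be a pole of P or Q. *)
have avoid a t : (ratden Pt).[a] = 0 \/ (ratden Qt).[a] = 0 -> 0 <= t <= 1 ->
    rateval V (gamma t) != a.
  move=> ra t01; apply/eqP => Ea; have tI : t \in `[0, 1] by rewrite in_itv.
  have [h1 h2] := no_poles tI; case: ra => r; [apply: h1|apply: h2].
    by apply: (etrans (EPt _)); rewrite ratmap_regular ?Ea; [rewrite /ratmap r eqxx|exact: aV].
  by apply: (etrans (EQt _)); rewrite ratmap_regular ?Ea; [rewrite /ratmap r eqxx|exact: aV].
have E01 := closed_of_moments gamma_smooth aV N0 hN.
have cl : closed_curve (image_curve V gamma).
  by rewrite /closed_curve /image_curve !ratmap_regular ?E01 //; apply: aV; rewrite lexx ler01.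
exists Pt, Qt, V; split => //; split => //.
(* [S] lists the finite poles of [Pt] and [Qt], as the roots of their reduced denominators. *)
have [S ES] := closed_field_poly_normal (ratden Pt * ratden Qt).
have rS a : (a \in S) = root (ratden Pt * ratden Qt) a.
  by rewrite ES rootZ ?root_prod_XsubC // lead_coef_eq0 mulf_neq0 ?ratden_neq0.
have rS' a : a \in S -> (ratden Pt).[a] = 0 \/ (ratden Qt).[a] = 0.
  by rewrite rS rootM => /orP[] /eqP ->; [left|right].
apply: (homologous_image_curve gamma_smooth (S := S)) => //.
- move=> z; rewrite rS rootM negb_or => /andP[h1 h2] [] /poles_some; exact.
- by move=> a t /rS'; exact: avoid.
move=> a aS; have {}aS := rS' a aS.
have [|M M0 hM] := res a.
  by case: aS => [/(ratden_root p2n0)|/(ratden_root q2n0)]; [left|right].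
by apply: (vint_residue gamma_smooth aV E01 _ M0 hM) => t; exact: avoid.
Qed.

End Necessity.

(** * Rational functions of Y with prescribed poles *)

Section PartialFractions.
Variable K : fieldType.
Variables (Y : ratfun K) (T : seq K).
Local Notation cst := (@tofrac {poly K} \o polyC).
Implicit Types (f g : ratfun K) (p q : {poly K}) (s : seq K).

(** The ring K[Y, 1 / (Y - a) : a in T] of functions of Y with poles only in [T] and at infinity. *)
Inductive ratring : ratfun K -> Prop :=
| ratring_cst c : ratring (cst c)
| ratring_gen : ratring Y
| ratring_pole a : a \in T -> ratring (Y - cst a)^-1
| ratring_add f g : ratring f -> ratring g -> ratring (f + g)
| ratring_mul f g : ratring f -> ratring g -> ratring (f * g).

Lemma ratring_exp f n : ratring f -> ratring (f ^+ n).
Proof.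
move=> rf; elim: n => [|n IH]; last by rewrite exprS; exact: ratring_mul.
by rewrite expr0 -(rmorph1 cst); exact: ratring_cst.
Qed.

Hypothesis Y_notin : forall a, Y != cst a.

Lemma sub_cst_neq0 a : Y - cst a != 0.
Proof. by rewrite subr_eq0. Qed.

Definition pole_prod s := \prod_(a <- s) (Y - cst a)^-1.

Lemma pole_prod_pev s : pole_prod s * pev cst Y (\prod_(a <- s) ('X - a%:P)) = 1.
Proof.
rewrite /pole_prod rmorph_prod -big_split big1_seq // => a _.
by rewrite pevXsubC; apply: mulVf; exact: sub_cst_neq0.
Qed.

Lemma add_common_denominator (F : fieldType) (u v a b x y : F) : a * x = 1 -> b * y = 1 ->
  u * a + v * b = (u * y + v * x) * (a * b).
Proof. by move=> ax yb; rewrite mulrDl mulrACA -[y * b]mulrC yb mulr1 [a * b]mulrC mulrACA -[x * a]mulrC ax mulr1. Qed.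

Lemma mulrACA' (F : fieldType) (u a v b : F) : u * a * (v * b) = u * v * (a * b).
Proof. exact: mulrACA. Qed.

Lemma ratring_normal f : ratring f ->
  exists p s, {subset s <= T} /\ f = pev cst Y p * pole_prod s.
Proof.
elim=> {f} [c||a aT|f g _ [p [s [sT ->]]] _ [q [t [tT ->]]]|f g _ [p [s [sT ->]]] _ [q [t [tT ->]]]].
- by exists c%:P, [::]; split => //; rewrite /pole_prod big_nil mulr1 pevC.
- by exists 'X, [::]; split => //; rewrite /pole_prod big_nil mulr1 pevX.
- exists 1, [:: a]; split; first by move=> b; rewrite inE => /eqP ->.
  by rewrite /pole_prod big_seq1 rmorph1 mul1r.
- exists (p * \prod_(a <- t) ('X - a%:P) + q * \prod_(a <- s) ('X - a%:P)), (s ++ t); split.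
    by move=> b; rewrite mem_cat => /orP[/sT|/tT].
  rewrite {3}/pole_prod big_cat -![\prod_(a <- _) (Y - _)^-1]/(pole_prod _).
  rewrite rmorphD !rmorphM; apply: add_common_denominator; exact: pole_prod_pev.
exists (p * q), (s ++ t); split; first by move=> b; rewrite mem_cat => /orP[/sT|/tT].
by rewrite {3}/pole_prod big_cat rmorphM; exact: mulrACA'.
Qed.

Lemma derivation_inv_sub (F : fieldType) (x dx di : F) : x != 0 -> di * x + x^-1 * dx = 0 ->
  di = (-1) * (x^-1 * x^-1) * dx.
Proof. by move=> x0 e; apply: (mulIf x0); apply/eqP; rewrite -subr_eq0; apply/eqP; rewrite -e; field. Qed.

Lemma ratderiv_inv_sub a : ratderiv (Y - cst a)^-1 = (-1) * ((Y - cst a)^-1 * (Y - cst a)^-1) * ratderiv Y.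
Proof.
apply: derivation_inv_sub; first exact: sub_cst_neq0.
have -> : ratderiv Y = ratderiv (Y - cst a).
  by rewrite -(rmorphN cst) ratderivD ratderiv_cst addr0.
rewrite -ratderivM mulVf; last exact: sub_cst_neq0.
by rewrite -(rmorph1 cst) ratderiv_cst.
Qed.

Lemma factor_derivative (F : fieldType) (f g u v d : F) : u * d * g + f * (v * d) = (u * g + f * v) * d.
Proof. by ring. Qed.

Lemma ratring_deriv f : ratring f -> exists2 g, ratring g & ratderiv f = g * ratderiv Y.
Proof.
have r0 : ratring 0 by rewrite -(rmorph0 cst); exact: ratring_cst.
have r1 : ratring 1 by rewrite -(rmorph1 cst); exact: ratring_cst.
elim=> {f} [c||a aT|f g rf [u ru eu] rg [v rv ev]|f g rf [u ru eu] rg [v rv ev]].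
- by exists 0; rewrite ?mul0r ?ratderiv_cst.
- by exists 1; rewrite ?mul1r.
- exists ((-1) * ((Y - cst a)^-1 * (Y - cst a)^-1)); last exact: ratderiv_inv_sub.
  apply: ratring_mul; first by rewrite -(rmorph1 cst) -(rmorphN cst); exact: ratring_cst.
  by apply: ratring_mul; exact: ratring_pole.
- by exists (u + v); [exact: ratring_add|rewrite ratderivD eu ev mulrDl].
exists (u * g + f * v); last by rewrite ratderivM eu ev; exact: factor_derivative.
by apply: ratring_add; exact: ratring_mul.
Qed.

End PartialFractions.

(** * Integrals of partial fractions *)

Section VanishingOnRatring.
Variable R : realType.
Local Notation K := R[i].
Local Notation cst := (@tofrac {poly K} \o polyC).
Variables (gamma : R -> K) (Y : ratfun K) (T : seq K).
Hypothesis gamma_smooth : piecewise_smooth gamma.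
Hypothesis aY : along gamma Y.
Hypothesis Y01 : rateval Y (gamma 0) = rateval Y (gamma 1).
Hypothesis Y_notin : forall a, Y != cst a.
Hypothesis YT : forall a t, a \in T -> 0 <= t <= 1 -> rateval Y (gamma t) != a.
Hypothesis vT : forall a, a \in T -> vint gamma ((Y - cst a)^-1 * ratderiv Y).

Lemma power_field (F : fieldType) (z d : F) k :
  (-1) * z ^+ k * ((-1) * (z * z) * d) = z ^+ k.+2 * d.
Proof. by rewrite !exprS; ring. Qed.

(** For Z = 1 / (Y - a) one has Z^(k + 2) dY = - Z^k dZ, which is exact with equal end values; the
    hypothesis on logarithmic integrals covers the simple pole. *)
Lemma vint_pole a k : a \in T -> vint gamma ((Y - cst a)^-1 ^+ k.+1 * ratderiv Y).
Proof.
move=> aT; case: k => [|k]; first by rewrite expr1; exact: vT.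
set Z := (Y - cst a)^-1.
have aZ : along gamma Z by apply: along_inv_sub => // t; exact: YT.
have Z01 : rateval Z (gamma 0) = rateval Z (gamma 1).
  by do 2![rewrite (regular_inv_sub (aY _) (YT _ _)).2 ?lexx ?ler01 //]; rewrite Y01.
have := vint_pev gamma_smooth (-1 * 'X^k) aZ Z01.
rewrite (ratderiv_inv_sub Y_notin) -/Z (rmorphM (pev cst Z)) (rmorphN (pev cst Z)) rmorph1 rmorphXn pevX.
by have -> := power_field Z (ratderiv Y) k.
Qed.

Lemma split_pole_field (F : fieldType) (c q z y r d : F) : z * y = 1 ->
  (c + q * y) * (z * r) * d = c * (z * r * d) + q * r * d.
Proof.
move=> zy; rewrite !mulrDl !mulrA; congr (_ + _).
by rewrite -[q * y * z]mulrA [y * z]mulrC zy mulr1.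
Qed.

Lemma two_poles_field (F : fieldType) (p y a b r d e e' : F) : y - a != 0 -> y - b != 0 ->
    e * (a - b) = 1 -> e' = - e ->
  p * ((y - a)^-1 * ((y - b)^-1 * r)) * d =
  e * (p * ((y - a)^-1 * r) * d) + e' * (p * ((y - b)^-1 * r) * d).
Proof.
move=> ya yb eab ->.
suff -> : (y - a)^-1 * ((y - b)^-1 * r) = e * ((y - a)^-1 * r - (y - b)^-1 * r) by ring.
rewrite -[LHS]mul1r -eab; field; by rewrite ya yb.
Qed.

(** Induction on the number of poles. If all equal a, splitting off p(a) leaves a pure power and a
    quotient with one pole less; two different poles a, b are separated by 1 / ((y - a) (y - b)) =
    (1 / (y - a) - 1 / (y - b)) / (a - b). *)
Lemma vint_normal p s : {subset s <= T} -> vint gamma (pev cst Y p * pole_prod Y s * ratderiv Y).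
Proof.
have [n] := ubnP (size s); elim: n s p => // n IH [|a s] p lt sT.
  by rewrite /pole_prod big_nil mulr1; exact: vint_pev.
have aT : a \in T by apply: sT; exact: mem_head.
have sT' : {subset s <= T} by move=> b bs; apply: sT; rewrite inE bs orbT.
have a0 := sub_cst_neq0 Y_notin a.
have cons b r : pole_prod Y (b :: r) = (Y - cst b)^-1 * pole_prod Y r by exact: big_cons.
have [/all_pred1P es|/allPn[b bs ba]] := boolP (all (pred1 a) s).
  have /dvdpP[q Eq] : 'X - a%:P %| p - p.[a]%:P by rewrite dvdp_XsubCl rootE !hornerE subrr.
  have -> : p = p.[a]%:P + q * ('X - a%:P) by rewrite -Eq addrC subrK.
  have v1 : vint gamma (cst p.[a] * (pole_prod Y (a :: s) * ratderiv Y)).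
    apply: vint_scale => //; rewrite es; move: (size s) => k.
    suff -> : pole_prod Y (a :: nseq k a) = (Y - cst a)^-1 ^+ k.+1 by exact: vint_pole.
    by rewrite cons exprS; congr (_ * _); rewrite /pole_prod big_nseq -Monoid.iteropE.
  have v2 := IH s q lt sT'.
  have := vint_add gamma_smooth v1 v2; rewrite rmorphD rmorphM pevC pevXsubC !cons.
  by rewrite (split_pole_field _ _ _ _ (mulVf a0)).
have bT := sT' b bs.
have perm_prod : pole_prod Y (a :: s) = pole_prod Y [:: a, b & rem b s].
  by apply: perm_big; rewrite perm_cons; exact: perm_to_rem.
have lt' c : (size (c :: rem b s) < n)%N by rewrite /= size_rem // prednK // ?(leq_trans _ lt) //; case: (s) bs.
have va : vint gamma (pev cst Y p * pole_prod Y (a :: rem b s) * ratderiv Y).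
  by apply: IH => // x; rewrite inE => /orP[/eqP ->//|/mem_rem]; exact: sT'.
have vb : vint gamma (pev cst Y p * pole_prod Y (b :: rem b s) * ratderiv Y).
  by apply: IH => // x; rewrite inE => /orP[/eqP ->//|/mem_rem]; exact: sT'.
have e1 : cst (a - b)^-1 * (cst a - cst b) = 1.
  by rewrite -(rmorphB cst) -(rmorphM cst) mulVf ?(rmorph1 cst) // subr_eq0 eq_sym.
have e2 : cst (- (a - b)^-1) = - cst (a - b)^-1 by exact: rmorphN.
rewrite perm_prod !cons.
rewrite (two_poles_field _ _ _ a0 (sub_cst_neq0 Y_notin b) e1 e2) -!cons.
exact: (vint_add gamma_smooth (vint_scale gamma_smooth (a - b)^-1 va)
  (vint_scale gamma_smooth (- (a - b)^-1) vb)).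
Qed.

Lemma vint_ratring f : ratring Y T f -> vint gamma (f * ratderiv Y).
Proof. by move=> /(ratring_normal Y_notin)[p [s [sT ->]]]; exact: vint_normal. Qed.

Lemma vint_moment P Q i j : ratring Y T P -> ratring Y T Q ->
  vint gamma (P ^+ i * Q ^+ j * ratderiv Q).
Proof.
move=> rP rQ; have [g rg ->] := ratring_deriv Y_notin rQ; rewrite mulrA.
apply: vint_ratring; apply: ratring_mul rg; apply: ratring_mul; exact: ratring_exp.
Qed.

End VanishingOnRatring.

(** * Choice of the coordinate Y *)

Section RatringMembership.
Variable K : closedFieldType.
Local Notation cst := (@tofrac {poly K} \o polyC).
Implicit Types (W P Y : ratfun K) (T s : seq K) (n d p : {poly K}).

Lemma ratring_pev Y T p : ratring Y T (pev cst Y p).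
Proof.
elim/poly_ind: p => [|p c IH]; first by rewrite rmorph0 -(rmorph0 cst); exact: ratring_cst.
rewrite rmorphD rmorphM pevX pevC; apply: ratring_add; last exact: ratring_cst.
by apply: ratring_mul => //; exact: ratring_gen.
Qed.

Lemma quotient_product (F : fieldType) (P n d e u v : F) : P * d = n -> d = e * v ->
  u * v = 1 -> e != 0 -> P = e^-1 * (n * u).
Proof.
move=> <- -> uv e0; have -> : P * (e * v) * u = P * e * (u * v) by ring.
by rewrite uv mulr1 mulrC mulfK.
Qed.

Lemma pole_decomposition W P n d : (forall a, W != cst a) -> pev cst W d != 0 ->
    P * pev cst W d = pev cst W n ->
  exists s c, [/\ P = cst c * (pev cst W n * pole_prod W s), size d = (size s).+1 &
    forall a, (a \in s) = root d a].
Proof.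
move=> nW d0 E; have dn0 : d != 0 by apply: contraNneq d0 => ->; rewrite rmorph0.
have [s Es] := closed_field_poly_normal d; exists s, (lead_coef d)^-1.
have lc0 : lead_coef d != 0 by rewrite lead_coef_eq0.
split; first 1 last.
- by rewrite {1}Es size_scale // size_prod_XsubC.
- by move=> a; rewrite [in RHS]Es rootZ // root_prod_XsubC.
rewrite (fmorphV cst); apply: (quotient_product E _ (pole_prod_pev nW s)).
  by rewrite {1}Es -mul_polyC rmorphM pevC.
by rewrite fmorph_eq0.
Qed.

Lemma ratring_pole_at_infinity W P T n d : (forall a, W != cst a) -> pev cst W d != 0 ->
    P * pev cst W d = pev cst W n -> (forall a, root d a -> a \in T) -> ratring W T P.
Proof.
move=> nW d0 E dT; have [s [c [-> _ sd]]] := pole_decomposition nW d0 E.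
apply: ratring_mul; first exact: ratring_cst.
apply: ratring_mul; first exact: ratring_pev.
have : {subset s <= T} by move=> a; rewrite sd => /dT.
elim: s {sd} => [|a s IH] sT; rewrite /pole_prod ?big_nil ?big_cons.
  by rewrite -(rmorph1 cst); exact: ratring_cst.
apply: ratring_mul; first by apply: ratring_pole; apply: sT; exact: mem_head.
by apply: IH => b bs; apply: sT; rewrite inE bs orbT.
Qed.

(** The bound on the degree of [p] means no pole at infinity: dividing by W - a once for each pole
    leaves constants and products of the 1 / (W - a), without positive powers of W. *)
Lemma ratring_proper W Y T s p : (forall a, W != cst a) ->
    (forall a, a \in s -> ratring Y T (W - cst a)^-1) -> (size p <= (size s).+1)%N ->
  ratring Y T (pev cst W p * pole_prod W s).
Proof.
move=> nW; elim: s p => [|a s IH] p sT sp.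
  by rewrite (size1_polyC sp) /pole_prod big_nil mulr1 pevC; exact: ratring_cst.
have sT' b : b \in s -> ratring Y T (W - cst b)^-1 by move=> bs; apply: sT; rewrite inE bs orbT.
have a0 := sub_cst_neq0 nW a.
have /dvdpP[q Eq] : 'X - a%:P %| p - p.[a]%:P by rewrite dvdp_XsubCl rootE !hornerE subrr.
have -> : p = p.[a]%:P + q * ('X - a%:P) by rewrite -Eq addrC subrK.
have key (F : fieldType) (c u x r : F) : x != 0 -> (c + u * x) * (x^-1 * r) = c * (x^-1 * r) + u * r.
  by move=> x0; field.
rewrite rmorphD rmorphM pevC pevXsubC /pole_prod big_cons (key _ _ _ _ _ a0).
apply: ratring_add; last first.
  apply: IH => //; have [->|q0] := eqVneq q 0; first by rewrite size_poly0.
  have := size_polyD p (- p.[a]%:P); rewrite Eq size_polyN size_Mmonic ?monicXsubC //.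
  rewrite size_XsubC addn2 /= => h; rewrite -ltnS (leq_trans h) // geq_max sp /=.
  by rewrite (leq_trans (size_polyC_leq1 _)).
apply: ratring_mul; first exact: ratring_cst.
apply: ratring_mul; first by apply: sT; exact: mem_head.
by have := IH 1 sT'; rewrite rmorph1 mul1r size_poly1; apply.
Qed.

(** In the coordinate Y = 1 / (W - b) the point a becomes 1 / (a - b), and 1 / (W - a) = (b - a)^-1
    Y / (Y - (a - b)^-1). *)
Lemma ratring_inv_sub W T (a b : K) : (forall c, W != cst c) ->
    (a != b -> (a - b)^-1 \in T) -> ratring (W - cst b)^-1 T (W - cst a)^-1.
Proof.
move=> nW aT; have [->|ab] := eqVneq a b; first exact: ratring_gen.
have key (F : fieldType) (w x y : F) : w - x != 0 -> w - y != 0 -> x != y ->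
    (w - x)^-1 = (y - x)^-1 * ((w - y)^-1 * ((w - y)^-1 - (x - y)^-1)^-1).
  move=> wx wy xy.
  have -> : (w - y)^-1 - (x - y)^-1 = - (w - x) / (w - y) / (x - y).
    by field; rewrite wy subr_eq0 xy.
  by field; rewrite ?oppr_eq0 wx wy !subr_eq0 xy eq_sym xy.
have a0 := sub_cst_neq0 nW a; have b0 := sub_cst_neq0 nW b.
have cab : cst a != cst b by rewrite (inj_eq (inj_comp (@tofrac_inj K) (@polyC_inj K))).
rewrite (key _ _ _ _ a0 b0 cab) -(rmorphB cst b a) -(rmorphB cst a b) -!(fmorphV cst).
apply: ratring_mul; first exact: ratring_cst.
by apply: ratring_mul; [exact: ratring_gen|apply: ratring_pole; exact: aT].
Qed.

Lemma inv_sub_nonconstant W b : (forall a, W != cst a) -> forall a, (W - cst b)^-1 != cst a.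
Proof.
move=> nW a; apply/eqP => Ya; have /eqP := nW (a^-1 + b); apply.
have e : W - cst b = cst a^-1 by rewrite (fmorphV cst) -[LHS]invrK Ya.
by rewrite -[LHS](subrK (cst b)) e; exact: esym (rmorphD cst _ _).
Qed.

Lemma ratring_finite_at_infinity W P T n d (b : K) : (forall a, W != cst a) ->
    pev cst W d != 0 -> P * pev cst W d = pev cst W n -> (size n <= size d)%N ->
    (forall a, root d a -> a != b -> (a - b)^-1 \in T) ->
  ratring (W - cst b)^-1 T P.
Proof.
move=> nW d0 E snd dT; have [s [c [-> sd rd]]] := pole_decomposition nW d0 E.
apply: ratring_mul; first exact: ratring_cst.
apply: ratring_proper => //; last by rewrite -sd.
by move=> a; rewrite rd => ra; apply: ratring_inv_sub => //; exact: dT.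
Qed.

End RatringMembership.

(** * Two coordinates on the sphere *)

Section Charts.
Variable R : realType.
Local Notation K := R[i].
Local Notation Re := (@complex.Re R).
Local Notation Im := (@complex.Im R).
Local Notation cst := (@tofrac {poly K} \o polyC).

Definition affine_chart (x : CP1 R) : K^o := if x is Some z then z else 0.

(** Here 0 is the true value at infinity, unlike in [affine_chart]; the default sits at [b], where
    the inverse of 0 is 0. *)
Definition inversion_chart (b : K) (x : CP1 R) : K^o := if x is Some z then (z - b)^-1 else 0.

Lemma affine_chart_continuous (x : CP1 R) : x <> None -> {for x, continuous affine_chart}.
Proof. by case: x => // z _; exact: cvg_id. Qed.

Lemma normc_le_inv (z : K) (M : R) : 0 < M -> M < `|Re z| \/ M < `|Im z| -> `|z^-1| <= (M^-1)%:C%C.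
Proof.
move=> M0 h; have zM : M%:C%C < `|z|.
  case: h => h; [apply: lt_le_trans (normc_ge_Re z)|apply: lt_le_trans (normc_ge_Im z)];
    by rewrite ltcR.
have Mc : (0 : K) < M%:C%C by rewrite ltcR.
have -> : (M^-1)%:C%C = (M%:C%C)^-1 :> K by rewrite fmorphV.
by rewrite normrV ?unitfE -?normr_gt0 ?(lt_trans Mc) // lef_pV2 ?ltW ?posrE // (lt_trans Mc).
Qed.

Lemma compact_rectangle (b : K) (M : R) :
  compact ((fun x : R * R => Complex x.1 x.2 : K^o) @`
    (`[Re b - M, Re b + M]%classic `*` `[Im b - M, Im b + M]%classic)).
Proof.
apply: continuous_compact; first by apply: continuous_subspaceT; exact: Complex_continuous.
by apply: compact_setX; exact: segment_compact.
Qed.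

(** The complement of a large closed rectangle around b is a neighborhood of infinity on which 1 /
    (z - b) is small. *)
Lemma inversion_chart_continuous b (x : CP1 R) : x <> Some b ->
  {for x, continuous (inversion_chart b)}.
Proof.
case: x => [z zb|_].
  have zb0 : z - b != 0 by rewrite subr_eq0; apply/eqP => e; apply: zb; rewrite e.
  have : {for z, continuous (fun w : K^o => (w - b)^-1 : K^o)}.
    have c0 : {for z, continuous (fun w : K^o => w - b : K^o)}.
      by apply: (@cvgB K K^o _ (nbhs z) _ id (fun=> b)); [exact: cvg_id|exact: cvg_cst].
    exact: (@cvgV K _ (nbhs z) _ (fun w : K^o => w - b : K^o) _ zb0 c0).
  exact.
move=> A /nbhs_ballP[e /= e0 hA].
have e1 : 0 < Re e by move: e0; rewrite ltcE /= => /andP[_].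
have Ee : e = (Re e)%:C%C by move: e0; rewrite ltcE /= => /andP[/eqP h _]; case: (e) h => u v /= ->.
(* The factor 2 makes the bound 1 / M strictly smaller than the radius [e]. *)
pose M := 2 / Re e; have M0 : 0 < M by rewrite divr_gt0.
have cC := @compact_rectangle b M.
exists ((fun x : R * R => Complex x.1 x.2 : K^o) @`
    (`[Re b - M, Re b + M]%classic `*` `[Im b - M, Im b + M]%classic)).
  by split => //; apply: compact_closed => //; exact: norm_hausdorff.
move=> _ [[z nz <-]|->]; last first.
  by apply: hA; rewrite /ball /= subrr normr0.
apply: hA; rewrite /ball /= sub0r normrN Ee.
have : M < `|Re (z - b)| \/ M < `|Im (z - b)|.
  apply/not_notP => /not_orP[/negP h1 /negP h2]; apply: nz.
  move: h1 h2; rewrite -!leNgt !raddfB /= !ler_norml => /andP[h1 h2] /andP[h3 h4].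
  exists (Re z, Im z); last by case: (z).
  by split; rewrite /= in_itv /=; apply/andP; split; lra.
move=> /(normc_le_inv M0) h; apply: le_lt_trans h _; rewrite ltcR /M invf_div.
by rewrite ltr_pdivrMr // ltr_pMr // ltr1n.
Qed.

Lemma inv_frac_sub (F : fieldType) (x c y : F) : y != 0 -> (x / y - c)^-1 = y / (x - c * y).
Proof. by move=> y0; rewrite -{1}[c](mulfK y0) -mulrBl invf_div. Qed.

(** [W] may have a pole at [z]: there 1 / (W - b) is regular with value 0. *)
Lemma rateval_inversion (W : ratfun K) b z : ratmap W (Some z : CP1 R) <> Some b ->
  regular (W - cst b)^-1 z /\
  rateval (W - cst b)^-1 z = inversion_chart b (ratmap W (Some z : CP1 R)).
Proof.
move=> Wb; pose n := ratnum W; pose d := ratden W.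
have E : (W - cst b)^-1 = tofrac d / tofrac (n - b%:P * d).
  rewrite {1}[W]ratfunE (inv_frac_sub _ (cst b)) ?tofrac_eq0 ?ratden_neq0 //.
  by rewrite tofracB tofracM.
have nd : (n - b%:P * d).[z] != 0.
  rewrite hornerD hornerN hornerM hornerC subr_eq0; apply/eqP => e.
  have [d0|d0] := eqVneq d.[z] 0.
    have nz : root n z by rewrite rootE e d0 mulr0.
    by have := coprimep_root (coprimep_ratnum_ratden W) nz; rewrite -/d d0 eqxx.
  apply: Wb; rewrite /ratmap (negPf d0) /rateval -/n -/d e mulfK //.
have [r ->] := rateval_frac E nd; split => //.
rewrite /ratmap -/d; have [d0|d0] := eqVneq d.[z] 0; first by rewrite d0 mul0r.
rewrite /= /rateval -/n -/d hornerD hornerN hornerM hornerC.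
by rewrite inv_frac_sub.
Qed.

End Charts.

(** * From the factorization to vanishing moments *)

Section Sufficiency.
Variable R : realType.
Local Notation K := R[i].
Local Notation cst := (@tofrac {poly K} \o polyC).
Variables (gamma : R -> K) (P Q : ratfun K).
Hypothesis gamma_smooth : piecewise_smooth gamma.
Hypotheses (nP : rat_nonconstant P) (nQ : rat_nonconstant Q).
Hypothesis no_poles : forall t : R, t \in `[0, 1] ->
  ~ poles P (Some (gamma t)) /\ ~ poles Q (Some (gamma t)).

(** [chart] is a coordinate continuous on [A], and Y is its expression along the curve.
    Null-homology in [A] makes the argument of Y - a return to its initial value for each a in [T],
    so that all logarithmic integrals vanish. *)
Lemma moments_of_chart (A : set (CP1 R)) (c : R -> CP1 R) (chart : CP1 R -> K^o)
    (Y : ratfun K) (T : seq K) :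
    homologous_to_zero A c -> closed_curve c ->
    (forall x, A x -> {for x, continuous chart}) -> along gamma Y ->
    (forall t, 0 <= t <= 1 -> rateval Y (gamma t) = chart (c t)) ->
    (forall a, Y != cst a) -> (forall a x, a \in T -> A x -> chart x != a) ->
    ratring Y T P -> ratring Y T Q ->
  forall i j, vint gamma (P ^+ i * Q ^+ j * ratderiv Q).
Proof.
move=> hc cl cchart aY Yc nY AT rP rQ i j.
have Ac t : 0 <= t <= 1 -> A (c t).
  by case: hc => [[_ cA] _] t01; apply: cA; exists t => //=; rewrite in_itv.
have Y01 : rateval Y (gamma 0) = rateval Y (gamma 1) by rewrite !Yc ?lexx ?ler01 // cl.
have YT a t : a \in T -> 0 <= t <= 1 -> rateval Y (gamma t) != a.
  by move=> aT t01; rewrite Yc //; apply: AT => //; exact: Ac.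
apply: vint_moment rP rQ => // a aT.
have cp : continuous (fun w : K^o => plane_point (w - a)).
  have cs : continuous (fun w : K^o => w - a : K^o).
    by move=> z; apply: (@cvgB K K^o _ (nbhs z) _ id (fun=> a)); [exact: cvg_id|exact: cvg_cst].
  apply: pair_continuous; first exact: continuous_compT cs (@Re_continuous R).
  exact: continuous_compT cs (@Im_continuous R).
have [||theta [ct pt t01]] := @homologous_closed_angle R _ A c (fun x => plane_point (chart x - a)) hc.
- move=> x Ax; apply: (@continuous_comp _ _ _ chart (fun w : K^o => plane_point (w - a))).
    exact: cchart.
  exact: cp.
- by move=> x Ax; rewrite plane_point_eq0 subr_eq0; exact: AT.
split.
  by apply: alongM; [apply: along_inv_sub => // t; exact: YT|exact: along_ratderiv].
rewrite (contour_log gamma_smooth aY (fun t => YT a t aT) ct _ Y01).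
  by rewrite t01 subrr.
by move=> t ht; rewrite Yc //; exact: pt.
Qed.

Lemma moments_of_one_side :
    (exists Pt Qt W : ratfun R[i],
      [/\ forall x : CP1 R, ratmap P x = ratmap Pt (ratmap W x),
          forall x : CP1 R, ratmap Q x = ratmap Qt (ratmap W x),
          closed_curve (image_curve W gamma) &
          on_one_side (poles Pt `|` poles Qt) (image_curve W gamma)]) ->
  forall i j, contour_integral gamma (fun z =>
    rateval P z ^+ i * rateval Q z ^+ j * rateval (ratderiv Q) z) = 0.
Proof.
move=> [Pt [Qt [W [EP EQ cl [_ hz]]]]] i j.
rewrite -(contour_integral_moment no_poles).
suff : forall i j, vint gamma (P ^+ i * Q ^+ j * ratderiv Q) by move=> /(_ i j)[].
have [dP eP] := ratmap_comp_inv EP; have [dQ eQ] := ratmap_comp_inv EQ.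
have nW a : W != cst a.
  apply/eqP => Wa; move: dQ eQ; rewrite Wa !pev_cst => dQ eQ.
  apply: (nQ (c := (ratnum Qt).[a] / (ratden Qt).[a])).
  rewrite -[LHS](mulfK dQ) eQ.
  by rewrite -[RHS]/(cst _) (rmorphM cst) (fmorphV cst).
have image_notin (t : R) : 0 <= t <= 1 -> (~` (poles Pt `|` poles Qt)) (image_curve W gamma t).
  by case: hz => [[_ cA] _] t01; apply: cA; exists t => //=; rewrite in_itv.
have [S ES] := closed_field_poly_normal (ratden Pt * ratden Qt).
have rS a : (a \in S) = root (ratden Pt * ratden Qt) a.
  by rewrite ES rootZ ?root_prod_XsubC // lead_coef_eq0 mulf_neq0 ?ratden_neq0.
have S_pole a : a \in S -> (poles Pt `|` poles Qt) (Some a).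
  rewrite rS rootM => /orP[] /eqP r; [left|right]; by rewrite /poles /= r eqxx.
have rP a : root (ratden Pt) a -> a \in S by rewrite rS rootM => ->.
have rQ a : root (ratden Qt) a -> a \in S by rewrite rS rootM => ->; rewrite orbT.
have [inf|ninf] := pselect ((poles Pt `|` poles Qt) None).
  have aW : along gamma W.
    move=> t t01; apply/negP => /eqP r; apply: (image_notin _ t01).
    by rewrite /image_curve /ratmap r eqxx.
  apply: (moments_of_chart hz cl (chart := @affine_chart R) (Y := W) (T := S)) => //.
  - by move=> x nx; apply: affine_chart_continuous => xN; apply: nx; rewrite xN.
  - by move=> t t01; rewrite /image_curve ratmap_regular //; exact: aW.
  - move=> a [z|] aS nx; last by case: nx.
    by apply/eqP => za; apply: nx; rewrite [z]za; exact: S_pole.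
  - exact: ratring_pole_at_infinity dP eP rP.
  - exact: ratring_pole_at_infinity dQ eQ rQ.
have [sP sQ] : (size (ratnum Pt) <= size (ratden Pt))%N /\ (size (ratnum Qt) <= size (ratden Qt))%N.
  by split; rewrite leqNgt; apply/negP => /poles_infty h; apply: ninf; [left|right].
(* With no pole at infinity, [Qt] must have a finite pole, or else it and Q would be constant. The
   curve avoids this point, so it can be sent to infinity. *)
have [b rb] : exists b, root (ratden Qt) b.
  apply/closed_rootP/negP => /eqP s1; move: sQ; rewrite s1 => /size1_polyC en.
  have /eqP/size1_polyC ed : (size (ratden Qt) <= 1)%N == true by rewrite s1.
  move: dQ eQ; rewrite en ed !pevC => dQ eQ.
  apply: (nQ (c := (ratnum Qt)`_0 / (ratden Qt)`_0)); rewrite -[LHS](mulfK dQ) eQ.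
  by rewrite -[RHS]/(cst _) (rmorphM cst) (fmorphV cst).
(* The positions, in the coordinate 1 / (W - b), of the finite poles other than b. *)
pose T := [seq (a - b)^-1 | a <- S & a != b].
have inT a : a \in S -> a != b -> (a - b)^-1 \in T.
  by move=> aS ab; apply/mapP; exists a => //; rewrite mem_filter ab.
have nb x : (~` (poles Pt `|` poles Qt)) x -> x <> Some b.
  by move=> nx xb; apply: nx; rewrite xb; apply: S_pole; exact: rQ.
have Yc (t : R) : 0 <= t <= 1 -> regular (W - cst b)^-1 (gamma t) /\
    rateval (W - cst b)^-1 (gamma t) = inversion_chart b (image_curve W gamma t).
  by move=> t01; apply: rateval_inversion; apply: nb; exact: image_notin.
apply: (moments_of_chart hz cl (chart := @inversion_chart R b) (Y := (W - cst b)^-1) (T := T)).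
- by move=> x /nb; exact: inversion_chart_continuous.
- by move=> t /Yc[].
- by move=> t /Yc[].
- exact: inv_sub_nonconstant.
- move=> c x /mapP[a]; rewrite mem_filter => /andP[ab aS] -> nx; apply/eqP => e.
  move: nx; case: x e => [z|] /= e nx; last first.
    by move: ab; rewrite -subr_eq0 -invr_eq0 -e eqxx.
  by apply: nx; rewrite (_ : z = a); [exact: S_pole|move/invr_inj: e => /addIr].
- by apply: (ratring_finite_at_infinity nW dP eP sP) => a /rP; exact: inT.
- by apply: (ratring_finite_at_infinity nW dQ eQ sQ) => a /rQ; exact: inT.
Qed.

End Sufficiency.

Theorem theorem5p2 (R : realType) (P Q : ratfun R[i]) (gamma : R -> R[i])
    (i0 j0 : nat) (hP : rat_nonconstant P) (hQ : rat_nonconstant Q)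
    (hgamma : curve gamma)
    (hpoles : forall t : R, t \in `[0, 1] ->
       ~ poles P (Some (gamma t)) /\ ~ poles Q (Some (gamma t))) :
  ((forall i j : nat, (i0 <= i)%N -> (j0 <= j)%N ->
      contour_integral gamma (fun z =>
        rateval P z ^+ i * rateval Q z ^+ j * rateval (ratderiv Q) z) = 0)
   <->
   (exists Pt Qt W : ratfun R[i],
      [/\ forall x : CP1 R, ratmap P x = ratmap Pt (ratmap W x),
          forall x : CP1 R, ratmap Q x = ratmap Qt (ratmap W x),
          closed_curve (image_curve W gamma) &
          on_one_side (poles Pt `|` poles Qt) (image_curve W gamma)]))
  /\
  ((forall i j : nat, (i0 <= i)%N -> (j0 <= j)%N ->
      contour_integral gamma (fun z =>
        rateval P z ^+ i * rateval Q z ^+ j * rateval (ratderiv Q) z) = 0) ->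
   forall i j : nat,
      contour_integral gamma (fun z =>
        rateval P z ^+ i * rateval Q z ^+ j * rateval (ratderiv Q) z) = 0).
Proof.
have [gamma_smooth _] := hgamma.
have necessity := one_side_of_moments gamma_smooth hP hQ hpoles.
have sufficiency := moments_of_one_side gamma_smooth hQ hpoles.
split; last by move=> /necessity; exact: sufficiency.
by split=> [/necessity//|/sufficiency moments i j _ _]; exact: moments.
Qed.
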